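(* Let $0<\alpha<1$. Then the Hilbert matrix operator $\mathcal{H}$ is bounded on the logarithmically weighted Korenblum space $H^\infty_{\alpha,\log}$. Moreover, $$\|\mathcal{H}\|_{H^\infty_{\alpha,\log}\rightarrow H^\infty_{\alpha,\log}}=\sup_{0\leq r<1}\int_{0}^{1}\frac{(1+r)^{\alpha}\left((t-1)r+1\right)^{2\alpha-1}\log\frac{2e^{1/\alpha}}{1-r^2}}{(1-t)^{\alpha}\left((t-1)r+1+t\right)^{\alpha}\log\frac{2e^{1/\alpha}}{1-\left(\frac{t}{1-(1-t)r}\right)^2}}\,dt,$$ and $$\|\mathcal{H}\|_{H^\infty_{\alpha,\log}\rightarrow H^\infty_{\alpha,\log}}\geq\frac{\pi}{\sin\alpha\pi}.$$
   Context: $\mathbb{D}$ is the open unit disk in $\mathbb{C}$ and $H(\mathbb{D})$ is the set of analytic functions on $\mathbb{D}$; $\log$ is the natural logarithm. For $0<\alpha<1$, the logarithmically weighted Korenblum space $H^\infty_{\alpha,\log}$ is the space of all $f\in H(\mathbb{D})$ with $$\|f\|_{H^\infty_{\alpha,\log}}=\sup_{z\in\mathbb{D}}(1-|z|^2)^\alpha\log\frac{2e^{1/\alpha}}{1-|z|^2}\,|f(z)|<\infty.$$ The Hilbert matrix operator $\mathcal{H}$ acts on $f(z)=\sum_{k\ge 0}a_kz^k\in H(\mathbb{D})$ by $$\mathcal{H}f(z)=\sum_{n=0}^\infty\left(\sum_{k=0}^\infty\frac{a_k}{n+k+1}\right)z^n,$$ whenever the right-hand side makes sense and defines an analytic function in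 $\mathbb{D}$. For normed spaces $X,Y$ of analytic functions, $\|\mathcal{H}\|_{X\to Y}=\sup\{\|\mathcal{H}f\|_Y:\ f\in X,\ \|f\|_X\le 1\}$. *)

(* Defs.v *)
From Stdlib Require Import Reals.
From Coquelicot Require Import Coquelicot.
Open Scope R_scope.

Definition unit_disk (z : C) : Prop := Cmod z < 1.

(* Functions on the disk are represented by total functions [C -> C]; their
   values outside the disk are never used.  [ex_derive] is taken over the field
   [C], i.e. it is complex differentiability. *)
Definition analytic_on_disk (f : C -> C) : Prop :=
  forall z : C, unit_disk z -> ex_derive f z.

Definition log_factor (alpha x : R) : R :=
  ln (2 * exp (1 / alpha) / (1 - x ^ 2)).

(* Takes the value [p_infty] when the supremum is infinite. *)
Definition korenblum_log_norm (alpha : R) (f : C -> C) : Rbar :=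
  Lub_Rbar (fun y : R => exists z : C, unit_disk z /\
    y = Rpower (1 - Cmod z ^ 2) alpha * log_factor alpha (Cmod z) * Cmod (f z)).

Definition korenblum_log (alpha : R) (f : C -> C) : Prop :=
  analytic_on_disk f /\ Rbar_lt (korenblum_log_norm alpha f) p_infty.

Definition expansion_on_disk (a : nat -> C) (f : C -> C) : Prop :=
  forall z : C, unit_disk z -> is_pseries a z (f z).

(* The Hilbert matrix operator as a partial operator: [hilbert f g] says that
   the operator is defined at [f] (all the coefficient series converge and the
   resulting power series is analytic on the disk) and that its value is [g].
   The function [g] is determined by [f] on the disk. *)
Definition hilbert (f g : C -> C) : Prop :=
  exists a b : nat -> C,
    expansion_on_disk a f /\
    (forall n : nat,
       is_series (fun k : nat => Cdiv (a k) (RtoC (INR (n + k + 1)))) (b n)) /\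
    expansion_on_disk b g /\
    analytic_on_disk g.

Definition bounded_operator (X Y : (C -> C) -> Prop)
    (normX normY : (C -> C) -> Rbar) (T : (C -> C) -> (C -> C) -> Prop) : Prop :=
  exists M : R, forall f : C -> C, X f ->
    exists g : C -> C, T f g /\ Y g /\
      Rbar_le (normY g) (Rbar_mult (Finite M) (normX f)).

Definition operator_norm (X : (C -> C) -> Prop)
    (normX normY : (C -> C) -> Rbar) (T : (C -> C) -> (C -> C) -> Prop) : Rbar :=
  Rbar_lub (fun y : Rbar => exists f g : C -> C,
    X f /\ Rbar_le (normX f) (Finite 1) /\ T f g /\ y = normY g).

Definition hilbert_korenblum_log_norm (alpha : R) : Rbar :=
  operator_norm (korenblum_log alpha)
    (korenblum_log_norm alpha) (korenblum_log_norm alpha) hilbert.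

Definition norm_integrand (alpha r t : R) : R :=
  (Rpower (1 + r) alpha * Rpower ((t - 1) * r + 1) (2 * alpha - 1)
     * log_factor alpha r) /
  (Rpower (1 - t) alpha * Rpower ((t - 1) * r + 1 + t) alpha
     * log_factor alpha (t / (1 - (1 - t) * r))).

(* Main.v *)
(** The substitution t |-> t / (1 - (1 - t) z) turns H f (z), which is the
    integral of f (x) / (1 - x z) over [0, 1), into the integral of
    f (phi_t z) / (1 - (1 - t) z), where |phi_t z| <= phi_t |z|.  As the weight
    decreases with |z|, the norm is at most the supremum over r of the radial
    integrals.  The reciprocal of (1 - z^2)^al (ln 2 + 1 / al - ln (1 - z^2)) is in
    the unit ball and equals the reciprocal of the weight on [0, 1), so each radial
    integral is attained; the constant 2 e^(1/al) makes y^al (ln 2 + 1 / al - ln y)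
    increasing up to y = 2, which is the range of |1 - z^2|.
    As r -> 1 the integrand tends to t^(al-1) (1 - t)^(-al), whose integral is
    pi / sin (al pi).

    For al >= 1/2 the series of a_k / (n + k + 1) need not converge absolutely:
    its partial sums are compared with the integral of x^n f (x) over [0, 1 - 1/N]
    by means of the Taylor remainder on circles of radius 1 - 1/(2N) and 1 - 2/N. *)
Require Import Defs.
From Stdlib Require Import Reals Lra Lia ClassicalEpsilon.
From Coquelicot Require Import Coquelicot.
Open Scope R_scope.

(** * Complex differentiability and curves *)

(** The integrals that represent H f end at the boundary point 1, where f need not have a limit.
    They are therefore truncated at t < 1 and compared with their limits at the explicit rate (1 -
    t)^(1 - al), which the growth |f| = O((1 - |z|)^(-al)) provides. Changing the path then amounts
    to joining two truncated end points that are O(1 - t) apart.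

    The quotient of the two logarithms in the radial integrand is not bounded uniformly in r; it is
    only O(t^(-al/2)). The remaining factor is t^(al - 1) near 0, so half of the exponent can be
    spent on the logarithms without losing integrability.

    The value pi / sin (al pi) comes from Cauchy's theorem for e^(al z) / (1 + e^z) on the strip 0
    <= Im z <= th with th < pi. As th tends to pi the upper side approaches the pole pi i, and its
    rotated imaginary part concentrates at x = 0 with mass pi, which plays the part of the residue.

    Cauchy's theorem also yields the Taylor expansions with free choice of the circle, hence
    primitives on the disk, hence the change of path and the logarithm of 1 - z^2. *)

Definition Cderiv (f : C -> C) (z l : C) : Prop :=
  forall eps, 0 < eps -> exists delta, 0 < delta /\
    forall w, Cmod (w - z) < delta ->
      Cmod (f w - f z - l * (w - z)) <= eps * Cmod (w - z).

Lemma Cmod_minus_sym (x y : C) : Cmod (x - y) = Cmod (y - x).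
Proof. rewrite <- Cmod_opp. f_equal. ring. Qed.

Lemma Cmod_triangle_minus (x y : C) : Cmod x - Cmod y <= Cmod (x - y).
Proof.
  generalize (Cmod_triangle (x - y) y). replace (x - y + y)%C with x by ring. lra.
Qed.

Lemma Cmod_minus_le (x y : C) : Cmod (x - y) <= Cmod x + Cmod y.
Proof.
  unfold Cminus. eapply Rle_trans; [apply Cmod_triangle|]. rewrite Cmod_opp. lra.
Qed.

(** The balls of [C_UniformSpace] are squares, so the modulus can reach sqrt 2 times the radius; the
    factor 2 absorbs this. *)
Lemma Cball_Cmod (z w : C) (e : posreal) :
  @ball C_UniformSpace z e w -> Cmod (w - z) < 2 * e.
Proof.
  intros [H1 H2].
  unfold ball in H1, H2. simpl in H1, H2.
  unfold AbsRing_ball, abs, minus, plus, opp in H1, H2; simpl in H1, H2.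
  assert (He := cond_pos e).
  eapply Rle_lt_trans; [apply Cmod_2Rmax|].
  assert (Hm : Rmax (Rabs (fst (w - z)%C)) (Rabs (snd (w - z)%C)) < e).
  { apply Rmax_lub_lt; assumption. }
  assert (Hs : sqrt 2 < 2).
  { rewrite <- (sqrt_Rsqr 2) at 2 by lra. apply sqrt_lt_1; unfold Rsqr; lra. }
  assert (0 <= Rmax (Rabs (fst (w - z)%C)) (Rabs (snd (w - z)%C))).
  { eapply Rle_trans; [apply Rabs_pos|apply Rmax_l]. }
  assert (0 <= sqrt 2) by apply sqrt_pos.
  nra.
Qed.

(** Stated for arbitrary [K] and [V], so that one proof serves real derivatives and both structures
    that carry complex ones. *)
Lemma is_derive_iff_eps {K : AbsRing} {V : NormedModule K} (f : K -> V) (x : K) (l : V) :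
  is_derive f x l <->
  forall eps, 0 < eps -> exists d, 0 < d /\ forall y, abs (minus y x) < d ->
    norm (minus (minus (f y) (f x)) (scal (minus y x) l)) <= eps * abs (minus y x).
Proof.
  split.
  - intros [_ H] eps Heps.
    destruct (H x (fun P HP => HP) (mkposreal eps Heps)) as [d Hd].
    exists d. split; [apply cond_pos|]. intros y Hy. exact (Hd y Hy).
  - intros H. split; [apply is_linear_scal_l|]. intros x' Hx'.
    (* The derivative filter quantifies over every point to which the neighbourhoods of x converge;
       by separation this is x alone. *)
    assert (x = x') as <- by apply (is_filter_lim_locally_unique (V := AbsRing_NormedModule K)), Hx'.
    intros eps. destruct (H eps (cond_pos eps)) as [d [Hd Hd']].
    exists (mkposreal d Hd). intros y Hy. exact (Hd' y Hy).
Qed.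

Lemma is_derive_eps (f : R -> R) (x l : R) :
  is_derive f x l <->
  forall eps, 0 < eps -> exists d, 0 < d /\ forall y, Rabs (y - x) < d ->
    Rabs (f y - f x - l * (y - x)) <= eps * Rabs (y - x).
Proof.
  rewrite is_derive_iff_eps. split; intros H eps Heps; destruct (H eps Heps) as [d [Hd Hd']];
  exists d; (split; [exact Hd|]); intros y Hy; specialize (Hd' y Hy);
  [rewrite (Rmult_comm l)|rewrite (Rmult_comm l) in Hd']; exact Hd'.
Qed.

Lemma is_derive_Cderiv (f : C -> C) (z l : C) :
  is_derive (K := C_AbsRing) (V := C_NormedModule) f z l <-> Cderiv f z l.
Proof.
  rewrite is_derive_iff_eps. split; intros H eps Heps; destruct (H eps Heps) as [d [Hd Hd']];
  exists d; (split; [exact Hd|]); intros y Hy; specialize (Hd' y Hy);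
  [rewrite (Cmult_comm l)|rewrite (Cmult_comm l) in Hd']; exact Hd'.
Qed.

(* C_NormedModule and C as a normed module over itself carry different uniform structures in Coquelicot. *)
Lemma is_derive_Cderiv_ring (f : C -> C) (z l : C) :
  is_derive (K := C_AbsRing) (V := AbsRing_NormedModule C_AbsRing) f z l <-> Cderiv f z l.
Proof.
  rewrite <- is_derive_Cderiv, !is_derive_iff_eps. reflexivity.
Qed.

Lemma Cderiv_ext_loc (f g : C -> C) (z l : C) (d : R) :
  0 < d -> (forall w, Cmod (w - z) < d -> f w = g w) ->
  Cderiv f z l -> Cderiv g z l.
Proof.
  intros Hd Heq H eps Heps.
  destruct (H eps Heps) as [d' [Hd' H']].
  exists (Rmin d d'). split; [apply Rmin_pos; assumption|].
  intros w Hw. rewrite <- !Heq.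
  - apply H'. eapply Rlt_le_trans; [exact Hw|apply Rmin_r].
  - replace (z - z)%C with (RtoC 0) by ring. rewrite Cmod_0. exact Hd.
  - eapply Rlt_le_trans; [exact Hw|apply Rmin_l].
Qed.

Lemma Cderiv_ext (f g : C -> C) (z l : C) :
  (forall w, f w = g w) -> Cderiv f z l -> Cderiv g z l.
Proof. intros H. apply (Cderiv_ext_loc f g z l 1); [lra|]. intros; apply H. Qed.

Lemma Cderiv_const (c z : C) : Cderiv (fun _ => c) z 0.
Proof. apply is_derive_Cderiv. exact (is_derive_const (K := C_AbsRing) (V := C_NormedModule) c z). Qed.

Lemma Cderiv_id (z : C) : Cderiv (fun w => w) z 1.
Proof. apply is_derive_Cderiv_ring. exact (is_derive_id (K := C_AbsRing) z). Qed.

Lemma Cderiv_plus (f g : C -> C) (z a b : C) :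
  Cderiv f z a -> Cderiv g z b -> Cderiv (fun w => f w + g w)%C z (a + b).
Proof.
  rewrite <- !is_derive_Cderiv_ring. exact (is_derive_plus (V := AbsRing_NormedModule C_AbsRing) f g z a b).
Qed.

Lemma Cderiv_minus (f g : C -> C) (z a b : C) :
  Cderiv f z a -> Cderiv g z b -> Cderiv (fun w => f w - g w)%C z (a - b).
Proof.
  rewrite <- !is_derive_Cderiv_ring. exact (is_derive_minus (V := AbsRing_NormedModule C_AbsRing) f g z a b).
Qed.

Lemma Cderiv_lip (f : C -> C) (z l : C) :
  Cderiv f z l -> exists d, 0 < d /\ forall w, Cmod (w - z) < d ->
    Cmod (f w - f z) <= (Cmod l + 1) * Cmod (w - z).
Proof.
  intros H. destruct (H 1 Rlt_0_1) as [d [Hd H1]].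
  exists d. split; [exact Hd|]. intros w Hw. specialize (H1 w Hw).
  replace (f w - f z)%C with ((f w - f z - l * (w - z)) + l * (w - z))%C by ring.
  eapply Rle_trans; [apply Cmod_triangle|]. rewrite Cmod_mult. lra.
Qed.

Lemma Cderiv_cont (f : C -> C) (z l : C) :
  Cderiv f z l -> forall eps, 0 < eps -> exists d, 0 < d /\
    forall w, Cmod (w - z) < d -> Cmod (f w - f z) < eps.
Proof.
  intros H eps Heps. destruct (Cderiv_lip f z l H) as [d [Hd H1]].
  assert (Hl := Cmod_ge_0 l).
  assert (He : 0 < eps / (Cmod l + 1)) by (apply Rdiv_lt_0_compat; lra).
  exists (Rmin d (eps / (Cmod l + 1))). split; [apply Rmin_pos; assumption|].
  intros w Hw.
  specialize (H1 w (Rlt_le_trans _ _ _ Hw (Rmin_l _ _))).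
  assert (Hw2 := Rlt_le_trans _ _ _ Hw (Rmin_r _ _)).
  eapply Rle_lt_trans; [exact H1|].
  replace eps with ((Cmod l + 1) * (eps / (Cmod l + 1))) by (field; lra).
  apply Rmult_lt_compat_l; lra.
Qed.

Lemma Cderiv_mult (f g : C -> C) (z a b : C) :
  Cderiv f z a -> Cderiv g z b ->
  Cderiv (fun w => f w * g w)%C z (a * g z + f z * b).
Proof.
  rewrite <- !is_derive_Cderiv_ring. intros Hf Hg.
  exact (is_derive_mult (K := C_AbsRing) f g z a b Hf Hg Cmult_comm).
Qed.

Lemma Cderiv_scal (c : C) (f : C -> C) (z a : C) :
  Cderiv f z a -> Cderiv (fun w => c * f w)%C z (c * a).
Proof.
  intros H. replace (c * a)%C with (0 * f z + c * a)%C by ring.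
  apply (Cderiv_mult (fun _ => c) f); [apply Cderiv_const|exact H].
Qed.

Lemma Cderiv_comp (f g : C -> C) (z a b : C) :
  Cderiv f (g z) a -> Cderiv g z b -> Cderiv (fun w => f (g w)) z (a * b).
Proof.
  rewrite <- !is_derive_Cderiv_ring, Cmult_comm. exact (is_derive_comp (V := AbsRing_NormedModule C_AbsRing) f g z a b).
Qed.

Lemma Cderiv_inv (z : C) : z <> 0%C -> Cderiv (fun w => / w)%C z (- / (z * z)).
Proof.
  intros Hz eps Heps.
  assert (Hz0 : 0 < Cmod z) by (apply Cmod_gt_0; exact Hz).
  set (m := Cmod z) in *.
  (* The remainder is (w - z)^2 / (z^2 w). Once |w| >= m / 2 it is at most 2 h^2 / m^3 with h = |w -
     z|, and h <= e turns this into eps h. *)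
  set (e := eps * (m * m * m) / 2).
  assert (Hm3 : 0 < m * m * m) by (repeat apply Rmult_lt_0_compat; assumption).
  assert (He : 0 < e) by (unfold e; nra).
  exists (Rmin (m / 2) e). split; [apply Rmin_pos; lra|].
  intros w Hw.
  assert (Hw1 := Rlt_le_trans _ _ _ Hw (Rmin_l _ _)).
  assert (Hw2 := Rlt_le_trans _ _ _ Hw (Rmin_r _ _)).
  assert (Hwm : m / 2 <= Cmod w).
  { generalize (Cmod_triangle_minus z w). rewrite Cmod_minus_sym. fold m. lra. }
  assert (Hw0 : w <> 0%C) by (apply Cmod_gt_0; lra).
  replace (/ w - / z - - / (z * z) * (w - z))%C with ((w - z) * (w - z) / (z * z * w))%C
    by (field; split; assumption).
  rewrite Cmod_div by (repeat apply Cmult_neq_0; assumption).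
  rewrite !Cmod_mult. fold m. set (h := Cmod (w - z)) in *.
  assert (Hh : 0 <= h) by apply Cmod_ge_0.
  apply Rle_div_l.
  { repeat apply Rmult_lt_0_compat; lra. }
  assert (m * m * (m / 2) <= m * m * Cmod w) by (apply Rmult_le_compat_l; nra).
  assert (eps * h * (m * m * (m / 2)) <= eps * h * (m * m * Cmod w)).
  { apply Rmult_le_compat_l; [apply Rmult_le_pos; lra|assumption]. }
  replace (eps * h * (m * m * (m / 2))) with (h * e) in H0 by (unfold e; field).
  nra.
Qed.

Lemma Cderiv_div (f g : C -> C) (z a b : C) : g z <> 0%C ->
  Cderiv f z a -> Cderiv g z b ->
  Cderiv (fun w => f w / g w)%C z ((a * g z - f z * b) / (g z * g z)).
Proof.
  intros Hz Hf Hg.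
  replace ((a * g z - f z * b) / (g z * g z))%C
    with (a * / g z + f z * (- / (g z * g z) * b))%C by (field; exact Hz).
  apply (Cderiv_mult f (fun w => / g w)%C); [exact Hf|].
  apply (Cderiv_comp Cinv g); [|exact Hg]. apply Cderiv_inv, Hz.
Qed.

(** * The complex exponential *)

Definition cexp (z : C) : C := (exp (Re z) * cos (Im z), exp (Re z) * sin (Im z)).

Lemma cexp_plus (z w : C) : cexp (z + w) = (cexp z * cexp w)%C.
Proof.
  unfold cexp. rewrite re_plus, im_plus, exp_plus, cos_plus, sin_plus.
  unfold Cmult; simpl. f_equal; ring.
Qed.

Lemma cexp_0 : cexp 0 = 1%C.
Proof. unfold cexp; simpl. rewrite exp_0, cos_0, sin_0. unfold RtoC. f_equal; ring. Qed.

Lemma Cmod_cexp (z : C) : Cmod (cexp z) = exp (Re z).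
Proof.
  unfold Cmod, cexp; simpl.
  replace (exp (Re z) * cos (Im z) * (exp (Re z) * cos (Im z) * 1) +
           exp (Re z) * sin (Im z) * (exp (Re z) * sin (Im z) * 1))
    with ((exp (Re z))² * ((sin (Im z))² + (cos (Im z))²)) by (unfold Rsqr; ring).
  rewrite sin2_cos2, Rmult_1_r. apply sqrt_Rsqr. left; apply exp_pos.
Qed.

Lemma cexp_neq_0 (z : C) : cexp z <> 0%C.
Proof. apply Cmod_gt_0. rewrite Cmod_cexp. apply exp_pos. Qed.

Lemma cexp_opp (z : C) : cexp (- z) = (/ cexp z)%C.
Proof.
  assert (H : (cexp (- z) * cexp z = 1)%C).
  { rewrite <- cexp_plus. replace (- z + z)%C with (RtoC 0) by ring. apply cexp_0. }
  replace (cexp (- z)) with (cexp (- z) * cexp z / cexp z)%C by (field; apply cexp_neq_0).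
  rewrite H. field. apply cexp_neq_0.
Qed.

Lemma Cmod_le_Rabs (z : C) : Cmod z <= Rabs (Re z) + Rabs (Im z).
Proof.
  replace z with (RtoC (Re z) + Ci * RtoC (Im z))%C at 1.
  - eapply Rle_trans; [apply Cmod_triangle|].
    rewrite Cmod_mult, !Cmod_R.
    assert (Cmod Ci = 1).
    { unfold Cmod, Ci; simpl. replace (0 * (0 * 1) + 1 * (1 * 1)) with 1 by ring. apply sqrt_1. }
    rewrite H. lra.
  - destruct z as [a b]. unfold Ci, RtoC, Cplus, Cmult; simpl. f_equal; ring.
Qed.

Lemma im_le_Cmod (z : C) : Rabs (Im z) <= Cmod z.
Proof.
  eapply Rle_trans; [apply Rmax_r|apply Rmax_Cmod].
Qed.

Lemma Cderiv_cexp_0 : Cderiv cexp 0 1.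
Proof.
  intros eps Heps.
  (* The real and the imaginary part of the remainder contribute at most 4 e h and 5 e h with h =
     |w|, so eps / 16 leaves room. *)
  set (e := Rmin 1 (eps / 16)).
  assert (He : 0 < e) by (apply Rmin_pos; lra).
  assert (He1 : e <= 1) by apply Rmin_l.
  assert (He8 : e <= eps / 16) by apply Rmin_r.
  assert (Dexp : is_derive exp 0 1).
  { replace 1 with (exp 0) by apply exp_0. apply is_derive_Reals, derivable_pt_lim_exp. }
  assert (Dsin : is_derive sin 0 1).
  { rewrite <- cos_0. apply is_derive_Reals, derivable_pt_lim_sin. }
  assert (Dcos : is_derive cos 0 0).
  { replace 0 with (- sin 0) at 2 by (rewrite sin_0; ring). apply is_derive_Reals, derivable_pt_lim_cos. }
  destruct (proj1 (is_derive_eps _ _ _) Dexp e He) as [d1 [Hd1 H1]].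
  destruct (proj1 (is_derive_eps _ _ _) Dsin e He) as [d2 [Hd2 H2]].
  destruct (proj1 (is_derive_eps _ _ _) Dcos e He) as [d3 [Hd3 H3]].
  (* Taking the radius at most e as well makes the second-order product in the imaginary part, (e^u
     - 1) sin v, of size e h. *)
  exists (Rmin e (Rmin d1 (Rmin d2 d3))). split; [apply Rmin_pos; [exact He|]; repeat apply Rmin_pos; assumption|].
  intros w Hw.
  replace (w - 0)%C with w in * by ring.
  rewrite cexp_0. replace (cexp w - 1 - 1 * w)%C with (cexp w - 1 - w)%C by ring.
  assert (Hu := re_le_Cmod w). assert (Hv := im_le_Cmod w).
  set (u := Re w) in *. set (v := Im w) in *. set (h := Cmod w) in *.
  assert (B0 : h < e) by (eapply Rlt_le_trans; [exact Hw|apply Rmin_l]).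
  assert (B := Rlt_le_trans _ _ _ Hw (Rmin_r _ _)).
  assert (B1 := Rlt_le_trans _ _ _ B (Rmin_l _ _)).
  assert (B' := Rlt_le_trans _ _ _ B (Rmin_r _ _)).
  assert (B2 := Rlt_le_trans _ _ _ B' (Rmin_l _ _)).
  assert (B3 := Rlt_le_trans _ _ _ B' (Rmin_r _ _)).
  specialize (H1 u). specialize (H2 v). specialize (H3 v).
  rewrite !Rminus_0_r, ?exp_0 in H1. rewrite !Rminus_0_r, ?sin_0 in H2.
  rewrite !Rminus_0_r, ?cos_0 in H3.
  specialize (H1 (Rle_lt_trans _ _ _ Hu B1)).
  specialize (H2 (Rle_lt_trans _ _ _ Hv B2)).
  specialize (H3 (Rle_lt_trans _ _ _ Hv B3)).
  assert (Hre : Re (cexp w - 1 - w)%C = (exp u - 1 - 1 * u) + ((exp u - 1 - 1 * u) + u + 1) * (cos v - 1 - 0 * v)).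
  { unfold cexp; simpl. fold u v. unfold Re in u. fold u. ring. }
  assert (Him : Im (cexp w - 1 - w)%C = ((exp u - 1 - 1 * u) + u) * ((sin v - 0 - 1 * v) + v) + (sin v - 0 - 1 * v)).
  { unfold cexp; simpl. fold u v. unfold Im in v. fold v. ring. }
  assert (Hh : 0 <= h) by apply Cmod_ge_0.
  eapply Rle_trans; [apply Cmod_le_Rabs|]. rewrite Hre, Him.
  set (A := exp u - 1 - 1 * u) in *. set (S := sin v - 0 - 1 * v) in *.
  replace (sin v - 1 * v) with S in H2 by (unfold S; ring).
  set (K := cos v - 1 - 0 * v) in *.
  assert (HA : Rabs A <= e * h) by (eapply Rle_trans; [exact H1|apply Rmult_le_compat_l; lra]).
  assert (HS : Rabs S <= e * h) by (eapply Rle_trans; [exact H2|apply Rmult_le_compat_l; lra]).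
  assert (HK : Rabs K <= e * h) by (eapply Rle_trans; [exact H3|apply Rmult_le_compat_l; lra]).
  assert (Heh : e * h <= 1) by nra.
  assert (P1 : Rabs (A + (A + u + 1) * K) <= e * h + 3 * (e * h)).
  { eapply Rle_trans; [apply Rabs_triang|]. apply Rplus_le_compat; [assumption|].
    rewrite Rabs_mult. apply Rmult_le_compat; [apply Rabs_pos|apply Rabs_pos| |assumption].
    eapply Rle_trans; [apply Rabs_triang|]. rewrite Rabs_R1.
    assert (Rabs (A + u) <= Rabs A + Rabs u) by apply Rabs_triang. lra. }
  assert (P2 : Rabs ((A + u) * (S + v) + S) <= 2 * h * (e * 1 + e) + e * h).
  { eapply Rle_trans; [apply Rabs_triang|]. apply Rplus_le_compat; [|assumption].
    rewrite Rabs_mult.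
    assert (Rabs (A + u) <= Rabs A + Rabs u) by apply Rabs_triang.
    assert (Rabs (S + v) <= Rabs S + Rabs v) by apply Rabs_triang.
    assert (e * h <= e * 1) by (apply Rmult_le_compat_l; lra).
    assert (e * h <= 1 * h) by (apply Rmult_le_compat_r; lra).
    apply Rmult_le_compat; [apply Rabs_pos|apply Rabs_pos| lra | lra]. }
  assert (16 * (e * h) <= eps * h) by nra.
  assert (0 <= e * h) by (apply Rmult_le_pos; lra).
  nra.
Qed.

(** The addition formula carries the derivative at 0 to every point. *)
Lemma Cderiv_cexp (z : C) : Cderiv cexp z (cexp z).
Proof.
  assert (H : Cderiv (fun w => cexp z * cexp (w - z))%C z (cexp z * (1 * (1 - 0)))%C).
  { apply Cderiv_scal. apply (Cderiv_comp cexp (fun w => w - z)%C).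
    - replace (z - z)%C with (RtoC 0) by ring. apply Cderiv_cexp_0.
    - apply Cderiv_minus; [apply Cderiv_id|apply Cderiv_const]. }
  replace (cexp z * (1 * (1 - 0)))%C with (cexp z) in H by ring.
  eapply Cderiv_ext; [|exact H]. intros w. simpl. rewrite <- cexp_plus. f_equal. ring.
Qed.

(** * Continuity and differentiation along curves *)

Definition Ccont_at (f : C -> C) (z : C) : Prop :=
  forall eps, 0 < eps -> exists d, 0 < d /\
    forall w, Cmod (w - z) < d -> Cmod (f w - f z) < eps.

Definition Ccont_curve (g : R -> C) (t : R) : Prop :=
  forall eps, 0 < eps -> exists d, 0 < d /\
    forall s, Rabs (s - t) < d -> Cmod (g s - g t) < eps.

Definition is_curve_derive (g : R -> C) (t : R) (l : C) : Prop :=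
  is_derive (fun s => Re (g s)) t (Re l) /\ is_derive (fun s => Im (g s)) t (Im l).

Lemma re_minus (a b : C) : Re (a - b) = Re a - Re b.
Proof. reflexivity. Qed.

Lemma im_minus (a b : C) : Im (a - b) = Im a - Im b.
Proof. reflexivity. Qed.

Lemma continuous_eps (f : R -> R) (t : R) :
  (forall eps, 0 < eps -> exists d, 0 < d /\ forall s, Rabs (s - t) < d -> Rabs (f s - f t) < eps) ->
  continuous f t.
Proof.
  intros H P [e He]. destruct (H e (cond_pos e)) as [d [Hd Hd']].
  exists (mkposreal d Hd). intros s Hs. apply He. apply (Hd' s Hs).
Qed.

Lemma Ccont_curve_Re (g : R -> C) (t : R) : Ccont_curve g t -> continuous (fun s => Re (g s)) t.
Proof.
  intros H. apply continuous_eps. intros eps Heps.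
  destruct (H eps Heps) as [d [Hd Hd']]. exists d. split; [exact Hd|].
  intros s Hs. rewrite <- re_minus. eapply Rle_lt_trans; [apply re_le_Cmod|]. apply Hd', Hs.
Qed.

Lemma Ccont_curve_Im (g : R -> C) (t : R) : Ccont_curve g t -> continuous (fun s => Im (g s)) t.
Proof.
  intros H. apply continuous_eps. intros eps Heps.
  destruct (H eps Heps) as [d [Hd Hd']]. exists d. split; [exact Hd|].
  intros s Hs. rewrite <- im_minus. eapply Rle_lt_trans; [apply im_le_Cmod|]. apply Hd', Hs.
Qed.

Lemma Ccont_curve_comp (f : C -> C) (g : R -> C) (t : R) :
  Ccont_at f (g t) -> Ccont_curve g t -> Ccont_curve (fun s => f (g s)) t.
Proof.
  intros Hf Hg eps Heps. destruct (Hf eps Heps) as [d [Hd H1]].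
  destruct (Hg d Hd) as [d' [Hd' H2]]. exists d'. split; [exact Hd'|].
  intros s Hs. apply H1, H2, Hs.
Qed.

Lemma Ccont_curve_Cmod (g : R -> C) (t : R) : Ccont_curve g t -> continuous (fun s => Cmod (g s)) t.
Proof.
  intros H. apply continuous_eps. intros eps Heps.
  destruct (H eps Heps) as [d [Hd Hd']]. exists d. split; [exact Hd|].
  intros s Hs. specialize (Hd' s Hs).
  assert (H1 := Cmod_triangle_minus (g s) (g t)).
  assert (H2 := Cmod_triangle_minus (g t) (g s)). rewrite Cmod_minus_sym in H2.
  apply Rabs_def1; lra.
Qed.

Lemma Cderiv_Ccont (f : C -> C) (z l : C) : Cderiv f z l -> Ccont_at f z.
Proof. intros H eps. apply (Cderiv_cont f z l H). Qed.

(** The form by components suits the real fundamental theorem of calculus; this form by moduli suits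
    the chain rule with a complex outer function. *)
Lemma is_curve_derive_eps (g : R -> C) (t : R) (l : C) :
  is_curve_derive g t l <-> forall eps, 0 < eps -> exists d, 0 < d /\ forall s, Rabs (s - t) < d ->
    Cmod (g s - g t - l * RtoC (s - t)) <= eps * Rabs (s - t).
Proof.
  assert (Hr : forall s, Re (g s - g t - l * RtoC (s - t))%C = Re (g s) - Re (g t) - Re l * (s - t)).
  { intros s. unfold Cminus. rewrite !re_plus, !re_opp, re_scal_r. ring. }
  assert (Hi : forall s, Im (g s - g t - l * RtoC (s - t))%C = Im (g s) - Im (g t) - Im l * (s - t)).
  { intros s. unfold Cminus. rewrite !im_plus, !im_opp, im_scal_r. ring. }
  split.
  - intros [H1 H2] eps Heps.
    destruct (proj1 (is_derive_eps _ _ _) H1 (eps / 2)) as [d1 [Hd1 E1]]; [lra|].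
    destruct (proj1 (is_derive_eps _ _ _) H2 (eps / 2)) as [d2 [Hd2 E2]]; [lra|].
    exists (Rmin d1 d2). split; [apply Rmin_pos; assumption|]. intros s Hs.
    specialize (E1 s (Rlt_le_trans _ _ _ Hs (Rmin_l _ _))).
    specialize (E2 s (Rlt_le_trans _ _ _ Hs (Rmin_r _ _))).
    eapply Rle_trans; [apply Cmod_le_Rabs|]. rewrite Hr, Hi. lra.
  - intros H. split; apply is_derive_eps; intros eps Heps;
    destruct (H eps Heps) as [d [Hd Hd']]; exists d; (split; [exact Hd|]);
    intros s Hs; specialize (Hd' s Hs).
    + rewrite <- Hr. eapply Rle_trans; [apply re_le_Cmod|exact Hd'].
    + rewrite <- Hi. eapply Rle_trans; [apply im_le_Cmod|exact Hd'].
Qed.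

Lemma Ccont_curve_RtoC (t : R) : Ccont_curve RtoC t.
Proof.
  intros eps Heps. exists eps. split; [exact Heps|]. intros s Hs.
  rewrite <- RtoC_minus, Cmod_R. exact Hs.
Qed.

Lemma is_curve_derive_comp (f : C -> C) (g : R -> C) (t : R) (a l : C) :
  Cderiv f (g t) a -> is_curve_derive g t l -> is_curve_derive (fun s => f (g s)) t (a * l).
Proof.
  intros Hf Hg. apply is_curve_derive_eps. rewrite is_curve_derive_eps in Hg. intros eps Heps.
  assert (Ha := Cmod_ge_0 a). assert (Hl := Cmod_ge_0 l).
  set (e1 := eps / (2 * (Cmod l + 1))).
  assert (He1 : 0 < e1) by (apply Rdiv_lt_0_compat; lra).
  set (e2 := eps / (2 * (Cmod a + 1))).
  assert (He2 : 0 < e2) by (apply Rdiv_lt_0_compat; lra).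
  destruct (Hf e1 He1) as [d1 [Hd1 H1]].
  destruct (Hg e2 He2) as [d2 [Hd2 H2]].
  destruct (Hg 1 Rlt_0_1) as [d3 [Hd3 H3]].
  assert (Hd4 : 0 < d1 / (Cmod l + 1)) by (apply Rdiv_lt_0_compat; lra).
  exists (Rmin (d1 / (Cmod l + 1)) (Rmin d2 d3)). split; [repeat apply Rmin_pos; assumption|].
  intros s Hs.
  assert (Hs1 := Rlt_le_trans _ _ _ Hs (Rmin_l _ _)).
  assert (Hs' := Rlt_le_trans _ _ _ Hs (Rmin_r _ _)).
  specialize (H2 s (Rlt_le_trans _ _ _ Hs' (Rmin_l _ _))).
  specialize (H3 s (Rlt_le_trans _ _ _ Hs' (Rmin_r _ _))).
  assert (L : Cmod (g s - g t) <= (Cmod l + 1) * Rabs (s - t)).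
  { replace (g s - g t)%C with ((g s - g t - l * RtoC (s - t)) + l * RtoC (s - t))%C by ring.
    eapply Rle_trans; [apply Cmod_triangle|]. rewrite Cmod_mult, Cmod_R. lra. }
  assert (L2 : Cmod (g s - g t) < d1).
  { eapply Rle_lt_trans; [exact L|].
    replace d1 with ((Cmod l + 1) * (d1 / (Cmod l + 1))) by (field; lra).
    apply Rmult_lt_compat_l; lra. }
  specialize (H1 _ L2).
  replace (f (g s) - f (g t) - a * l * RtoC (s - t))%C
    with ((f (g s) - f (g t) - a * (g s - g t)) + a * (g s - g t - l * RtoC (s - t)))%C by ring.
  eapply Rle_trans; [apply Cmod_triangle|]. rewrite Cmod_mult.
  set (h := Rabs (s - t)) in *. assert (Hh : 0 <= h) by apply Rabs_pos.
  assert (T1 : e1 * Cmod (g s - g t) <= e1 * ((Cmod l + 1) * h)) by (apply Rmult_le_compat_l; lra).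
  assert (T2 : Cmod a * Cmod (g s - g t - l * RtoC (s - t)) <= (Cmod a + 1) * (e2 * h)).
  { apply Rmult_le_compat; [assumption|apply Cmod_ge_0|lra|assumption]. }
  replace (e1 * ((Cmod l + 1) * h)) with (eps / 2 * h) in T1 by (unfold e1; field; lra).
  replace ((Cmod a + 1) * (e2 * h)) with (eps / 2 * h) in T2 by (unfold e2; field; lra).
  lra.
Qed.

Lemma is_curve_derive_RtoC (t : R) : is_curve_derive RtoC t 1.
Proof.
  split; simpl.
  - apply (is_derive_id (K := R_AbsRing) t).
  - apply (is_derive_const (K := R_AbsRing) (V := R_NormedModule) 0 t).
Qed.

Lemma is_curve_derive_Cderiv (f : C -> C) (t : R) (a : C) :
  Cderiv f (RtoC t) a -> is_curve_derive (fun s => f (RtoC s)) t a.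
Proof.
  intros H. replace a with (a * 1)%C by ring. apply is_curve_derive_comp; [exact H|apply is_curve_derive_RtoC].
Qed.

(** * Integrals of complex-valued functions of a real variable *)

Definition is_CInt (f : R -> C) (a b : R) (l : C) : Prop :=
  is_RInt (fun t => Re (f t)) a b (Re l) /\ is_RInt (fun t => Im (f t)) a b (Im l).

(** The total counterpart of [is_CInt], for use inside equations; the relation is what carries
    integrability. *)
Definition CInt (f : R -> C) (a b : R) : C :=
  (RInt (fun t => Re (f t)) a b, RInt (fun t => Im (f t)) a b).

Lemma is_CInt_unique (f : R -> C) (a b : R) (l : C) : is_CInt f a b l -> CInt f a b = l.
Proof.
  intros [H1 H2]. unfold CInt. rewrite (is_RInt_unique _ _ _ _ H1), (is_RInt_unique _ _ _ _ H2).
  destruct l; reflexivity.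
Qed.

Lemma CInt_correct (f : R -> C) (a b : R) :
  (forall t, Rmin a b <= t <= Rmax a b -> Ccont_curve f t) -> is_CInt f a b (CInt f a b).
Proof.
  intros H. split; simpl; apply (RInt_correct (V := R_CompleteNormedModule));
  apply (ex_RInt_continuous (V := R_CompleteNormedModule)); intros t Ht.
  - apply Ccont_curve_Re, H, Ht.
  - apply Ccont_curve_Im, H, Ht.
Qed.

Lemma CInt_correct_le (f : R -> C) (a b : R) :
  a <= b -> (forall t, a <= t <= b -> Ccont_curve f t) -> is_CInt f a b (CInt f a b).
Proof.
  intros Hab H. apply CInt_correct. rewrite Rmin_left, Rmax_right by exact Hab. exact H.
Qed.

Lemma is_CInt_ext (f g : R -> C) (a b : R) (l : C) :
  (forall t, Rmin a b < t < Rmax a b -> f t = g t) -> is_CInt f a b l -> is_CInt g a b l.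
Proof.
  intros H [H1 H2]. split; [eapply is_RInt_ext; [|exact H1]|eapply is_RInt_ext; [|exact H2]];
  intros t Ht; simpl; rewrite H by exact Ht; reflexivity.
Qed.

Lemma is_CInt_plus (f g : R -> C) (a b : R) (l m : C) :
  is_CInt f a b l -> is_CInt g a b m -> is_CInt (fun t => f t + g t)%C a b (l + m).
Proof.
  intros [H1 H2] [H3 H4]. split.
  - rewrite re_plus. eapply is_RInt_ext; [|exact (is_RInt_plus _ _ _ _ _ _ H1 H3)].
    intros; reflexivity.
  - rewrite im_plus. eapply is_RInt_ext; [|exact (is_RInt_plus _ _ _ _ _ _ H2 H4)].
    intros; reflexivity.
Qed.

Lemma is_CInt_scal (c : C) (f : R -> C) (a b : R) (l : C) :
  is_CInt f a b l -> is_CInt (fun t => c * f t)%C a b (c * l).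
Proof.
  intros [H1 H2].
  assert (A1 := is_RInt_scal _ _ _ (Re c) _ H1). assert (A2 := is_RInt_scal _ _ _ (Im c) _ H1).
  assert (B1 := is_RInt_scal _ _ _ (Re c) _ H2). assert (B2 := is_RInt_scal _ _ _ (Im c) _ H2).
  split.
  - rewrite re_mult. exact (is_RInt_minus _ _ _ _ _ _ A1 B2).
  - rewrite im_mult. exact (is_RInt_plus _ _ _ _ _ _ B1 A2).
Qed.

Lemma is_CInt_minus (f g : R -> C) (a b : R) (l m : C) :
  is_CInt f a b l -> is_CInt g a b m -> is_CInt (fun t => f t - g t)%C a b (l - m).
Proof.
  intros [H1 H2] [H3 H4]. split.
  - exact (is_RInt_minus _ _ _ _ _ _ H1 H3).
  - exact (is_RInt_minus _ _ _ _ _ _ H2 H4).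
Qed.

Lemma is_CInt_Chasles (f : R -> C) (a b c : R) (l m : C) :
  is_CInt f a b l -> is_CInt f b c m -> is_CInt f a c (l + m).
Proof.
  intros [H1 H2] [H3 H4]. split.
  - exact (is_RInt_Chasles _ _ _ _ _ _ H1 H3).
  - exact (is_RInt_Chasles _ _ _ _ _ _ H2 H4).
Qed.

Lemma is_CInt_const (c : C) (a b : R) : is_CInt (fun _ => c) a b (c * RtoC (b - a)).
Proof.
  split.
  - rewrite re_scal_r, Rmult_comm. apply (is_RInt_const (V := R_NormedModule) a b (Re c)).
  - rewrite im_scal_r, Rmult_comm. apply (is_RInt_const (V := R_NormedModule) a b (Im c)).
Qed.

Lemma is_CInt_shift (f : R -> C) (v a b : R) (l : C) :
  is_CInt f (a + v) (b + v) l -> is_CInt (fun t => f (t + v)) a b l.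
Proof.
  intros [H1 H2].
  rewrite <- (Rmult_1_l a), <- (Rmult_1_l b) in H1, H2.
  apply (is_RInt_comp_lin (V := R_NormedModule)) in H1, H2.
  split; [eapply is_RInt_ext; [|exact H1]|eapply is_RInt_ext; [|exact H2]];
  intros t _; unfold scal; simpl; unfold mult; simpl; rewrite !Rmult_1_l; reflexivity.
Qed.

Lemma is_CInt_FTC (F f : R -> C) (a b : R) :
  (forall t, Rmin a b <= t <= Rmax a b -> is_curve_derive F t (f t)) ->
  (forall t, Rmin a b <= t <= Rmax a b -> Ccont_curve f t) ->
  is_CInt f a b (F b - F a).
Proof.
  intros HD HC. split.
  - rewrite re_minus. apply (is_RInt_derive (V := R_CompleteNormedModule) (fun t => Re (F t))).
    + intros t Ht. apply (HD t Ht).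
    + intros t Ht. apply Ccont_curve_Re, HC, Ht.
  - rewrite im_minus. apply (is_RInt_derive (V := R_CompleteNormedModule) (fun t => Im (F t))).
    + intros t Ht. apply (HD t Ht).
    + intros t Ht. apply Ccont_curve_Im, HC, Ht.
Qed.

Lemma is_CInt_FTC_le (F f : R -> C) (a b : R) : a <= b ->
  (forall t, a <= t <= b -> is_curve_derive F t (f t)) ->
  (forall t, a <= t <= b -> Ccont_curve f t) ->
  is_CInt f a b (F b - F a).
Proof.
  intros Hab HD HC. apply is_CInt_FTC; rewrite Rmin_left, Rmax_right by exact Hab; assumption.
Qed.

(* Rotate so that the integral becomes a nonnegative real number. *)
Lemma Cmod_CInt_le (f : R -> C) (g : R -> R) (a b : R) (l : C) (m : R) :
  a <= b -> is_CInt f a b l -> is_RInt g a b m ->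
  (forall t, a < t < b -> Cmod (f t) <= g t) -> Cmod l <= m.
Proof.
  intros Hab Hf Hg Hle.
  destruct (Ceq_dec l 0) as [->|Hl].
  - rewrite Cmod_0. eapply is_RInt_ge_0; [exact Hab|exact Hg|].
    intros t Ht. eapply Rle_trans; [apply Cmod_ge_0|apply Hle, Ht].
  - assert (Hl0 : 0 < Cmod l) by (apply Cmod_gt_0; exact Hl).
    set (u := (Cconj l / RtoC (Cmod l))%C).
    assert (Hu : Cmod u = 1).
    { unfold u. rewrite Cmod_div by (intros E; apply RtoC_inj in E; lra).
      rewrite Cmod_conj, Cmod_R, Rabs_pos_eq by lra. field; lra. }
    assert (Hul : (u * l)%C = RtoC (Cmod l)).
    { unfold u. replace (Cconj l / RtoC (Cmod l) * l)%C with ((l * Cconj l) / RtoC (Cmod l))%C.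
      - rewrite <- Cmod2_conj. simpl. rewrite Rmult_1_r, RtoC_mult. field.
        intros E; apply RtoC_inj in E; lra.
      - field. intros E; apply RtoC_inj in E; lra. }
    apply (is_CInt_scal u) in Hf. rewrite Hul in Hf. destruct Hf as [Hf _]. clearbody u.
    change (Re (RtoC (Cmod l))) with (Cmod l) in Hf.
    eapply is_RInt_le; [exact Hab|exact Hf|exact Hg|].
    intros t Ht. eapply Rle_trans; [apply Rle_abs|].
    eapply Rle_trans; [apply re_le_Cmod|]. rewrite Cmod_mult, Hu, Rmult_1_l. apply Hle, Ht.
Qed.

Lemma Cmod_CInt_le_const (f : R -> C) (a b M : R) (l : C) :
  a <= b -> is_CInt f a b l -> (forall t, a < t < b -> Cmod (f t) <= M) ->
  Cmod l <= M * (b - a).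
Proof.
  intros Hab Hf Hle. rewrite Rmult_comm.
  eapply Cmod_CInt_le; [exact Hab|exact Hf|apply (is_RInt_const (V := R_NormedModule) a b M)|exact Hle].
Qed.

(** * Goursat's theorem *)

Lemma CInt_Chasles (f : R -> C) (a b c : R) :
  a <= b <= c -> (forall t, a <= t <= c -> Ccont_curve f t) ->
  (CInt f a b + CInt f b c)%C = CInt f a c.
Proof.
  intros Hab H. symmetry. apply is_CInt_unique.
  apply is_CInt_Chasles with b; apply CInt_correct;
  intros t; rewrite Rmin_left, Rmax_right by lra; intros Ht; apply H; lra.
Qed.

Lemma Ccont_curve_h (y t : R) : Ccont_curve (fun x => (x, y)) t.
Proof.
  intros eps Heps. exists eps. split; [exact Heps|]. intros s Hs.
  replace ((s, y) - (t, y))%C with (RtoC (s - t)).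
  - rewrite Cmod_R. exact Hs.
  - unfold Cminus, Cplus, Copp, RtoC; simpl. f_equal; ring.
Qed.

Lemma Ccont_curve_v (x t : R) : Ccont_curve (fun y => (x, y)) t.
Proof.
  intros eps Heps. exists eps. split; [exact Heps|]. intros s Hs.
  eapply Rle_lt_trans; [apply Cmod_le_Rabs|]. simpl.
  replace (x + - x) with 0 by ring. rewrite Rabs_R0, Rplus_0_l. exact Hs.
Qed.

Lemma is_curve_derive_h (y t : R) : is_curve_derive (fun x => (x, y)) t 1.
Proof.
  split; simpl.
  - apply (is_derive_id (K := R_AbsRing) t).
  - apply (is_derive_const (K := R_AbsRing) (V := R_NormedModule) y t).
Qed.

Lemma is_curve_derive_v (x t : R) : is_curve_derive (fun y => (x, y)) t Ci.
Proof.
  split; simpl.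
  - apply (is_derive_const (K := R_AbsRing) (V := R_NormedModule) x t).
  - apply (is_derive_id (K := R_AbsRing) t).
Qed.

Definition in_rect (x1 x2 y1 y2 : R) (w : C) : Prop :=
  x1 <= Re w <= x2 /\ y1 <= Im w <= y2.

(** The contour integral of f dz around the boundary, counterclockwise; dz = i dy on the vertical
    sides. *)
Definition rect_int (f : C -> C) (x1 x2 y1 y2 : R) : C :=
  (CInt (fun x => f (x, y1)) x1 x2 + Ci * CInt (fun y => f (x2, y)) y1 y2
   - CInt (fun x => f (x, y2)) x1 x2 - Ci * CInt (fun y => f (x1, y)) y1 y2)%C.

Lemma Ccont_curve_rect_h (f : C -> C) (x1 x2 y1 y2 y t : R) :
  (forall w, in_rect x1 x2 y1 y2 w -> Ccont_at f w) ->
  y1 <= y <= y2 -> x1 <= t <= x2 -> Ccont_curve (fun x => f (x, y)) t.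
Proof.
  intros H Hy Ht. apply (Ccont_curve_comp f (fun x => (x, y))).
  - apply H. split; assumption.
  - apply Ccont_curve_h.
Qed.

Lemma Ccont_curve_rect_v (f : C -> C) (x1 x2 y1 y2 x t : R) :
  (forall w, in_rect x1 x2 y1 y2 w -> Ccont_at f w) ->
  x1 <= x <= x2 -> y1 <= t <= y2 -> Ccont_curve (fun y => f (x, y)) t.
Proof.
  intros H Hy Ht. apply (Ccont_curve_comp f (fun y => (x, y))).
  - apply H. split; assumption.
  - apply Ccont_curve_v.
Qed.

Lemma rect_int_split_x (f : C -> C) (x1 x x2 y1 y2 : R) :
  x1 <= x <= x2 -> y1 <= y2 ->
  (forall w, in_rect x1 x2 y1 y2 w -> Ccont_at f w) ->
  rect_int f x1 x2 y1 y2 = (rect_int f x1 x y1 y2 + rect_int f x x2 y1 y2)%C.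
Proof.
  intros Hx Hy H. unfold rect_int.
  rewrite <- (CInt_Chasles (fun x => f (x, y1)) x1 x x2) by
    (try assumption; intros t Ht; apply (Ccont_curve_rect_h f x1 x2 y1 y2 y1 t H); lra).
  rewrite <- (CInt_Chasles (fun x => f (x, y2)) x1 x x2) by
    (try assumption; intros t Ht; apply (Ccont_curve_rect_h f x1 x2 y1 y2 y2 t H); lra).
  ring.
Qed.

Lemma rect_int_split_y (f : C -> C) (x1 x2 y1 y y2 : R) :
  x1 <= x2 -> y1 <= y <= y2 ->
  (forall w, in_rect x1 x2 y1 y2 w -> Ccont_at f w) ->
  rect_int f x1 x2 y1 y2 = (rect_int f x1 x2 y1 y + rect_int f x1 x2 y y2)%C.
Proof.
  intros Hx Hy H. unfold rect_int.
  rewrite <- (CInt_Chasles (fun y => f (x1, y)) y1 y y2) by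
    (try assumption; intros t Ht; apply (Ccont_curve_rect_v f x1 x2 y1 y2 x1 t H); lra).
  rewrite <- (CInt_Chasles (fun y => f (x2, y)) y1 y y2) by
    (try assumption; intros t Ht; apply (Ccont_curve_rect_v f x1 x2 y1 y2 x2 t H); lra).
  ring.
Qed.

Lemma Ci_mul_Ci : (Ci * Ci)%C = (-1)%C.
Proof. unfold Ci, Cmult, RtoC, Copp; simpl. f_equal; ring. Qed.

Lemma Cmod_Ci : Cmod Ci = 1.
Proof.
  unfold Cmod, Ci; simpl. replace (0 * (0 * 1) + 1 * (1 * 1)) with 1 by ring. apply sqrt_1.
Qed.

Lemma Cmod_rect_int_le (f : C -> C) (x1 x2 y1 y2 M : R) :
  x1 <= x2 -> y1 <= y2 ->
  (forall w, in_rect x1 x2 y1 y2 w -> Ccont_at f w) ->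
  (forall w, in_rect x1 x2 y1 y2 w -> Cmod (f w) <= M) ->
  Cmod (rect_int f x1 x2 y1 y2) <= 2 * M * ((x2 - x1) + (y2 - y1)).
Proof.
  intros Hx Hy Hc HM.
  assert (Hh : forall y, y1 <= y <= y2 -> Cmod (CInt (fun x => f (x, y)) x1 x2) <= M * (x2 - x1)).
  { intros y Hyy. apply (Cmod_CInt_le_const (fun x => f (x, y))); [exact Hx| |].
    - apply CInt_correct_le; [lra|]. intros t Ht.
      apply (Ccont_curve_rect_h f x1 x2 y1 y2 y t Hc); assumption.
    - intros t Ht. apply HM. split; simpl; lra. }
  assert (Hv : forall x, x1 <= x <= x2 -> Cmod (CInt (fun y => f (x, y)) y1 y2) <= M * (y2 - y1)).
  { intros x Hxx. apply (Cmod_CInt_le_const (fun y => f (x, y))); [exact Hy| |].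
    - apply CInt_correct_le; [lra|]. intros t Ht.
      apply (Ccont_curve_rect_v f x1 x2 y1 y2 x t Hc); assumption.
    - intros t Ht. apply HM. split; simpl; lra. }
  assert (A1 := Hh y1 ltac:(lra)). assert (A2 := Hh y2 ltac:(lra)).
  assert (A3 := Hv x1 ltac:(lra)). assert (A4 := Hv x2 ltac:(lra)).
  unfold rect_int.
  eapply Rle_trans; [apply Cmod_minus_le|].
  eapply Rle_trans; [apply Rplus_le_compat_r, Cmod_minus_le|].
  eapply Rle_trans; [apply Rplus_le_compat_r, Rplus_le_compat_r, Cmod_triangle|].
  rewrite !Cmod_mult, Cmod_Ci. lra.
Qed.

Lemma rect_int_primitive (F f : C -> C) (x1 x2 y1 y2 : R) :
  x1 <= x2 -> y1 <= y2 ->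
  (forall w, in_rect x1 x2 y1 y2 w -> Ccont_at f w) ->
  (forall w, in_rect x1 x2 y1 y2 w -> Cderiv F w (f w)) ->
  rect_int f x1 x2 y1 y2 = 0%C.
Proof.
  intros Hx Hy Hc HF.
  assert (Hh : forall y, y1 <= y <= y2 -> CInt (fun x => f (x, y)) x1 x2 = (F (x2, y) - F (x1, y))%C).
  { intros y Hyy. apply is_CInt_unique.
    apply (is_CInt_FTC_le (fun x => F (x, y))); [lra| |]; intros t Ht.
    - replace (f (t, y)) with (f (t, y) * 1)%C by ring.
      apply (is_curve_derive_comp F (fun x => (x, y))); [apply HF; split; assumption|apply is_curve_derive_h].
    - apply (Ccont_curve_rect_h f x1 x2 y1 y2 y t Hc); assumption. }
  assert (Hv : forall x, x1 <= x <= x2 -> (Ci * CInt (fun y => f (x, y)) y1 y2)%C = (F (x, y2) - F (x, y1))%C).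
  { intros x Hxx.
    (* Along a vertical line F has derivative i f, so the antiderivative of f in y is - i F. *)
    replace (CInt (fun y => f (x, y)) y1 y2) with (- Ci * F (x, y2) - - Ci * F (x, y1))%C.
    - replace (Ci * (- Ci * F (x, y2) - - Ci * F (x, y1)))%C
        with (- (Ci * Ci) * (F (x, y2) - F (x, y1)))%C by ring.
      rewrite Ci_mul_Ci. ring.
    - symmetry. apply is_CInt_unique.
      apply (is_CInt_FTC (fun y => - Ci * F (x, y))%C); intros t; rewrite Rmin_left, Rmax_right by lra; intros Ht.
      + replace (f (x, t)) with ((- Ci * f (x, t)) * Ci)%C.
        2:{ replace (- Ci * f (x, t) * Ci)%C with (- (Ci * Ci) * f (x, t))%C by ring.
            rewrite Ci_mul_Ci. ring. }
        apply (is_curve_derive_comp (fun w => - Ci * F w)%C (fun y => (x, y))); [|apply is_curve_derive_v].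
        apply Cderiv_scal, HF. split; assumption.
      + apply (Ccont_curve_rect_v f x1 x2 y1 y2 x t Hc); assumption. }
  unfold rect_int.
  rewrite (Hh y1), (Hh y2), (Hv x1), (Hv x2) by lra. ring.
Qed.

Lemma rect_int_minus (f g : C -> C) (x1 x2 y1 y2 : R) :
  x1 <= x2 -> y1 <= y2 ->
  (forall w, in_rect x1 x2 y1 y2 w -> Ccont_at f w) ->
  (forall w, in_rect x1 x2 y1 y2 w -> Ccont_at g w) ->
  rect_int (fun w => f w - g w)%C x1 x2 y1 y2 = (rect_int f x1 x2 y1 y2 - rect_int g x1 x2 y1 y2)%C.
Proof.
  intros Hx Hy Hf Hg.
  assert (Hh : forall y, y1 <= y <= y2 ->
    CInt (fun x => f (x, y) - g (x, y))%C x1 x2 = (CInt (fun x => f (x, y)) x1 x2 - CInt (fun x => g (x, y)) x1 x2)%C).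
  { intros y Hyy. apply is_CInt_unique. apply is_CInt_minus; apply CInt_correct; intros t;
    rewrite Rmin_left, Rmax_right by lra; intros Ht.
    - apply (Ccont_curve_rect_h f x1 x2 y1 y2 y t Hf); assumption.
    - apply (Ccont_curve_rect_h g x1 x2 y1 y2 y t Hg); assumption. }
  assert (Hv : forall x, x1 <= x <= x2 ->
    CInt (fun y => f (x, y) - g (x, y))%C y1 y2 = (CInt (fun y => f (x, y)) y1 y2 - CInt (fun y => g (x, y)) y1 y2)%C).
  { intros x Hxx. apply is_CInt_unique. apply is_CInt_minus; apply CInt_correct; intros t;
    rewrite Rmin_left, Rmax_right by lra; intros Ht.
    - apply (Ccont_curve_rect_v f x1 x2 y1 y2 x t Hf); assumption.
    - apply (Ccont_curve_rect_v g x1 x2 y1 y2 x t Hg); assumption. }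
  unfold rect_int.
  rewrite (Hh y1), (Hh y2), (Hv x1), (Hv x2) by lra. ring.
Qed.

(** The affine part of f at c has a polynomial primitive and integrates to 0. What remains is at
    most e |w - c| <= e S on a contour of length 2 S, where S is half the perimeter. *)
Lemma rect_int_local (f : C -> C) (c l : C) (x1 x2 y1 y2 e : R) :
  0 <= e -> in_rect x1 x2 y1 y2 c ->
  (forall w, in_rect x1 x2 y1 y2 w -> Ccont_at f w) ->
  (forall w, in_rect x1 x2 y1 y2 w -> Cmod (f w - f c - l * (w - c)) <= e * Cmod (w - c)) ->
  Cmod (rect_int f x1 x2 y1 y2) <= 2 * e * ((x2 - x1) + (y2 - y1)) ^ 2.
Proof.
  intros He [Hcx Hcy] Hf Hloc.
  assert (Hx : x1 <= x2) by lra. assert (Hy : y1 <= y2) by lra.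
  set (A := fun w : C => (f c + l * (w - c))%C).
  assert (HB : forall w, Cderiv (fun w => f c * w + (l / 2) * ((w - c) * (w - c)))%C w (A w)).
  { intros w. unfold A.
    replace (f c + l * (w - c))%C with (f c * 1 + (l / 2) * ((1 - 0) * (w - c) + (w - c) * (1 - 0)))%C.
    - apply Cderiv_plus; [apply Cderiv_scal, Cderiv_id|]. apply Cderiv_scal.
      apply (Cderiv_mult (fun w => w - c)%C (fun w => w - c)%C);
      apply Cderiv_minus; (apply Cderiv_id || apply Cderiv_const).
    - field. }
  assert (HA : forall w, Cderiv A w l).
  { intros w. unfold A. cut (Cderiv (fun w => f c + l * (w - c))%C w (0 + l * (1 - 0))).
    { replace (0 + l * (1 - 0))%C with l by ring. exact (fun H => H). }
    apply Cderiv_plus; [apply Cderiv_const|]. apply Cderiv_scal, Cderiv_minus; [apply Cderiv_id|apply Cderiv_const]. }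
  assert (HAc : forall w, Ccont_at A w) by (intros w; apply (Cderiv_Ccont A w l), HA).
  replace (rect_int f x1 x2 y1 y2) with (rect_int (fun w => f w - A w)%C x1 x2 y1 y2).
  2:{ rewrite rect_int_minus by auto.
      rewrite (rect_int_primitive _ A x1 x2 y1 y2 Hx Hy (fun w _ => HAc w) (fun w _ => HB w)). ring. }
  set (S := (x2 - x1) + (y2 - y1)).
  replace (2 * e * S ^ 2) with (2 * (e * S) * S) by ring.
  apply Cmod_rect_int_le; [assumption|assumption| |].
  - intros w Hw eps Heps.
    destruct (Hf w Hw (eps / 2)) as [d1 [Hd1 H1]]; [lra|].
    destruct (HAc w (eps / 2)) as [d2 [Hd2 H2]]; [lra|].
    exists (Rmin d1 d2). split; [apply Rmin_pos; assumption|]. intros v Hv.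
    specialize (H1 v (Rlt_le_trans _ _ _ Hv (Rmin_l _ _))).
    specialize (H2 v (Rlt_le_trans _ _ _ Hv (Rmin_r _ _))).
    replace (f v - A v - (f w - A w))%C with ((f v - f w) - (A v - A w))%C by ring.
    eapply Rle_lt_trans; [apply Cmod_minus_le|]. lra.
  - intros w Hw. unfold A.
    replace (f w - (f c + l * (w - c)))%C with (f w - f c - l * (w - c))%C by ring.
    eapply Rle_trans; [apply Hloc, Hw|]. apply Rmult_le_compat_l; [exact He|].
    eapply Rle_trans; [apply Cmod_le_Rabs|]. rewrite re_minus, im_minus.
    destruct Hw as [Hw1 Hw2]. unfold S. apply Rplus_le_compat; apply Rabs_le; lra.
Qed.

Lemma nested_intervals (a b : nat -> R) :
  (forall n, a n <= a (S n)) -> (forall n, b (S n) <= b n) -> (forall n, a n <= b n) ->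
  exists c, forall n, a n <= c <= b n.
Proof.
  intros Ha Hb Hab.
  assert (Ha' : forall n m, (n <= m)%nat -> a n <= a m).
  { intros n m H. induction H; [lra|]. eapply Rle_trans; [exact IHle|apply Ha]. }
  assert (Hb' : forall n m, (n <= m)%nat -> b m <= b n).
  { intros n m H. induction H; [lra|]. eapply Rle_trans; [apply Hb|exact IHle]. }
  assert (Hanb : forall m n, a m <= b n).
  { intros m n. destruct (Nat.le_ge_cases m n) as [H|H].
    - eapply Rle_trans; [apply Ha', H|apply Hab].
    - eapply Rle_trans; [apply Hab|apply Hb', H]. }
  destruct (completeness (fun x => exists n, x = a n)) as [c [Hc1 Hc2]].
  - exists (b 0%nat). intros x [n ->]. apply Hanb.
  - exists (a 0%nat). exists 0%nat. reflexivity.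
  - exists c. intros n. split.
    + apply Hc1. exists n. reflexivity.
    + apply Hc2. intros x [m ->]. apply Hanb.
Qed.

Section Bisection.
Variables (f : C -> C) (x0 y0 w h : R).
Hypothesis Hw : 0 <= w.
Hypothesis Hh : 0 <= h.
Hypothesis Hf : forall z, in_rect x0 (x0 + w) y0 (y0 + h) z -> exists l, Cderiv f z l.

(** A rectangle of level n is coded by its lower left corner p alone, since the level fixes its
    sides. *)
Let sub (n : nat) (p : R * R) : C :=
  rect_int f (fst p) (fst p + w / 2 ^ n) (snd p) (snd p + h / 2 ^ n).

Let inside (n : nat) (p : R * R) : Prop :=
  x0 <= fst p /\ fst p + w / 2 ^ n <= x0 + w /\ y0 <= snd p /\ snd p + h / 2 ^ n <= y0 + h.

(** The values 0 and 1 of i and j select one of the four quarters; as real numbers they let the four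
    cases share one computation. *)
Let child (n : nat) (p : R * R) (i j : R) : R * R :=
  (fst p + i * (w / 2 ^ S n), snd p + j * (h / 2 ^ S n)).

Local Lemma half_pow (a : R) (n : nat) : a / 2 ^ n = 2 * (a / 2 ^ S n).
Proof. simpl. field. apply pow_nonzero. lra. Qed.

Local Lemma div_pow_ge_0 (a : R) (n : nat) : 0 <= a -> 0 <= a / 2 ^ n.
Proof. intros H. apply Rdiv_le_0_compat; [exact H|]. apply pow_lt. lra. Qed.

Local Lemma child_inside (n : nat) (p : R * R) (i j : R) :
  0 <= i <= 1 -> 0 <= j <= 1 -> inside n p -> inside (S n) (child n p i j).
Proof.
  intros Hi Hj (H1 & H2 & H3 & H4). unfold inside, child; cbn [fst snd].
  assert (A := div_pow_ge_0 w (S n) Hw). assert (B := div_pow_ge_0 h (S n) Hh).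
  rewrite (half_pow w) in H2. rewrite (half_pow h) in H4.
  set (a := w / 2 ^ S n) in *. set (b := h / 2 ^ S n) in *.
  assert (0 <= i * a <= a) by (split; [apply Rmult_le_pos; lra|]; rewrite <- (Rmult_1_l a) at 2; apply Rmult_le_compat_r; lra).
  assert (0 <= j * b <= b) by (split; [apply Rmult_le_pos; lra|]; rewrite <- (Rmult_1_l b) at 2; apply Rmult_le_compat_r; lra).
  repeat split; lra.
Qed.

Local Lemma split4 (n : nat) (p : R * R) : inside n p ->
  sub n p = (sub (S n) (child n p 0 0) + sub (S n) (child n p 1 0)
    + sub (S n) (child n p 0 1) + sub (S n) (child n p 1 1))%C.
Proof.
  intros (H1 & H2 & H3 & H4). unfold sub, child; cbn [fst snd].
  assert (A := div_pow_ge_0 w (S n) Hw). assert (B := div_pow_ge_0 h (S n) Hh).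
  rewrite (half_pow w n), (half_pow h n) in *.
  set (a := w / 2 ^ S n) in *. set (b := h / 2 ^ S n) in *.
  destruct p as [x y]; simpl in *.
  assert (Hc : forall z, in_rect x (x + 2 * a) y (y + 2 * b) z -> Ccont_at f z).
  { intros z [Z1 Z2]. destruct (Hf z) as [l Hl]; [split; lra|]. exact (Cderiv_Ccont f z l Hl). }
  rewrite (rect_int_split_x f x (x + a) (x + 2 * a)) by (try exact Hc; lra).
  rewrite (rect_int_split_y f x (x + a) y (y + b) (y + 2 * b)).
  2,3: lra. 2:{ intros z [Z1 Z2]; apply Hc; split; lra. }
  rewrite (rect_int_split_y f (x + a) (x + 2 * a) y (y + b) (y + 2 * b)).
  2,3: lra. 2:{ intros z [Z1 Z2]; apply Hc; split; lra. }
  replace (x + 0 * a) with x by ring. replace (y + 0 * b) with y by ring.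
  replace (x + 1 * a) with (x + a) by ring. replace (y + 1 * b) with (y + b) by ring.
  replace (x + a + a) with (x + 2 * a) by ring. replace (y + b + b) with (y + 2 * b) by ring.
  ring.
Qed.

Local Lemma bisection_step (n : nat) (p : R * R) (K : R) :
  inside n p -> 4 * K <= Cmod (sub n p) ->
  exists i j, (0 <= i <= 1) /\ (0 <= j <= 1) /\ K <= Cmod (sub (S n) (child n p i j)).
Proof.
  intros Hin HK. rewrite (split4 n p Hin) in HK.
  destruct (Rle_dec K (Cmod (sub (S n) (child n p 0 0)))); [exists 0, 0; repeat split; lra|].
  destruct (Rle_dec K (Cmod (sub (S n) (child n p 1 0)))); [exists 1, 0; repeat split; lra|].
  destruct (Rle_dec K (Cmod (sub (S n) (child n p 0 1)))); [exists 0, 1; repeat split; lra|].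
  destruct (Rle_dec K (Cmod (sub (S n) (child n p 1 1)))); [exists 1, 1; repeat split; lra|].
  exfalso.
  assert (T := Cmod_triangle (sub (S n) (child n p 0 0) + sub (S n) (child n p 1 0)
    + sub (S n) (child n p 0 1)) (sub (S n) (child n p 1 1))).
  assert (T1 := Cmod_triangle (sub (S n) (child n p 0 0) + sub (S n) (child n p 1 0))
     (sub (S n) (child n p 0 1))).
  assert (T2 := Cmod_triangle (sub (S n) (child n p 0 0)) (sub (S n) (child n p 1 0))).
  lra.
Qed.

Local Lemma bisection_sequence (eta : R) : eta <= Cmod (rect_int f x0 (x0 + w) y0 (y0 + h)) ->
  exists p : nat -> R * R, forall n, inside n (p n) /\ eta / 4 ^ n <= Cmod (sub n (p n)) /\
    fst (p n) <= fst (p (S n)) /\ fst (p (S n)) + w / 2 ^ S n <= fst (p n) + w / 2 ^ n /\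
    snd (p n) <= snd (p (S n)) /\ snd (p (S n)) + h / 2 ^ S n <= snd (p n) + h / 2 ^ n.
Proof.
  intros Heta.
  (* The invariant is part of the type of the recursion, and indefinite description turns the
     existence of a quarter carrying its share of the integral into a choice at each level. *)
  set (T := fun n => {p : R * R | inside n p /\ eta / 4 ^ n <= Cmod (sub n p)}).
  assert (step : forall n (s : T n), {s' : T (S n) | exists i j, 0 <= i <= 1 /\ 0 <= j <= 1 /\
     proj1_sig s' = child n (proj1_sig s) i j}).
  { intros n [p [Hp1 Hp2]].
    apply ClassicalEpsilon.constructive_indefinite_description.
    destruct (bisection_step n p (eta / 4 ^ S n) Hp1) as (i & j & Hi & Hj & HK).
    { replace (4 * (eta / 4 ^ S n)) with (eta / 4 ^ n); [exact Hp2|].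
      simpl. field. apply pow_nonzero. lra. }
    exists (exist _ (child n p i j) (conj (child_inside n p i j Hi Hj Hp1) HK)).
    exists i, j. split; [exact Hi|]. split; [exact Hj|]. reflexivity. }
  assert (s0 : T 0%nat).
  { exists (x0, y0). split.
    - unfold inside; simpl. repeat split; lra.
    - unfold sub; simpl. rewrite !Rdiv_1_r. exact Heta. }
  set (s := fix s n : T n := match n with O => s0 | S m => proj1_sig (step m (s m)) end).
  exists (fun n => proj1_sig (s n)). intros n.
  destruct (proj2_sig (s n)) as [Hp1 Hp2]. split; [exact Hp1|]. split; [exact Hp2|].
  destruct (proj2_sig (step n (s n))) as (i & j & Hi & Hj & E).
  change (proj1_sig (step n (s n))) with (s (S n)) in E. rewrite E.
  unfold child; cbn [fst snd].
  assert (A := div_pow_ge_0 w (S n) Hw). assert (B := div_pow_ge_0 h (S n) Hh).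
  rewrite (half_pow w n), (half_pow h n).
  set (a := w / 2 ^ S n) in *. set (b := h / 2 ^ S n) in *.
  assert (0 <= i * a <= a) by (split; [apply Rmult_le_pos; lra|]; rewrite <- (Rmult_1_l a) at 2; apply Rmult_le_compat_r; lra).
  assert (0 <= j * b <= b) by (split; [apply Rmult_le_pos; lra|]; rewrite <- (Rmult_1_l b) at 2; apply Rmult_le_compat_r; lra).
  repeat split; lra.
Qed.

Lemma goursat_aux : rect_int f x0 (x0 + w) y0 (y0 + h) = 0%C.
Proof.
  apply Cmod_eq_0.
  destruct (Req_dec (Cmod (rect_int f x0 (x0 + w) y0 (y0 + h))) 0) as [E|E]; [exact E|exfalso].
  set (eta := Cmod (rect_int f x0 (x0 + w) y0 (y0 + h))) in *.
  assert (Heta : 0 < eta) by (generalize (Cmod_ge_0 (rect_int f x0 (x0 + w) y0 (y0 + h))); fold eta; lra).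
  destruct (bisection_sequence eta (Rle_refl _)) as [p Hp].
  destruct (nested_intervals (fun n => fst (p n)) (fun n => fst (p n) + w / 2 ^ n)) as [cx Hcx].
  1,2: intros n; apply (Hp n).
  { intros n. generalize (div_pow_ge_0 w n Hw). lra. }
  destruct (nested_intervals (fun n => snd (p n)) (fun n => snd (p n) + h / 2 ^ n)) as [cy Hcy].
  1,2: intros n; apply (Hp n).
  { intros n. generalize (div_pow_ge_0 h n Hh). lra. }
  set (c := (cx, cy) : C).
  destruct (Hf c) as [l Hl].
  { destruct (Hp 0%nat) as [(H1 & H2 & H3 & H4) _].
    specialize (Hcx 0%nat). specialize (Hcy 0%nat). split; simpl in *; lra. }
  set (S := w + h). assert (HS : 0 <= S) by (unfold S; lra).
  (* The local estimate at level n is 2 e S^2 / 4^n; this e makes 2 e S^2 < eta, against the lower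
     bound eta / 4^n kept by the bisection. *)
  set (e := eta / (4 * (S ^ 2 + 1))).
  assert (HS2 : 0 <= S ^ 2) by apply pow2_ge_0.
  assert (He : 0 < e) by (apply Rdiv_lt_0_compat; lra).
  destruct (Hl e He) as [d [Hd Hd']].
  assert (Hn : exists n, S / 2 ^ n < d).
  { destruct (pow_lt_1_zero (/ 2) ltac:(rewrite Rabs_pos_eq; lra) (d / (S + 1))) as [n Hn].
    { apply Rdiv_lt_0_compat; lra. }
    exists n. specialize (Hn n (le_n n)). rewrite pow_inv in Hn.
    assert (P : 0 < / 2 ^ n) by (apply Rinv_0_lt_compat, pow_lt; lra).
    rewrite Rabs_pos_eq in Hn by lra.
    apply (Rmult_lt_compat_r (S + 1)) in Hn; [|lra].
    replace (d / (S + 1) * (S + 1)) with d in Hn by (field; lra). unfold Rdiv. nra. }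
  destruct Hn as [n Hn].
  destruct (Hp n) as ((H1 & H2 & H3 & H4) & HK & _).
  specialize (Hcx n). specialize (Hcy n). simpl in Hcx, Hcy.
  assert (HB : Cmod (sub n (p n)) <= 2 * e * (S / 2 ^ n) ^ 2).
  { unfold sub.
    replace (S / 2 ^ n) with ((fst (p n) + w / 2 ^ n - fst (p n)) + (snd (p n) + h / 2 ^ n - snd (p n)))
      by (unfold S; field; apply pow_nonzero; lra).
    apply (rect_int_local f c l).
    - lra.
    - split; simpl; lra.
    - intros z [Z1 Z2]. destruct (Hf z) as [l' Hl']; [split; lra|]. exact (Cderiv_Ccont f z l' Hl').
    - intros z [Z1 Z2]. apply Hd'.
      eapply Rle_lt_trans; [|exact Hn].
      eapply Rle_trans; [apply Cmod_le_Rabs|]. rewrite re_minus, im_minus. simpl.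
      replace (S / 2 ^ n) with (w / 2 ^ n + h / 2 ^ n) by (unfold S; field; apply pow_nonzero; lra).
      apply Rplus_le_compat; apply Rabs_le; lra. }
  assert (P4 : 0 < 4 ^ n) by (apply pow_lt; lra).
  assert (E2 : 2 * e * (S / 2 ^ n) ^ 2 = 2 * e * S ^ 2 / 4 ^ n).
  { replace 4 with (2 * 2) by ring. rewrite Rpow_mult_distr. field. apply pow_nonzero; lra. }
  rewrite E2 in HB.
  assert (HC : eta / 4 ^ n <= 2 * e * S ^ 2 / 4 ^ n) by lra.
  apply Rmult_le_reg_r in HC; [|apply Rinv_0_lt_compat, P4].
  assert (e * (4 * (S ^ 2 + 1)) = eta) by (unfold e; field; lra).
  nra.
Qed.

End Bisection.

Lemma goursat (f : C -> C) (x1 x2 y1 y2 : R) :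
  x1 <= x2 -> y1 <= y2 ->
  (forall z, in_rect x1 x2 y1 y2 z -> exists l, Cderiv f z l) ->
  rect_int f x1 x2 y1 y2 = 0%C.
Proof.
  intros Hx Hy Hf.
  replace x2 with (x1 + (x2 - x1)) in * by ring. replace y2 with (y1 + (y2 - y1)) in * by ring.
  apply goursat_aux; [lra|lra|exact Hf].
Qed.

(** * Integrals over circles *)

Lemma continuous_eps_inv (f : R -> R) (t : R) : continuous f t ->
  forall eps, 0 < eps -> exists d, 0 < d /\ forall s, Rabs (s - t) < d -> Rabs (f s - f t) < eps.
Proof.
  intros H eps Heps.
  destruct (H (fun y => Rabs (y - f t) < eps)) as [d Hd].
  { exists (mkposreal eps Heps). intros y Hy. exact Hy. }
  exists d. split; [apply cond_pos|]. intros s Hs. apply Hd, Hs.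
Qed.

Lemma Ccont_curve_components (g : R -> C) (t : R) :
  continuous (fun s => Re (g s)) t -> continuous (fun s => Im (g s)) t -> Ccont_curve g t.
Proof.
  intros H1 H2 eps Heps.
  destruct (continuous_eps_inv _ _ H1 (eps / 2)) as [d1 [Hd1 E1]]; [lra|].
  destruct (continuous_eps_inv _ _ H2 (eps / 2)) as [d2 [Hd2 E2]]; [lra|].
  exists (Rmin d1 d2). split; [apply Rmin_pos; assumption|]. intros s Hs.
  specialize (E1 s (Rlt_le_trans _ _ _ Hs (Rmin_l _ _))).
  specialize (E2 s (Rlt_le_trans _ _ _ Hs (Rmin_r _ _))).
  eapply Rle_lt_trans; [apply Cmod_le_Rabs|]. rewrite re_minus, im_minus. lra.
Qed.

Lemma Ccont_curve_const (c : C) (t : R) : Ccont_curve (fun _ => c) t.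
Proof. apply Ccont_curve_components; apply continuous_const. Qed.

Lemma Ccont_curve_plus (f g : R -> C) (t : R) :
  Ccont_curve f t -> Ccont_curve g t -> Ccont_curve (fun s => f s + g s)%C t.
Proof.
  intros Hf Hg. apply Ccont_curve_components.
  - apply (continuous_plus (fun s => Re (f s)) (fun s => Re (g s))); apply Ccont_curve_Re; assumption.
  - apply (continuous_plus (fun s => Im (f s)) (fun s => Im (g s))); apply Ccont_curve_Im; assumption.
Qed.

Lemma Ccont_curve_mult (f g : R -> C) (t : R) :
  Ccont_curve f t -> Ccont_curve g t -> Ccont_curve (fun s => f s * g s)%C t.
Proof.
  intros Hf Hg. apply Ccont_curve_components.
  - apply (continuous_minus (fun s => Re (f s) * Re (g s)) (fun s => Im (f s) * Im (g s)));
    apply (continuous_mult (K := R_AbsRing)); (apply Ccont_curve_Re || apply Ccont_curve_Im); assumption.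
  - apply (continuous_plus (fun s => Re (f s) * Im (g s)) (fun s => Im (f s) * Re (g s)));
    apply (continuous_mult (K := R_AbsRing)); (apply Ccont_curve_Re || apply Ccont_curve_Im); assumption.
Qed.

Lemma Ccont_curve_ext (f g : R -> C) (t : R) :
  (forall s, f s = g s) -> Ccont_curve f t -> Ccont_curve g t.
Proof.
  intros E H eps Heps. destruct (H eps Heps) as [d [Hd Hd']]. exists d. split; [exact Hd|].
  intros s Hs. rewrite <- !E. apply Hd', Hs.
Qed.

Lemma Ccont_curve_opp (g : R -> C) (t : R) : Ccont_curve g t -> Ccont_curve (fun s => - g s)%C t.
Proof.
  intros Hg. apply (Ccont_curve_ext (fun s => (-1) * g s)%C); [intros; ring|].
  apply Ccont_curve_mult; [apply Ccont_curve_const|exact Hg].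
Qed.

Lemma Ccont_curve_minus (f g : R -> C) (t : R) :
  Ccont_curve f t -> Ccont_curve g t -> Ccont_curve (fun s => f s - g s)%C t.
Proof. intros Hf Hg. apply Ccont_curve_plus; [exact Hf|apply Ccont_curve_opp, Hg]. Qed.

Lemma Ccont_curve_inv (g : R -> C) (t : R) : g t <> 0%C -> Ccont_curve g t -> Ccont_curve (fun s => / g s)%C t.
Proof.
  intros H Hg. apply (Ccont_curve_comp Cinv g); [|exact Hg].
  exact (Cderiv_Ccont _ _ _ (Cderiv_inv _ H)).
Qed.

Lemma Ccont_curve_div (f g : R -> C) (t : R) :
  g t <> 0%C -> Ccont_curve f t -> Ccont_curve g t -> Ccont_curve (fun s => f s / g s)%C t.
Proof. intros H Hf Hg. apply Ccont_curve_mult; [exact Hf|apply Ccont_curve_inv; assumption]. Qed.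

Lemma Ccont_curve_pow (g : R -> C) (n : nat) (t : R) : Ccont_curve g t -> Ccont_curve (fun s => g s ^ n)%C t.
Proof.
  intros Hg. induction n.
  - exact (Ccont_curve_const 1 t).
  - apply (Ccont_curve_mult g (fun s => g s ^ n)%C); assumption.
Qed.

Lemma CInt_ext (f g : R -> C) (a b : R) : (forall t, f t = g t) -> CInt f a b = CInt g a b.
Proof. intros H. unfold CInt. f_equal; apply RInt_ext; intros t _; rewrite H; reflexivity. Qed.

Lemma CInt_correct_everywhere (f : R -> C) (a b : R) :
  (forall t, Ccont_curve f t) -> is_CInt f a b (CInt f a b).
Proof. intros H. apply CInt_correct. intros; apply H. Qed.

(** Meant for the difference quotient behind Cauchy's formula, which is only continuous at its
    centre. Four rectangles that avoid c are cut off; the square of side 2 e left around c has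
    integral O(e), because f is bounded near c. *)
Lemma goursat_except (f : C -> C) (x1 x2 y1 y2 : R) (c : C) :
  x1 < Re c < x2 -> y1 < Im c < y2 ->
  (forall z, in_rect x1 x2 y1 y2 z -> z <> c -> exists l, Cderiv f z l) ->
  Ccont_at f c ->
  rect_int f x1 x2 y1 y2 = 0%C.
Proof.
  destruct c as [p q]. cbn [Re Im fst snd]. intros Hp Hq Hf Hc.
  assert (Hcont : forall z, in_rect x1 x2 y1 y2 z -> Ccont_at f z).
  { intros z Hz. destruct (Ceq_dec z (p, q)) as [->|E]; [exact Hc|].
    destruct (Hf z Hz E) as [l Hl]. exact (Cderiv_Ccont f z l Hl). }
  destruct (Hc 1 Rlt_0_1) as [d [Hd Hd1]].
  set (M := Cmod (f (p, q)) + 1).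
  assert (HM : 0 < M) by (unfold M; generalize (Cmod_ge_0 (f (p, q))); lra).
  set (e0 := Rmin (Rmin (p - x1) (x2 - p)) (Rmin (q - y1) (y2 - q))).
  assert (He0 : 0 < e0) by (repeat apply Rmin_pos; lra).
  assert (B1 : e0 <= p - x1) by (eapply Rle_trans; [apply Rmin_l|apply Rmin_l]).
  assert (B2 : e0 <= x2 - p) by (eapply Rle_trans; [apply Rmin_l|apply Rmin_r]).
  assert (B3 : e0 <= q - y1) by (eapply Rle_trans; [apply Rmin_r|apply Rmin_l]).
  assert (B4 : e0 <= y2 - q) by (eapply Rle_trans; [apply Rmin_r|apply Rmin_r]).
  assert (key : forall e, 0 < e -> e <= e0 -> 2 * e < d -> Cmod (rect_int f x1 x2 y1 y2) <= 2 * M * (4 * e)).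
  { intros e He Hee Hed.
    assert (G : forall u1 u2 v1 v2, x1 <= u1 -> u1 <= u2 -> u2 <= x2 -> y1 <= v1 -> v1 <= v2 -> v2 <= y2 ->
      (u2 < p \/ p < u1 \/ v2 < q \/ q < v1) -> rect_int f u1 u2 v1 v2 = 0%C).
    { intros u1 u2 v1 v2 I1 I2 I3 I4 I5 I6 I7. apply goursat; [lra|lra|].
      intros z [Z1 Z2]. apply Hf; [split; lra|]. intros ->. cbn [Re Im fst snd] in *. lra. }
    rewrite (rect_int_split_x f x1 (p - e) x2) by (try exact Hcont; lra).
    rewrite (G x1 (p - e)) by lra.
    rewrite (rect_int_split_x f (p - e) (p + e) x2); [|lra|lra|].
    2:{ intros z [Z1 Z2]. apply Hcont. split; lra. }
    rewrite (G (p + e) x2) by lra.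
    rewrite (rect_int_split_y f (p - e) (p + e) y1 (q - e) y2); [|lra|lra|].
    2:{ intros z [Z1 Z2]. apply Hcont. split; lra. }
    rewrite (G (p - e) (p + e) y1 (q - e)) by lra.
    rewrite (rect_int_split_y f (p - e) (p + e) (q - e) (q + e) y2); [|lra|lra|].
    2:{ intros z [Z1 Z2]. apply Hcont. split; lra. }
    rewrite (G (p - e) (p + e) (q + e) y2) by lra.
    replace (0 + (0 + rect_int f (p - e) (p + e) (q - e) (q + e) + 0 + 0))%C
      with (rect_int f (p - e) (p + e) (q - e) (q + e)) by ring.
    replace (0 + (0 + (rect_int f (p - e) (p + e) (q - e) (q + e) + 0) + 0))%C
      with (rect_int f (p - e) (p + e) (q - e) (q + e)) by ring.
    replace (4 * e) with ((p + e - (p - e)) + (q + e - (q - e))) by ring.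
    apply Cmod_rect_int_le; [lra|lra| |].
    - intros z [Z1 Z2]. apply Hcont. split; lra.
    - intros z [Z1 Z2].
      assert (Hz : Cmod (z - (p, q)) < d).
      { eapply Rle_lt_trans; [apply Cmod_le_Rabs|]. rewrite re_minus, im_minus. cbn [Re Im fst snd].
        assert (Rabs (Re z - p) <= e) by (apply Rabs_le; unfold Re in *; lra).
        assert (Rabs (Im z - q) <= e) by (apply Rabs_le; unfold Im in *; lra).
        unfold Re, Im in *. lra. }
      specialize (Hd1 z Hz). generalize (Cmod_triangle_minus (f z) (f (p, q))). unfold M. lra. }
  apply Cmod_eq_0. apply Rle_antisym; [|apply Cmod_ge_0].
  apply le_epsilon. intros eps Heps. rewrite Rplus_0_l.
  set (e := Rmin (Rmin e0 (d / 4)) (eps / (8 * M))).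
  assert (He : 0 < e). { repeat apply Rmin_pos; try lra. apply Rdiv_lt_0_compat; lra. }
  assert (E1 : e <= e0) by (eapply Rle_trans; [apply Rmin_l|apply Rmin_l]).
  assert (E2 : e <= d / 4) by (eapply Rle_trans; [apply Rmin_l|apply Rmin_r]).
  assert (E3 : e <= eps / (8 * M)) by apply Rmin_r.
  eapply Rle_trans; [apply (key e); lra|].
  apply (Rmult_le_compat_l (8 * M)) in E3; [|lra].
  replace (8 * M * (eps / (8 * M))) with eps in E3 by (field; lra). lra.
Qed.

Definition cis (t : R) : C := (cos t, sin t).

Lemma cexp_pair (x y : R) : cexp (x, y) = (RtoC (exp x) * cis y)%C.
Proof. unfold cexp, cis, RtoC, Cmult; simpl. f_equal; ring. Qed.

Lemma Cmod_cis (t : R) : Cmod (cis t) = 1.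
Proof.
  replace (cis t) with (cexp (0, t)).
  - rewrite Cmod_cexp. apply exp_0.
  - rewrite cexp_pair, exp_0. ring.
Qed.

Lemma cis_2PI (t : R) : cis (t + 2 * PI) = cis t.
Proof. unfold cis. rewrite cos_plus, sin_plus, cos_2PI, sin_2PI. f_equal; ring. Qed.

Lemma is_curve_derive_cis (t : R) : is_curve_derive cis t (Ci * cis t).
Proof.
  replace (Ci * cis t)%C with ((cexp (0, t)) * Ci)%C.
  2:{ rewrite cexp_pair, exp_0. ring. }
  apply is_curve_derive_eps. intros eps Heps.
  destruct (proj1 (is_curve_derive_eps _ _ _) (is_curve_derive_comp cexp (fun y => (0, y)) t _ _ (Cderiv_cexp (0, t)) (is_curve_derive_v 0 t)) eps Heps)
    as [d [Hd Hd']].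
  exists d. split; [exact Hd|]. intros s Hs. specialize (Hd' s Hs).
  rewrite !cexp_pair, exp_0 in *. replace (1 * cis s)%C with (cis s) in Hd' by ring.
  replace (1 * cis t)%C with (cis t) in * by ring. exact Hd'.
Qed.

Lemma is_curve_derive_Ccurve (g : R -> C) (t : R) (l : C) : is_curve_derive g t l -> Ccont_curve g t.
Proof.
  intros [H1 H2]. apply Ccont_curve_components; apply (ex_derive_continuous (V := R_NormedModule)).
  - exists (Re l). exact H1.
  - exists (Im l). exact H2.
Qed.

Lemma Ccont_curve_cis (t : R) : Ccont_curve cis t.
Proof. exact (is_curve_derive_Ccurve _ _ _ (is_curve_derive_cis t)). Qed.

Lemma cis_neq_0 (t : R) : cis t <> 0%C.
Proof. apply Cmod_gt_0. rewrite Cmod_cis. lra. Qed.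

Lemma is_CInt_swap (f : R -> C) (a b : R) (l : C) : is_CInt f a b l -> is_CInt f b a (- l).
Proof.
  intros [H1 H2]. split.
  - rewrite re_opp. exact (is_RInt_swap _ _ _ _ H1).
  - rewrite im_opp. exact (is_RInt_swap _ _ _ _ H2).
Qed.

(** In logarithmic coordinates the rectangle is centred at the argument a of the exceptional point;
    this moves its vertical sides back to the interval from - PI to PI. *)
Lemma CInt_periodic (g : R -> C) (a : R) :
  (forall t, Ccont_curve g t) -> (forall t, g (t + 2 * PI) = g t) ->
  CInt g (a - PI) (a + PI) = CInt g (- PI) PI.
Proof.
  intros Hc Hp.
  set (m := CInt g (- PI) (a - PI)).
  assert (H1 : is_CInt g (- PI) (a - PI) m) by (apply CInt_correct_everywhere; exact Hc).
  assert (H2 : is_CInt g (a - PI) (- PI) (- m)) by (apply is_CInt_swap, H1).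
  assert (H3 : is_CInt g PI (a + PI) m).
  { assert (E : is_CInt g PI (a + PI) (CInt g PI (a + PI))) by (apply CInt_correct_everywhere; exact Hc).
    replace m with (CInt g PI (a + PI)); [exact E|]. symmetry. unfold m.
    apply is_CInt_unique.
    apply (is_CInt_ext (fun t => g (t + 2 * PI))); [intros; apply Hp|].
    apply is_CInt_shift. replace (- PI + 2 * PI) with PI by ring.
    replace (a - PI + 2 * PI) with (a + PI) by ring. exact E. }
  apply is_CInt_unique.
  replace (CInt g (- PI) PI) with ((- m + CInt g (- PI) PI) + m)%C by ring.
  apply is_CInt_Chasles with PI; [|exact H3].
  apply is_CInt_Chasles with (- PI); [exact H2|]. apply CInt_correct_everywhere, Hc.
Qed.

Lemma polar_form (z : C) : z <> 0%C -> exists t, z = (RtoC (Cmod z) * cis t)%C.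
Proof.
  intros Hz. assert (H0 : 0 < Cmod z) by (apply Cmod_gt_0, Hz).
  set (m := Cmod z) in *.
  assert (Hm : m ^ 2 = Re z ^ 2 + Im z ^ 2) by apply Cmod2_alt.
  set (x := Re z / m). set (y := Im z / m).
  assert (Hxy : x ^ 2 + y ^ 2 = 1).
  { unfold x, y. replace ((Re z / m) ^ 2 + (Im z / m) ^ 2) with ((Re z ^ 2 + Im z ^ 2) / m ^ 2) by (field; lra).
    rewrite <- Hm. field. lra. }
  assert (Hx : -1 <= x <= 1) by nra.
  assert (Hs : sin (acos x) = sqrt (1 - x ^ 2)).
  { rewrite sin_acos by exact Hx. f_equal. unfold Rsqr. ring. }
  assert (Hc : cos (acos x) = x) by (apply cos_acos, Hx).
  replace (1 - x ^ 2) with (Rsqr y) in Hs by (unfold Rsqr; lra).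
  rewrite sqrt_Rsqr_abs in Hs.
  assert (Hz' : z = (RtoC m * (x, y))%C).
  { destruct z as [a b]. unfold x, y, Cmult, RtoC. simpl. f_equal; field; lra. }
  destruct (Rle_dec 0 y) as [Hy|Hy].
  - exists (acos x). unfold cis. rewrite Hs, Hc, Rabs_pos_eq by exact Hy. exact Hz'.
  - exists (- acos x). unfold cis. rewrite cos_neg, sin_neg, Hs, Hc, Rabs_left, Ropp_involutive by lra.
    exact Hz'.
Qed.

(** Equality forces cos (s - t) = 1, while cosine is below 1 on (0, PI]. Hence the exceptional point
    has only one logarithm in a rectangle of height 2 PI centred at its argument. *)
Lemma cis_inj (s t : R) : Rabs (s - t) <= PI -> cis s = cis t -> s = t.
Proof.
  intros H E. unfold cis in E. injection E as E1 E2.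
  assert (Hc : cos (s - t) = 1).
  { rewrite cos_minus, E1, E2. generalize (sin2_cos2 t). unfold Rsqr. lra. }
  assert (HP := PI_RGT_0).
  assert (Hpos : forall x, 0 < x <= PI -> cos x < 1).
  { intros x Hx. rewrite <- cos_0. apply cos_decreasing_1; lra. }
  destruct (Rtotal_order (s - t) 0) as [L|[L|L]]; [|lra|].
  - rewrite Rabs_left in H by lra. specialize (Hpos (- (s - t)) ltac:(lra)). rewrite cos_neg in Hpos. lra.
  - rewrite Rabs_pos_eq in H by lra. specialize (Hpos (s - t) ltac:(lra)). lra.
Qed.

Lemma RtoC_neq_0 (x : R) : x <> 0 -> RtoC x <> 0%C.
Proof. intros H E. apply H, RtoC_inj, E. Qed.

Section Circle.
Variables (q : C -> C) (r : R) (z : C).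
Hypothesis Hr : 0 < r.
Hypothesis Hz : Cmod z < r.
Hypothesis Hq : forall w, Cmod w <= r -> w <> z -> exists l, Cderiv q w l.
Hypothesis Hqz : Ccont_at q z.

Let cont (w : C) : Cmod w <= r -> Ccont_at q w.
Proof.
  intros Hw. destruct (Ceq_dec w z) as [->|E]; [exact Hqz|].
  destruct (Hq w Hw E) as [l Hl]. exact (Cderiv_Ccont q w l Hl).
Qed.

(** The integrand of q dzeta on the circle of radius s, up to the constant i: dzeta = i zeta dt. *)
Let g (s t : R) : C := (q (RtoC s * cis t) * (RtoC s * cis t))%C.

Let g_cont (s t : R) : 0 < s <= r -> Ccont_curve (g s) t.
Proof.
  intros Hs. unfold g.
  assert (H : Ccont_curve (fun t => RtoC s * cis t)%C t) by (apply Ccont_curve_mult; [apply Ccont_curve_const|apply Ccont_curve_cis]).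
  apply Ccont_curve_mult; [|exact H].
  apply (Ccont_curve_comp q (fun t => RtoC s * cis t)%C); [|exact H].
  apply cont. rewrite Cmod_mult, Cmod_cis, Cmod_R, Rabs_pos_eq; lra.
Qed.

(* In the coordinate w = log zeta the annulus becomes a rectangle whose horizontal sides cancel. *)
Let annulus (s : R) : 0 < s < r -> (z = 0%C \/ s < Cmod z) -> CInt (g r) (- PI) PI = CInt (g s) (- PI) PI.
Proof.
  intros Hs Hsz.
  assert (HP := PI_RGT_0).
  set (h := fun w => (q (cexp w) * cexp w)%C).
  assert (Hh : forall s t, 0 < s -> h (ln s, t) = g s t).
  { intros s' t Hs'. unfold h, g. rewrite cexp_pair, exp_ln by exact Hs'. reflexivity. }
  assert (Hmod : forall w, Re w <= ln r -> Cmod (cexp w) <= r).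
  { intros w Hw. rewrite Cmod_cexp, <- (exp_ln r) by exact Hr.
    destruct Hw as [Hw|Hw]; [left; apply exp_increasing, Hw|right; f_equal; exact Hw]. }
  assert (Hln : ln s < ln r) by (apply ln_increasing; lra).
  assert (Hd : forall w, Re w <= ln r -> cexp w <> z -> exists l, Cderiv h w l).
  { intros w Hw Hwz. destruct (Hq (cexp w) (Hmod w Hw) Hwz) as [l Hl].
    eexists. unfold h. apply (Cderiv_mult (fun w => q (cexp w)) cexp); [|apply Cderiv_cexp].
    apply (Cderiv_comp q cexp); [exact Hl|apply Cderiv_cexp]. }
  assert (Hrect : exists a, rect_int h (ln s) (ln r) (a - PI) (a + PI) = 0%C).
  { destruct (Ceq_dec z 0) as [E|E].
    - exists 0. apply goursat; [lra|lra|]. intros w [W1 W2]. apply Hd; [lra|].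
      rewrite E. apply cexp_neq_0.
    - destruct (polar_form z E) as [a Ha]. exists a.
      assert (Hz0 : 0 < Cmod z) by (apply Cmod_gt_0, E).
      assert (Hsz' : s < Cmod z) by (destruct Hsz; [contradiction|assumption]).
      assert (Hz' : cexp (ln (Cmod z), a) = z) by (rewrite cexp_pair, exp_ln by exact Hz0; congruence).
      apply (goursat_except h _ _ _ _ (ln (Cmod z), a)); cbn [Re Im fst snd].
      + split; apply ln_increasing; lra.
      + lra.
      + intros w [W1 W2] Hwc. apply Hd; [lra|]. intros Ew. apply Hwc.
        destruct w as [u v]. cbn [Re Im fst snd] in *.
        assert (Eu : exp u = Cmod z).
        { rewrite <- Ew, Cmod_cexp. reflexivity. }
        assert (u = ln (Cmod z)) by (rewrite <- Eu, ln_exp; reflexivity).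
        rewrite cexp_pair, Eu in Ew.
        assert (cis v = cis a).
        { replace (cis v) with (RtoC (Cmod z) * cis v / RtoC (Cmod z))%C by (field; apply RtoC_neq_0; lra).
          rewrite Ew, Ha at 1. field. apply RtoC_neq_0; lra. }
        f_equal; [assumption|]. apply cis_inj; [|assumption]. apply Rabs_le; lra.
      + intros eps Heps.
        assert (A : Ccont_at (fun v => q v * v)%C z).
        { intros e He.
          set (K := Cmod z + Cmod (q z) + 2).
          assert (HK : 0 < K) by (unfold K; generalize (Cmod_ge_0 z), (Cmod_ge_0 (q z)); lra).
          assert (He1 : 0 < e / (2 * K)) by (apply Rdiv_lt_0_compat; lra).
          destruct (Hqz (Rmin 1 (e / (2 * K)))) as [d [Hd1 Hd2]]; [apply Rmin_pos; lra|].
          exists (Rmin d (Rmin 1 (e / (2 * K)))). split; [repeat apply Rmin_pos; lra|].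
          intros w Hw.
          specialize (Hd2 w (Rlt_le_trans _ _ _ Hw (Rmin_l _ _))).
          assert (Hw' := Rlt_le_trans _ _ _ Hw (Rmin_r _ _)).
          assert (Hw1 := Rlt_le_trans _ _ _ Hw' (Rmin_l _ _)).
          assert (Hw2 := Rlt_le_trans _ _ _ Hw' (Rmin_r _ _)).
          assert (Hq1 := Rlt_le_trans _ _ _ Hd2 (Rmin_r _ _)).
          replace (q w * w - q z * z)%C with ((q w - q z) * w + q z * (w - z))%C by ring.
          eapply Rle_lt_trans; [apply Cmod_triangle|]. rewrite !Cmod_mult.
          assert (Cmod w <= K).
          { generalize (Cmod_triangle_minus w z), (Cmod_ge_0 (q z)). unfold K. lra. }
          assert (Cmod (q z) < K) by (unfold K; generalize (Cmod_ge_0 z); lra).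
          assert (Cmod (q w - q z) * Cmod w <= (e / (2 * K)) * K).
          { apply Rmult_le_compat; try apply Cmod_ge_0; lra. }
          assert (Cmod (q z) * Cmod (w - z) < K * (e / (2 * K))).
          { apply Rmult_le_0_lt_compat; try apply Cmod_ge_0; lra. }
          replace (e / (2 * K) * K) with (e / 2) in * by (field; lra).
          replace (K * (e / (2 * K))) with (e / 2) in * by (field; lra). lra. }
        destruct (A eps Heps) as [d [Hd1 Hd2]].
        destruct (Cderiv_Ccont _ _ _ (Cderiv_cexp (ln (Cmod z), a)) d Hd1) as [d' [Hd1' Hd2']].
        exists d'. split; [exact Hd1'|]. intros w Hw. unfold h. rewrite Hz'.
        apply Hd2. rewrite <- Hz' at 1. apply Hd2', Hw. }
  destruct Hrect as [a Ha]. unfold rect_int in Ha.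
  rewrite (CInt_ext (fun y => h (ln r, y)) (g r)) in Ha by (intros; apply Hh; lra).
  rewrite (CInt_ext (fun y => h (ln s, y)) (g s)) in Ha by (intros; apply Hh; lra).
  rewrite (CInt_ext (fun x => h (x, a + PI)) (fun x => h (x, a - PI))) in Ha.
  2:{ intros x. unfold h. rewrite !cexp_pair. replace (a + PI) with (a - PI + 2 * PI) by ring.
      rewrite cis_2PI. reflexivity. }
  assert (per : forall s t, g s (t + 2 * PI) = g s t) by (intros; unfold g; rewrite cis_2PI; reflexivity).
  rewrite !CInt_periodic in Ha by (try (intros; apply per); intros; apply g_cont; lra).
  set (X := CInt (fun x => h (x, a - PI)) (ln s) (ln r)) in Ha.
  replace (CInt (g r) (- PI) PI) with
    (CInt (g s) (- PI) PI + - Ci * (X + Ci * CInt (g r) (- PI) PI - X - Ci * CInt (g s) (- PI) PI))%C.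
  - rewrite Ha. ring.
  - replace (CInt (g s) (- PI) PI + - Ci * (X + Ci * CInt (g r) (- PI) PI - X - Ci * CInt (g s) (- PI) PI))%C
      with ((1 + Ci * Ci) * CInt (g s) (- PI) PI - (Ci * Ci) * CInt (g r) (- PI) PI)%C by ring.
    rewrite Ci_mul_Ci. ring.
Qed.

(** By [annulus] the radius may be shrunk to s, and there the integrand is at most M s because q is
    bounded near 0; so the integral is at most 2 PI M s for every small s. *)
Lemma circle_integral_zero : CInt (fun t => q (RtoC r * cis t) * (RtoC r * cis t))%C (- PI) PI = 0%C.
Proof.
  change (CInt (g r) (- PI) PI = 0%C).
  assert (HP := PI_RGT_0).
  destruct (cont 0 ltac:(rewrite Cmod_0; lra) 1 Rlt_0_1) as [d [Hd Hd1]].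
  set (M := Cmod (q 0) + 1).
  assert (HM : 0 < M) by (unfold M; generalize (Cmod_ge_0 (q 0)); lra).
  apply Cmod_eq_0. apply Rle_antisym; [|apply Cmod_ge_0].
  apply le_epsilon. intros eps Heps. rewrite Rplus_0_l.
  (* The radius has to stay below |z| unless z = 0, in which case r serves as a harmless
     substitute. *)
  set (m := if Ceq_dec z 0 then r else Cmod z).
  assert (Hm : 0 < m).
  { unfold m. destruct (Ceq_dec z 0); [exact Hr|apply Cmod_gt_0; assumption]. }
  set (s := Rmin (Rmin r m / 2) (Rmin (d / 2) (eps / (2 * PI * M)))).
  assert (Hrm : 0 < Rmin r m) by (apply Rmin_pos; assumption).
  assert (Hs : 0 < s).
  { repeat apply Rmin_pos; try lra. apply Rdiv_lt_0_compat; [lra|]. apply Rmult_lt_0_compat; lra. }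
  assert (S1 : s <= Rmin r m / 2) by apply Rmin_l.
  assert (S2 : s <= d / 2) by (eapply Rle_trans; [apply Rmin_r|apply Rmin_l]).
  assert (S3 : s <= eps / (2 * PI * M)) by (eapply Rle_trans; [apply Rmin_r|apply Rmin_r]).
  assert (R1 : Rmin r m <= r) by apply Rmin_l. assert (R2 : Rmin r m <= m) by apply Rmin_r.
  rewrite (annulus s); [|lra|].
  2:{ unfold m in *. destruct (Ceq_dec z 0); [left; assumption|right; lra]. }
  eapply Rle_trans.
  { apply (Cmod_CInt_le_const (g s) (- PI) PI (M * s)); [lra| |].
    - apply CInt_correct_everywhere. intros; apply g_cont; lra.
    - intros t Ht. unfold g. rewrite Cmod_mult.
      assert (E : Cmod (RtoC s * cis t) = s) by (rewrite Cmod_mult, Cmod_cis, Cmod_R, Rabs_pos_eq; lra).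
      rewrite E. apply Rmult_le_compat_r; [lra|].
      specialize (Hd1 (RtoC s * cis t)%C).
      replace (RtoC s * cis t - 0)%C with (RtoC s * cis t)%C in Hd1 by ring. rewrite E in Hd1.
      generalize (Cmod_triangle_minus (q (RtoC s * cis t)) (q 0)). specialize (Hd1 ltac:(lra)).
      unfold M. lra. }
  apply (Rmult_le_compat_l (2 * PI * M)) in S3; [|apply Rmult_le_pos; lra].
  replace (2 * PI * M * (eps / (2 * PI * M))) with eps in S3 by (field; split; lra). lra.
Qed.

End Circle.

(** * Taylor's theorem *)

Lemma is_series_C (a : nat -> C) (l : C) :
  is_series a l <->
  forall eps, 0 < eps -> exists N, forall n, (N <= n)%nat -> Cmod (sum_n a n - l) < eps.
Proof.
  split.
  - intros H eps Heps.
    destruct (H (fun w => Cmod (w - l) < eps)) as [N HN].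
    { exists (mkposreal (eps / 2) ltac:(lra)). intros w Hw. apply Cball_Cmod in Hw. simpl in Hw. lra. }
    exists N. intros n Hn. apply HN, Hn.
  - intros H P [e He]. destruct (H e (cond_pos e)) as [N HN]. exists N. intros n Hn.
    apply He. apply C_NormedModule_mixin_compat1. apply HN, Hn.
Qed.

(* Finite sums have their type in an abelian monoid structure, which ring does not see through. *)
Ltac Cring := match goal with |- ?x = ?y => change (@eq C x y) end; ring.

Lemma pow_n_Cpow (z : C) (n : nat) : pow_n (K := C_Ring) z n = (z ^ n)%C.
Proof. induction n; [reflexivity|]. simpl. rewrite IHn. reflexivity. Qed.

Lemma is_pseries_C (a : nat -> C) (z l : C) :
  is_pseries a z l <->
  forall eps, 0 < eps -> exists N, forall n, (N <= n)%nat ->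
    Cmod (sum_n (fun k => (a k * z ^ k)%C) n - l) < eps.
Proof.
  unfold is_pseries. rewrite is_series_C.
  assert (E : forall n, sum_n (fun k => scal (pow_n (K := C_Ring) z k) (a k)) n = sum_n (fun k => (a k * z ^ k)%C) n).
  { intros n. apply sum_n_ext. intros k. rewrite pow_n_Cpow. apply Cmult_comm. }
  split; intros H eps Heps; destruct (H eps Heps) as [N HN]; exists N; intros n Hn;
  specialize (HN n Hn); [rewrite <- E|rewrite E]; exact HN.
Qed.

Lemma sum_Sn_C (a : nat -> C) (n : nat) : sum_n a (S n) = (sum_n a n + a (S n))%C.
Proof. exact (sum_Sn (G := C_AbelianMonoid) a n). Qed.

Lemma sum_0_C (a : nat -> C) : sum_n a 0 = a 0%nat.
Proof. exact (sum_O (G := C_AbelianMonoid) a). Qed.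

Lemma Cmod_sum_n_le (a : nat -> C) (b : nat -> R) (n : nat) :
  (forall k, Cmod (a k) <= b k) -> Cmod (sum_n a n) <= sum_n b n.
Proof.
  intros H. induction n.
  - rewrite sum_0_C, sum_O. apply H.
  - rewrite sum_Sn_C, sum_Sn. eapply Rle_trans; [apply Cmod_triangle|].
    apply Rplus_le_compat; [exact IHn|apply H].
Qed.

Lemma cis_plus (s t : R) : cis (s + t) = (cis s * cis t)%C.
Proof. unfold cis, Cmult. cbn [fst snd]. rewrite cos_plus, sin_plus. f_equal; ring. Qed.

Lemma cis_0 : cis 0 = 1%C.
Proof. unfold cis. rewrite cos_0, sin_0. reflexivity. Qed.

Lemma cis_opp (t : R) : cis (- t) = (/ cis t)%C.
Proof.
  assert (H : (cis (- t) * cis t)%C = 1%C).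
  { rewrite <- cis_plus. replace (- t + t) with 0 by ring. apply cis_0. }
  replace (cis (- t)) with (cis (- t) * cis t / cis t)%C by (field; apply cis_neq_0).
  rewrite H. field. apply cis_neq_0.
Qed.

Lemma cis_pow (t : R) (n : nat) : (cis t ^ n)%C = cis (INR n * t).
Proof.
  induction n.
  - simpl. rewrite Rmult_0_l, cis_0. reflexivity.
  - rewrite Cpow_S, IHn, <- cis_plus, S_INR. f_equal. ring.
Qed.

Lemma is_curve_derive_cis_scal (c t : R) : is_curve_derive (fun t => cis (c * t)) t (Ci * RtoC c * cis (c * t)).
Proof.
  replace (Ci * RtoC c * cis (c * t))%C with (cexp (Ci * RtoC c * RtoC t) * (Ci * RtoC c * 1))%C.
  2:{ replace (Ci * RtoC c * RtoC t)%C with ((0, c * t) : C).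
      - rewrite cexp_pair, exp_0. ring.
      - unfold Ci, RtoC, Cmult; simpl. f_equal; ring. }
  apply is_curve_derive_eps. intros eps Heps.
  destruct (proj1 (is_curve_derive_eps _ _ _) (is_curve_derive_Cderiv (fun w => cexp (Ci * RtoC c * w)) t _
    (Cderiv_comp cexp (fun w => Ci * RtoC c * w)%C (RtoC t) _ _ (Cderiv_cexp _)
      (Cderiv_scal (Ci * RtoC c) _ _ _ (Cderiv_id (RtoC t))))) eps Heps) as [d [Hd Hd']].
  assert (E : forall s, cis (c * s) = cexp (Ci * RtoC c * RtoC s)).
  { intros s. replace (Ci * RtoC c * RtoC s)%C with ((0, c * s) : C).
      - rewrite cexp_pair, exp_0. ring.
      - unfold Ci, RtoC, Cmult; simpl. f_equal; ring. }
  exists d. split; [exact Hd|]. intros s Hs. rewrite !E. apply Hd', Hs.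
Qed.

Lemma Cderiv_linear (c z : C) : Cderiv (fun w => c * w)%C z c.
Proof.
  assert (H := Cderiv_scal c _ z _ (Cderiv_id z)). rewrite Cmult_1_r in H. exact H.
Qed.

Lemma CInt_cis_pow (n : nat) : CInt (fun t => / cis t ^ S n)%C (- PI) PI = 0%C.
Proof.
  set (c := - INR (S n)).
  assert (Hc : c <> 0) by (unfold c; generalize (lt_0_INR (S n) ltac:(lia)); lra).
  assert (HcC : RtoC c <> 0%C) by (apply RtoC_neq_0, Hc).
  assert (E : forall t, (/ cis t ^ S n)%C = cis (c * t)).
  { intros t. rewrite cis_pow, <- cis_opp. f_equal. unfold c. ring. }
  apply is_CInt_unique. apply (is_CInt_ext (fun t => cis (c * t))); [intros; symmetry; apply E|].
  replace (RtoC 0) with ((/ (Ci * RtoC c)) * cis (c * PI) - (/ (Ci * RtoC c)) * cis (c * - PI))%C.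
  (* As c is a nonzero integer, the antiderivative takes the same value at both ends. *)
  2:{ replace (c * - PI) with (c * PI + 2 * INR (S n) * PI) by (unfold c; ring).
      unfold cis. rewrite cos_period, sin_period. ring. }
  apply (is_CInt_FTC (fun t => / (Ci * RtoC c) * cis (c * t))%C).
  - intros t _.
    replace (cis (c * t)) with (/ (Ci * RtoC c) * (Ci * RtoC c * cis (c * t)))%C.
    2:{ field. split; [exact HcC|apply Ci_nz]. }
    apply (is_curve_derive_comp (fun w => / (Ci * RtoC c) * w)%C (fun t => cis (c * t)) t).
    2: apply is_curve_derive_cis_scal.
    apply Cderiv_linear.
  - intros t _. exact (is_curve_derive_Ccurve _ _ _ (is_curve_derive_cis_scal c t)).
Qed.

Lemma pow_small (x M eps : R) : 0 <= x < 1 -> 0 <= M -> 0 < eps ->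
  exists N, forall n, (N <= n)%nat -> M * x ^ n < eps.
Proof.
  intros Hx HM Heps.
  destruct (pow_lt_1_zero x ltac:(rewrite Rabs_pos_eq; lra) (eps / (M + 1))) as [N HN].
  { apply Rdiv_lt_0_compat; lra. }
  exists N. intros n Hn. specialize (HN n Hn). rewrite Rabs_pos_eq in HN by (apply pow_le; lra).
  apply (Rmult_lt_compat_l (M + 1)) in HN; [|lra].
  replace ((M + 1) * (eps / (M + 1))) with eps in HN by (field; lra).
  assert (0 <= x ^ n) by (apply pow_le; lra). lra.
Qed.

Lemma continuous_bounded (g : R -> R) (a b : R) : a <= b ->
  (forall t, a <= t <= b -> continuous g t) -> exists M, 0 <= M /\ forall t, a <= t <= b -> g t <= M.
Proof.
  intros Hab H.
  destruct (continuity_ab_maj g a b Hab) as [m [Hm _]].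
  { intros t Ht. apply continuity_pt_filterlim. apply (H t Ht). }
  exists (Rmax 0 (g m)). split; [apply Rmax_l|].
  intros t Ht. eapply Rle_trans; [apply Hm, Ht|apply Rmax_r].
Qed.

Lemma Cmod_circle_point (r t : R) : 0 <= r -> Cmod (RtoC r * cis t) = r.
Proof. intros H. rewrite Cmod_mult, Cmod_cis, Cmod_R, Rabs_pos_eq; lra. Qed.

Lemma circle_point_neq_0 (r t : R) : 0 < r -> (RtoC r * cis t)%C <> 0%C.
Proof. intros H. apply Cmod_gt_0. rewrite Cmod_circle_point; lra. Qed.

Lemma Ccont_curve_circle_point (r t : R) : Ccont_curve (fun t => RtoC r * cis t)%C t.
Proof. apply Ccont_curve_mult; [apply Ccont_curve_const|apply Ccont_curve_cis]. Qed.

Definition holomorphic (f : C -> C) : Prop := forall z, Cmod z < 1 -> exists l, Cderiv f z l.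

(** Cauchy's coefficient formula on the circle of radius r: dzeta / (2 pi i zeta) is dt / (2 pi), so
    the power in the denominator is k and not k + 1. *)
Definition taylor_coeff (f : C -> C) (r : R) (k : nat) : C :=
  (CInt (fun t => f (RtoC r * cis t) / (RtoC r * cis t) ^ k)%C (- PI) PI / RtoC (2 * PI))%C.

(** With u = z / zeta this is the mean of f (zeta) u^k / (1 - u) over the circle: the Cauchy
    integral for k = 0, and the remainder after the terms of index below k in general. *)
Definition taylor_rem (f : C -> C) (r : R) (z : C) (k : nat) : C :=
  (CInt (fun t => f (RtoC r * cis t) * (z / (RtoC r * cis t)) ^ k / (1 - z / (RtoC r * cis t)))%C (- PI) PI
    / RtoC (2 * PI))%C.

Section Taylor.
Variables (f : C -> C) (r : R).
Hypothesis Hf : holomorphic f.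
Hypothesis Hr : 0 < r < 1.

Let f_cont (t : R) : Ccont_curve (fun t => f (RtoC r * cis t))%C t.
Proof.
  apply (Ccont_curve_comp f (fun t => RtoC r * cis t)%C); [|apply Ccont_curve_circle_point].
  destruct (Hf (RtoC r * cis t)%C) as [l Hl]; [rewrite Cmod_circle_point; lra|]. exact (Cderiv_Ccont _ _ _ Hl).
Qed.

Lemma Ccont_curve_circle (t : R) : Ccont_curve (fun t => f (RtoC r * cis t))%C t.
Proof. exact (f_cont t). Qed.

Section AtPoint.
Variable z : C.
Hypothesis Hz : Cmod z < r.

Lemma Cmod_quot (t : R) : Cmod (z / (RtoC r * cis t)) = Cmod z / r.
Proof. rewrite Cmod_div by (apply circle_point_neq_0; lra). rewrite Cmod_circle_point by lra. reflexivity. Qed.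

Lemma quot_range : 0 <= Cmod z / r < 1.
Proof.
  split; [apply Rdiv_le_0_compat; [apply Cmod_ge_0|lra]|].
  apply Rlt_div_l; lra.
Qed.

Lemma one_minus_quot_ge (t : R) : 1 - Cmod z / r <= Cmod (1 - z / (RtoC r * cis t)).
Proof.
  rewrite <- (Cmod_quot t). generalize (Cmod_triangle_minus 1 (z / (RtoC r * cis t))).
  rewrite Cmod_1. lra.
Qed.

Lemma one_minus_quot_neq_0 (t : R) : (1 - z / (RtoC r * cis t))%C <> 0%C.
Proof. apply Cmod_gt_0. generalize (one_minus_quot_ge t), quot_range. lra. Qed.

Lemma Ccont_curve_quot (t : R) : Ccont_curve (fun t => z / (RtoC r * cis t))%C t.
Proof. apply Ccont_curve_div; [apply circle_point_neq_0; lra|apply Ccont_curve_const|apply Ccont_curve_circle_point]. Qed.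

Lemma Ccont_curve_taylor_rem (g : R -> C) (k : nat) (t : R) : Ccont_curve g t ->
  Ccont_curve (fun t => g t * (z / (RtoC r * cis t)) ^ k / (1 - z / (RtoC r * cis t)))%C t.
Proof.
  intros Hg. apply (Ccont_curve_div (fun t => g t * (z / (RtoC r * cis t)) ^ k)%C (fun t => 1 - z / (RtoC r * cis t))%C).
  - apply one_minus_quot_neq_0.
  - apply Ccont_curve_mult; [exact Hg|]. apply (Ccont_curve_pow (fun t => z / (RtoC r * cis t))%C), Ccont_curve_quot.
  - apply Ccont_curve_minus; [apply Ccont_curve_const|apply Ccont_curve_quot].
Qed.

Let two_PI_neq_0 : RtoC (2 * PI) <> 0%C.
Proof. apply RtoC_neq_0. generalize PI_RGT_0. lra. Qed.

(** Integrates u^k / (1 - u) = u^k + u^(k+1) / (1 - u) for u = z / zeta. The function g stays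
    general because it is f on the circle in one use and the constant 1 in the other. *)
Lemma taylor_rem_S (g : R -> C) (k : nat) : (forall t, Ccont_curve g t) ->
  CInt (fun t => g t * (z / (RtoC r * cis t)) ^ k / (1 - z / (RtoC r * cis t)))%C (- PI) PI =
  (CInt (fun t => g t / (RtoC r * cis t) ^ k)%C (- PI) PI * z ^ k +
   CInt (fun t => g t * (z / (RtoC r * cis t)) ^ S k / (1 - z / (RtoC r * cis t)))%C (- PI) PI)%C.
Proof.
  intros Hg. apply is_CInt_unique.
  apply (is_CInt_ext (fun t => z ^ k * (g t / (RtoC r * cis t) ^ k) +
     g t * (z / (RtoC r * cis t)) ^ S k / (1 - z / (RtoC r * cis t)))%C).
  - intros t _. rewrite Cpow_S. set (u := (z / (RtoC r * cis t))%C).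
    assert (Hu : (1 - u)%C <> 0%C) by apply one_minus_quot_neq_0.
    replace (z ^ k)%C with (u ^ k * (RtoC r * cis t) ^ k)%C.
    2:{ rewrite <- Cpow_mult_l. f_equal. unfold u. field.
        generalize (circle_point_neq_0 r t ltac:(lra)). intros H; split; intros E; apply H; rewrite E; ring. }
    field. split; [exact Hu|]. apply Cpow_nz, circle_point_neq_0. lra.
  - replace (CInt (fun t => g t / (RtoC r * cis t) ^ k)%C (- PI) PI * z ^ k)%C
      with (z ^ k * CInt (fun t => g t / (RtoC r * cis t) ^ k)%C (- PI) PI)%C by ring.
    apply is_CInt_plus; [apply is_CInt_scal|]; apply CInt_correct_everywhere; intros t.
    + apply Ccont_curve_div; [apply Cpow_nz, circle_point_neq_0; lra|apply Hg|].
      apply (Ccont_curve_pow (fun t => RtoC r * cis t)%C), Ccont_curve_circle_point.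
    + apply Ccont_curve_taylor_rem, Hg.
Qed.

Lemma Cmod_taylor_rem_int_le (g : R -> C) (M : R) (k : nat) : (forall t, Ccont_curve g t) ->
  (forall t, - PI <= t <= PI -> Cmod (g t) <= M) -> 0 <= M ->
  Cmod (CInt (fun t => g t * (z / (RtoC r * cis t)) ^ k / (1 - z / (RtoC r * cis t)))%C (- PI) PI)
   <= M * 2 * PI / (1 - Cmod z / r) * (Cmod z / r) ^ k.
Proof.
  intros Hg HM HM0. assert (HP := PI_RGT_0). assert (Hq := quot_range).
  eapply Rle_trans.
  { eapply (Cmod_CInt_le_const _ (- PI) PI (M * (Cmod z / r) ^ k / (1 - Cmod z / r))); [lra| |].
    - apply CInt_correct_everywhere. intros t. apply Ccont_curve_taylor_rem, Hg.
    - intros t Ht. cbv beta. rewrite Cmod_div by apply one_minus_quot_neq_0.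
      rewrite Cmod_mult, Cmod_pow, Cmod_quot.
      unfold Rdiv at 1 3.
      assert (A := one_minus_quot_ge t).
      apply Rmult_le_compat.
      + apply Rmult_le_pos; [apply Cmod_ge_0|apply pow_le; lra].
      + left. apply Rinv_0_lt_compat. lra.
      + apply Rmult_le_compat_r; [apply pow_le; lra|apply HM; lra].
      + apply Rinv_le_contravar; lra. }
  right. field. split; lra.
Qed.

Lemma circle_bound (g : R -> C) : (forall t, Ccont_curve g t) ->
  exists M, 0 <= M /\ forall t, - PI <= t <= PI -> Cmod (g t) <= M.
Proof.
  intros Hg. apply continuous_bounded; [generalize PI_RGT_0; lra|].
  intros t _. apply Ccont_curve_Cmod, Hg.
Qed.

(** For g = 1 the moments of positive order vanish, so all remainders of positive order coincide;
    they also decay geometrically, hence are 0. Only the moment of order 0, which is 2 PI, is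
    left. *)
Lemma cauchy_kernel : CInt (fun t => 1 / (1 - z / (RtoC r * cis t)))%C (- PI) PI = RtoC (2 * PI).
Proof.
  assert (HP := PI_RGT_0). assert (Hq := quot_range).
  set (E := fun k => CInt (fun t => 1 * (z / (RtoC r * cis t)) ^ k / (1 - z / (RtoC r * cis t)))%C (- PI) PI).
  assert (HS : forall k, E (S k) = E (S (S k))).
  { intros k. unfold E at 1. rewrite (taylor_rem_S (fun _ => 1%C)) by (intros; apply Ccont_curve_const).
    fold (E (S (S k))).
    replace (CInt (fun t => 1 / (RtoC r * cis t) ^ S k)%C (- PI) PI) with (RtoC 0); [ring|].
    symmetry. apply is_CInt_unique.
    apply (is_CInt_ext (fun t => / (RtoC r ^ S k) * (/ cis t ^ S k))%C).
    - intros t _. rewrite Cpow_mult_l. field. split; apply Cpow_nz; [apply cis_neq_0|apply RtoC_neq_0; lra].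
    - replace (RtoC 0) with (/ (RtoC r ^ S k) * 0)%C by ring. rewrite <- (CInt_cis_pow k).
      apply is_CInt_scal, CInt_correct_everywhere. intros t.
      apply Ccont_curve_inv; [apply Cpow_nz, cis_neq_0|]. apply (Ccont_curve_pow cis), Ccont_curve_cis. }
  assert (H1 : forall k, E 1%nat = E (S k)).
  { induction k; [reflexivity|]. rewrite IHk. apply HS. }
  assert (E1 : E 1%nat = 0%C).
  { apply Cmod_eq_0, Rle_antisym; [|apply Cmod_ge_0]. apply le_epsilon. intros eps Heps. rewrite Rplus_0_l.
    destruct (pow_small (Cmod z / r) (1 * 2 * PI / (1 - Cmod z / r)) eps Hq) as [N HN]; [|exact Heps|].
    - apply Rdiv_le_0_compat; lra.
    - left. eapply Rle_lt_trans; [|apply (HN (S N)); lia]. rewrite (H1 N).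
      apply (Cmod_taylor_rem_int_le (fun _ => 1%C)); [intros; apply Ccont_curve_const| |lra].
      intros t _. rewrite Cmod_1. lra. }
  rewrite (CInt_ext _ (fun t => 1 * (z / (RtoC r * cis t)) ^ 0 / (1 - z / (RtoC r * cis t)))%C).
  2:{ intros t. simpl. rewrite Cmult_1_r. reflexivity. }
  rewrite (taylor_rem_S (fun _ => 1%C)) by (intros; apply Ccont_curve_const).
  fold (E 1%nat). rewrite E1.
  replace (CInt (fun t => 1 / (RtoC r * cis t) ^ 0)%C (- PI) PI) with (RtoC (2 * PI)); [simpl; ring|].
  symmetry. apply is_CInt_unique. apply (is_CInt_ext (fun _ => 1%C)).
  - intros t _. simpl. field.
  - replace (RtoC (2 * PI)) with (1 * RtoC (PI - - PI))%C; [apply is_CInt_const|].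
    rewrite Cmult_1_l. f_equal. ring.
Qed.

(** The difference quotient q, completed by the derivative at z, has vanishing circle integral.
    Since zeta / (zeta - z) = 1 / (1 - z / zeta), this integral is the Cauchy integral of f minus f
    z times that of the kernel. *)
Lemma cauchy_formula : f z = taylor_rem f r z 0.
Proof.
  destruct (Hf z ltac:(lra)) as [l Hl].
  set (q := fun w => if Ceq_dec w z then l else ((f w - f z) / (w - z))%C).
  assert (Hq0 : forall w, w <> z -> q w = ((f w - f z) / (w - z))%C).
  { intros w Hw. unfold q. destruct (Ceq_dec w z); [contradiction|reflexivity]. }
  assert (Hzz : q z = l) by (unfold q; destruct (Ceq_dec z z); [reflexivity|contradiction]).
  assert (I : CInt (fun t => q (RtoC r * cis t) * (RtoC r * cis t))%C (- PI) PI = 0%C).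
  { apply (circle_integral_zero q r z); [lra|exact Hz| |].
    - intros w Hw Hwz. destruct (Hf w ltac:(lra)) as [lw Hlw].
      eexists.
      apply (Cderiv_ext_loc (fun w => (f w - f z) / (w - z))%C q w _ (Cmod (w - z))).
      + apply Cmod_gt_0. intros E. apply Hwz. apply Ceq_minus, E.
      + intros v Hv. symmetry. apply Hq0. intros ->. rewrite Cmod_minus_sym in Hv. lra.
      + apply (Cderiv_div (fun w => f w - f z)%C (fun w => w - z)%C w).
        * intros E. apply Hwz. apply Ceq_minus, E.
        * apply Cderiv_minus; [exact Hlw|apply Cderiv_const].
        * apply Cderiv_minus; [apply Cderiv_id|apply Cderiv_const].
    - intros eps Heps. destruct (Hl (eps / 2)) as [d [Hd Hd']]; [lra|]. exists d. split; [exact Hd|].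
      intros w Hw. rewrite Hzz. destruct (Ceq_dec w z) as [->|E].
      + rewrite Hzz. replace (l - l)%C with (RtoC 0) by ring. rewrite Cmod_0. exact Heps.
      + rewrite Hq0 by exact E. specialize (Hd' w Hw).
        assert (Hwz : (w - z)%C <> 0%C) by (intros E'; apply E, Ceq_minus, E').
        assert (Hwz0 : 0 < Cmod (w - z)) by (apply Cmod_gt_0, Hwz).
        replace ((f w - f z) / (w - z) - l)%C with ((f w - f z - l * (w - z)) / (w - z))%C by (field; exact Hwz).
        rewrite Cmod_div by exact Hwz.
        apply Rle_lt_trans with (eps / 2); [|lra]. apply Rle_div_l; assumption. }
  assert (I2 : is_CInt (fun t => q (RtoC r * cis t) * (RtoC r * cis t))%C (- PI) PI
     (CInt (fun t => f (RtoC r * cis t) * (z / (RtoC r * cis t)) ^ 0 / (1 - z / (RtoC r * cis t)))%C (- PI) PI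
       - f z * RtoC (2 * PI))).
  { apply (is_CInt_ext (fun t => f (RtoC r * cis t) * (z / (RtoC r * cis t)) ^ 0 / (1 - z / (RtoC r * cis t)) - f z * (1 / (1 - z / (RtoC r * cis t))))%C).
    - intros t _.
      assert (A1 : (RtoC r * cis t)%C <> 0%C) by (apply circle_point_neq_0; lra).
      assert (A2 := one_minus_quot_neq_0 t).
      assert (A3 : (RtoC r * cis t)%C <> z).
      { intros E. rewrite <- E in Hz. rewrite Cmod_circle_point in Hz; lra. }
      rewrite Hq0 by exact A3. set (w := (RtoC r * cis t)%C) in *.
      simpl. field. split; [|exact A1].
      intros E. apply A3, Ceq_minus, E.
    - apply is_CInt_minus.
      + apply CInt_correct_everywhere. intros t. apply Ccont_curve_taylor_rem, f_cont.
      + apply is_CInt_scal. rewrite <- cauchy_kernel. apply CInt_correct_everywhere. intros t.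
        apply Ccont_curve_div; [apply one_minus_quot_neq_0|apply Ccont_curve_const|].
        apply Ccont_curve_minus; [apply Ccont_curve_const|apply Ccont_curve_quot]. }
  apply is_CInt_unique in I2. rewrite I in I2.
  unfold taylor_rem.
  set (X := CInt (fun t => f (RtoC r * cis t) * (z / (RtoC r * cis t)) ^ 0 / (1 - z / (RtoC r * cis t)))%C (- PI) PI) in *.
  replace X with (0 + f z * RtoC (2 * PI))%C by (rewrite I2; ring). field. exact two_PI_neq_0.
Qed.

(** Telescopes the geometric step, starting from Cauchy's formula as the remainder of order 0. *)
Lemma taylor_formula (n : nat) :
  f z = (sum_n (fun k => (taylor_coeff f r k * z ^ k)%C) n + taylor_rem f r z (S n))%C.
Proof.
  assert (St : forall k, taylor_rem f r z k = (taylor_coeff f r k * z ^ k + taylor_rem f r z (S k))%C).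
  { intros k. unfold taylor_rem at 1. rewrite (taylor_rem_S (fun t => f (RtoC r * cis t))%C) by apply f_cont.
    unfold taylor_coeff, taylor_rem. field. exact two_PI_neq_0. }
  induction n.
  - rewrite sum_0_C, <- St. apply cauchy_formula.
  - rewrite sum_Sn_C, IHn at 1. rewrite (St (S n)). ring.
Qed.

End AtPoint.

Lemma taylor_series (z : C) : Cmod z < r ->
  is_pseries (taylor_coeff f r) z (f z).
Proof.
  intros Hz. apply is_pseries_C. intros eps Heps.
  assert (HP := PI_RGT_0). assert (Hq := quot_range z Hz).
  destruct (circle_bound (fun t => f (RtoC r * cis t))%C f_cont) as [M [HM0 HM]].
  destruct (pow_small (Cmod z / r) (M * 2 * PI / (1 - Cmod z / r) / (2 * PI)) eps Hq) as [N HN]; [|exact Heps|].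
  { apply Rdiv_le_0_compat; [|lra]. apply Rdiv_le_0_compat; [|lra]. apply Rmult_le_pos; lra. }
  exists N. intros n Hn. rewrite (taylor_formula z Hz n).
  set (s := sum_n _ n).
  replace (s - (s + taylor_rem f r z (S n)))%C with (- taylor_rem f r z (S n))%C by ring.
  rewrite Cmod_opp. eapply Rle_lt_trans; [|apply (HN (S n)); lia].
  unfold taylor_rem. rewrite Cmod_div by (apply RtoC_neq_0; lra).
  rewrite Cmod_R, (Rabs_pos_eq (2 * PI)) by lra.
  apply Rle_div_l; [lra|].
  eapply Rle_trans; [apply (Cmod_taylor_rem_int_le z Hz (fun t => f (RtoC r * cis t))%C M); [exact f_cont|exact HM|exact HM0]|].
  right. field. lra.
Qed.

End Taylor.

(** * Power series *)

Lemma CV_radius_ge (u : nat -> R) (d : R) :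
  (forall x, 0 < x < d -> exists M, forall n, Rabs (u n * x ^ n) <= M) ->
  0 < d -> Rbar_le d (CV_radius u).
Proof.
  intros H Hd. destruct (CV_radius_bounded u) as [Hub _].
  assert (K : forall x, 0 < x < d -> Rbar_le x (CV_radius u)).
  { intros x Hx. apply Hub. apply H, Hx. }
  destruct (CV_radius u) as [c| |] eqn:E.
  - simpl. apply le_epsilon. intros eps Heps.
    set (x := Rmax (d / 2) (d - eps)).
    assert (Hx : 0 < x < d).
    { unfold x. split; [eapply Rlt_le_trans; [|apply Rmax_l]; lra|apply Rmax_lub_lt; lra]. }
    specialize (K x Hx). simpl in K. assert (d - eps <= x) by apply Rmax_r. lra.
  - exact I.
  - specialize (K (d / 2) ltac:(lra)). simpl in K. contradiction.
Qed.

Lemma sum_n_ge_term (v : nat -> R) (n k : nat) :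
  (forall j, 0 <= v j) -> (k <= n)%nat -> v k <= sum_n v n.
Proof.
  intros Hv Hk. induction Hk.
  - destruct k; [rewrite sum_O; lra|]. rewrite sum_Sn.
    assert (0 <= sum_n v k).
    { clear - Hv. induction k; [rewrite sum_O; apply Hv|]. rewrite sum_Sn.
      apply Rplus_le_le_0_compat; [assumption|apply Hv]. }
    change (v (S k) <= sum_n v k + v (S k)). lra.
  - rewrite sum_Sn. change (v k <= sum_n v m + v (S m)). specialize (Hv (S m)). lra.
Qed.

Lemma pseries_terms_bounded (a : nat -> C) (z l : C) :
  is_pseries a z l -> exists M, forall n, Cmod (a n * z ^ n) <= M.
Proof.
  intros H. rewrite is_pseries_C in H. destruct (H 1 Rlt_0_1) as [N HN].
  exists (sum_n (fun k => Cmod (a k * z ^ k)) N + 2). intros n.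
  assert (Hpos : forall j, 0 <= Cmod (a j * z ^ j)) by (intros; apply Cmod_ge_0).
  assert (H0 := sum_n_ge_term _ N 0 Hpos ltac:(lia)). specialize (Hpos 0%nat) as Hp0. cbv beta in *.
  destruct (Nat.le_gt_cases n N) as [Hn|Hn].
  - assert (T := sum_n_ge_term _ N n Hpos Hn). cbv beta in T. lra.
  - destruct n; [lia|].
    assert (A1 := HN n ltac:(lia)). assert (A2 := HN (S n) ltac:(lia)).
    rewrite sum_Sn_C in A2. set (s := sum_n (fun k => (a k * z ^ k)%C) n) in *.
    set (w := (a (S n) * z ^ S n)%C) in *.
    replace w with ((s + w - l) - (s - l))%C by ring.
    eapply Rle_trans; [apply Cmod_minus_le|]. lra.
Qed.

(** Convergence at positive real points already bounds the terms. The sequence g will be the moduli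
    of the coefficients or one of their components, which opens the theory of real power series. *)
Lemma CV_radius_expansion (a : nat -> C) (f : C -> C) (d : R) (g : nat -> R) : 0 < d ->
  (forall z, Cmod z < d -> is_pseries a z (f z)) ->
  (forall n, Rabs (g n) <= Cmod (a n)) ->
  Rbar_le d (CV_radius g).
Proof.
  intros Hd H Hg. apply CV_radius_ge; [|exact Hd]. intros x Hx.
  destruct (pseries_terms_bounded a (RtoC x) (f (RtoC x))) as [M HM].
  { apply H. rewrite Cmod_R, Rabs_pos_eq; lra. }
  exists M. intros n. specialize (HM n). rewrite Cmod_mult, Cmod_pow, Cmod_R, (Rabs_pos_eq x) in HM by lra.
  rewrite Rabs_mult, (Rabs_pos_eq (x ^ n)) by (apply pow_le; lra).
  eapply Rle_trans; [|exact HM]. apply Rmult_le_compat_r; [apply pow_le; lra|apply Hg].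
Qed.

(** P stands for [Re] or [Im]. At a real point these commute with partial sums, which reduces
    uniqueness of complex coefficients to the real case. *)
Lemma is_pseries_component (P : C -> R) (a : nat -> C) (x : R) (l : C) :
  (forall u v, P (u + v)%C = P u + P v) -> (forall u (y : R), P (u * RtoC y)%C = P u * y) ->
  (forall u, Rabs (P u) <= Cmod u) ->
  is_pseries a (RtoC x) l -> PSeries (fun n => P (a n)) x = P l.
Proof.
  intros Hadd Hscal Hle H. apply is_pseries_unique. rewrite is_pseries_C in H.
  intros Q [e He]. destruct (H e (cond_pos e)) as [N HN]. exists N. intros n Hn. apply He.
  specialize (HN n Hn).
  change (Rabs (sum_n (fun k => scal (pow_n x k) (P (a k))) n - P l) < e).
  replace (sum_n (fun k => scal (pow_n x k) (P (a k))) n) with (P (sum_n (fun k => (a k * RtoC x ^ k)%C) n)).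
  - assert (E : P (sum_n (fun k => (a k * RtoC x ^ k)%C) n - l)%C = P (sum_n (fun k => (a k * RtoC x ^ k)%C) n) - P l).
    { replace (sum_n (fun k => (a k * RtoC x ^ k)%C) n - l)%C
        with (sum_n (fun k => (a k * RtoC x ^ k)%C) n + l * RtoC (-1))%C by ring.
      rewrite Hadd, Hscal. ring. }
    rewrite <- E. eapply Rle_lt_trans; [apply Hle|exact HN].
  - assert (T : forall k, P (a k * RtoC x ^ k)%C = scal (pow_n x k) (P (a k))).
    { intros k. rewrite <- RtoC_pow, Hscal. change (P (a k) * x ^ k = pow_n x k * P (a k)).
      replace (pow_n x k) with (x ^ k) by (symmetry; apply pow_n_pow). apply Rmult_comm. }
    clear - T Hadd. induction n.
    + rewrite sum_0_C, sum_O. apply T.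
    + rewrite sum_Sn_C, sum_Sn, Hadd, IHn, T. reflexivity.
Qed.

Lemma pseries_coeff_unique (a b : nat -> C) (f : C -> C) (d : R) : 0 < d ->
  (forall z, Cmod z < d -> is_pseries a z (f z)) ->
  (forall z, Cmod z < d -> is_pseries b z (f z)) ->
  forall n, a n = b n.
Proof.
  intros Hd Ha Hb n.
  assert (K : forall P : C -> R, (forall u v, P (u + v)%C = P u + P v) -> (forall u (y : R), P (u * RtoC y)%C = P u * y) ->
     (forall u, Rabs (P u) <= Cmod u) -> P (a n) = P (b n)).
  { intros P H1 H2 H3.
    assert (R : forall c, (forall z, Cmod z < d -> is_pseries c z (f z)) ->
       Rbar_lt 0 (CV_radius (fun n => P (c n)))).
    { intros c Hc. apply Rbar_lt_le_trans with d; [exact Hd|].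
      apply (CV_radius_expansion c f d); [exact Hd|exact Hc|]. intros; apply H3. }
    apply (PSeries_ext_recip (fun n => P (a n)) (fun n => P (b n)) n); [apply R, Ha|apply R, Hb|].
    exists (mkposreal d Hd). intros x Hx.
    assert (Hx' : Cmod (RtoC x) < d).
    { rewrite Cmod_R. unfold ball in Hx; simpl in Hx. unfold AbsRing_ball, abs, minus, plus, opp in Hx; simpl in Hx.
      rewrite Ropp_0, Rplus_0_r in Hx. exact Hx. }
    rewrite (is_pseries_component P a x (f (RtoC x))), (is_pseries_component P b x (f (RtoC x))); auto. }
  assert (E1 := K Re re_plus (fun u y => re_scal_r u y) re_le_Cmod).
  assert (E2 := K Im im_plus (fun u y => im_scal_r u y) im_le_Cmod).
  destruct (a n), (b n); simpl in *; f_equal; assumption.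
Qed.

(** Coefficients over different circles agree by uniqueness near 0, so one sequence serves the whole
    disk; 1/2 is an arbitrary reference radius. The freedom in r is what later allows circles whose
    radius depends on the index of a partial sum. *)
Lemma holomorphic_taylor (f : C -> C) : holomorphic f ->
  exists a, expansion_on_disk a f /\ forall r k, 0 < r < 1 -> a k = taylor_coeff f r k.
Proof.
  intros Hf.
  assert (E : forall r k, 0 < r < 1 -> taylor_coeff f (1 / 2) k = taylor_coeff f r k).
  { intros r k Hr. apply (pseries_coeff_unique _ _ f (Rmin (1 / 2) r)).
    - apply Rmin_pos; lra.
    - intros z Hz. apply (taylor_series f (1 / 2) Hf); [lra|]. eapply Rlt_le_trans; [exact Hz|apply Rmin_l].
    - intros z Hz. apply (taylor_series f r Hf Hr). eapply Rlt_le_trans; [exact Hz|apply Rmin_r]. }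
  exists (taylor_coeff f (1 / 2)). split; [|exact E].
  intros z Hz. unfold unit_disk in Hz.
  (* The expansion on a circle holds only inside it, so the circle passes halfway between |z| and
     1. *)
  assert (Hr : 0 < (1 + Cmod z) / 2 < 1) by (generalize (Cmod_ge_0 z); lra).
  assert (H := taylor_series f ((1 + Cmod z) / 2) Hf Hr z ltac:(lra)).
  rewrite is_pseries_C in *. intros eps Heps. destruct (H eps Heps) as [N HN]. exists N. intros n Hn.
  rewrite (sum_n_ext _ (fun k => (taylor_coeff f ((1 + Cmod z) / 2) k * z ^ k)%C)); [apply HN, Hn|].
  intros k. rewrite (E _ k Hr). reflexivity.
Qed.

Lemma expansion_coeff (a : nat -> C) (f : C -> C) : holomorphic f -> expansion_on_disk a f ->
  forall r k, 0 < r < 1 -> a k = taylor_coeff f r k.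
Proof.
  intros Hf Ha r k Hr. destruct (holomorphic_taylor f Hf) as [b [Hb Hb']].
  rewrite <- (Hb' r k Hr). apply (pseries_coeff_unique a b f 1); [lra|exact Ha|exact Hb].
Qed.

Lemma ex_pseries_abs (a : nat -> C) (z : C) :
  Rbar_lt (Cmod z) (CV_radius (fun n => Cmod (a n))) ->
  exists l, is_pseries a z l.
Proof.
  intros H.
  apply (ex_series_le (K := C_AbsRing) (V := C_CompleteNormedModule) _ (fun n => Rabs (Cmod (a n) * Cmod z ^ n))).
  - intros n. rewrite pow_n_Cpow. change (Cmod (z ^ n * a n)%C <= Rabs (Cmod (a n) * Cmod z ^ n)).
    rewrite Cmod_mult, Cmod_pow, Rabs_pos_eq; [rewrite Rmult_comm; apply Rle_refl|].
    apply Rmult_le_pos; [apply Cmod_ge_0|apply pow_le, Cmod_ge_0].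
  - apply CV_disk_inside. rewrite Rabs_pos_eq by apply Cmod_ge_0. exact H.
Qed.

(** With n = m + 2 the bound n (n - 1) |h|^2 rho^(n-2) is twice the sharp one, but it has exactly
    the coefficients of the twice differentiated series. In the induction the remainder is
    multiplied by z + h and gains n h^2 z^(n-1). *)
Lemma pow_second_order (z h : C) (rho : R) (m : nat) :
  Cmod z <= rho -> Cmod (z + h) <= rho ->
  Cmod ((z + h) ^ S (S m) - z ^ S (S m) - RtoC (INR (S (S m))) * h * z ^ S m)
    <= INR (S m) * INR (S (S m)) * Cmod h ^ 2 * rho ^ m.
Proof.
  intros Hz Hzh.
  assert (Hrho : 0 <= rho) by (eapply Rle_trans; [apply Cmod_ge_0|exact Hz]).
  assert (Hh : 0 <= Cmod h) by apply Cmod_ge_0.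
  induction m.
  - replace ((z + h) ^ 2 - z ^ 2 - RtoC (INR 2) * h * z ^ 1)%C with (h ^ 2)%C.
    + rewrite Cmod_pow. simpl. assert (0 <= Cmod h * (Cmod h * 1)) by (rewrite Rmult_1_r; apply Rmult_le_pos; assumption). lra.
    + simpl. rewrite RtoC_plus. ring.
  - rewrite (S_INR (S (S m))).
    replace ((z + h) ^ S (S (S m)) - z ^ S (S (S m)) - RtoC (INR (S (S m)) + 1) * h * z ^ S (S m))%C
      with ((z + h) * ((z + h) ^ S (S m) - z ^ S (S m) - RtoC (INR (S (S m))) * h * z ^ S m) +
        RtoC (INR (S (S m))) * h ^ 2 * z ^ S m)%C.
    2:{ rewrite RtoC_plus, !(Cpow_S _ (S (S m))), (Cpow_S z (S m)). simpl (h ^ 2)%C. ring. }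
    eapply Rle_trans; [apply Cmod_triangle|]. rewrite !Cmod_mult, !Cmod_pow, Cmod_R.
    assert (Hn : 0 <= INR (S (S m))) by apply pos_INR. rewrite (Rabs_pos_eq (INR (S (S m)))) by exact Hn.
    assert (Hh2 : 0 <= Cmod h ^ 2) by (apply pow_le; lra).
    assert (Hrm : 0 <= rho ^ S m) by (apply pow_le; lra).
    assert (T1 : Cmod (z + h) * Cmod ((z + h) ^ S (S m) - z ^ S (S m) - RtoC (INR (S (S m))) * h * z ^ S m)
       <= rho * (INR (S m) * INR (S (S m)) * Cmod h ^ 2 * rho ^ m)).
    { apply Rmult_le_compat; [apply Cmod_ge_0|apply Cmod_ge_0|exact Hzh|exact IHm]. }
    assert (T2 : INR (S (S m)) * Cmod h ^ 2 * Cmod z ^ S m <= INR (S (S m)) * Cmod h ^ 2 * rho ^ S m).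
    { apply Rmult_le_compat_l; [apply Rmult_le_pos; assumption|]. apply pow_incr. split; [apply Cmod_ge_0|exact Hz]. }
    replace (rho * (INR (S m) * INR (S (S m)) * Cmod h ^ 2 * rho ^ m))
      with (INR (S m) * (INR (S (S m)) * Cmod h ^ 2 * rho ^ S m)) in T1 by (simpl (rho ^ S m); ring).
    set (X := INR (S (S m)) * Cmod h ^ 2 * rho ^ S m) in *.
    assert (HX : 0 <= X) by (unfold X; apply Rmult_le_pos; [apply Rmult_le_pos|]; assumption).
    replace (INR (S (S m)) * (INR (S (S m)) + 1) * Cmod h ^ 2 * rho ^ S m) with ((INR (S (S m)) + 1) * X) by (unfold X; ring).
    assert (E : INR (S (S m)) = INR (S m) + 1) by apply S_INR.
    clearbody X. assert (E' : (INR (S (S m)) + 1) * X = INR (S m) * X + 2 * X) by (rewrite E; ring).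
    rewrite E'. lra.
Qed.

(** The second-order estimate, summed over the terms, gives |f (z + h) - f z - d h| <= K |h|^2,
    where K is the second derivative of the series of moduli at a radius rho between |z| and 1. It
    is proved for partial sums and passed to the limit. *)
Lemma pseries_derivable (a : nat -> C) (f : C -> C) (z : C) :
  expansion_on_disk a f -> Cmod z < 1 ->
  exists d, is_pseries (fun n => RtoC (INR (S n)) * a (S n))%C z d
    /\ Cderiv f z d.
Proof.
  intros Ha Hz.
  set (u := fun n => Cmod (a n)).
  assert (Hu : Rbar_le 1 (CV_radius u)).
  { apply (CV_radius_expansion a f 1); [lra|exact Ha|]. intros n. unfold u. rewrite Rabs_pos_eq by apply Cmod_ge_0. lra. }
  destruct (ex_pseries_abs (fun n => RtoC (INR (S n)) * a (S n))%C z) as [d Hd].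
  { rewrite (CV_radius_ext _ (PS_derive u)).
    - rewrite CV_radius_derive. apply Rbar_lt_le_trans with 1; [exact Hz|exact Hu].
    - intros n. unfold PS_derive, u. rewrite Cmod_mult, Cmod_R, Rabs_pos_eq by apply pos_INR. reflexivity. }
  exists d. split; [exact Hd|].
  (* Halfway between |z| and 1: it dominates |z + h| for |h| <= (1 - |z|) / 2 and still lies inside
     the disk of convergence. *)
  set (rho := (1 + Cmod z) / 2). assert (Hz0 := Cmod_ge_0 z).
  assert (HK : ex_series (fun n => Rabs (PS_derive (PS_derive u) n * rho ^ n))).
  { apply CV_disk_inside. rewrite !CV_radius_derive, Rabs_pos_eq by (unfold rho; lra).
    apply Rbar_lt_le_trans with 1; [simpl; unfold rho; lra|exact Hu]. }
  set (v := fun n => Rabs (PS_derive (PS_derive u) n * rho ^ n)) in *.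
  assert (Hv : forall n, 0 <= v n) by (intros; apply Rabs_pos).
  set (K := Series v).
  assert (HsK : forall n, sum_n v n <= K).
  { intros n. apply (is_lim_seq_incr_compare (sum_n v)).
    - apply Series_correct, HK.
    - intros m. rewrite sum_Sn. change (sum_n v m <= sum_n v m + v (S m)). specialize (Hv (S m)). lra. }
  assert (HK0 : 0 <= K).
  { eapply Rle_trans; [|apply (HsK 0%nat)]. rewrite sum_O. apply Hv. }
  assert (key : forall h, Cmod h <= (1 - Cmod z) / 2 -> Cmod (f (z + h)%C - f z - d * h) <= K * Cmod h ^ 2).
  { intros h Hh.
    assert (Hzh : Cmod (z + h) <= rho) by (eapply Rle_trans; [apply Cmod_triangle|unfold rho; lra]).
    set (Sf := fun w n => sum_n (fun k => (a k * w ^ k)%C) n).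
    set (Sd := fun n => sum_n (fun k => (RtoC (INR (S k)) * a (S k) * z ^ k)%C) n).
    assert (B : forall n, Cmod (Sf (z + h)%C (S (S n)) - Sf z (S (S n)) - Sd (S n) * h) <= K * Cmod h ^ 2).
    { intros n.
      replace (Sf (z + h)%C (S (S n)) - Sf z (S (S n)) - Sd (S n) * h)%C
        with (sum_n (fun m => (a (S (S m)) * ((z + h) ^ S (S m) - z ^ S (S m) - RtoC (INR (S (S m))) * h * z ^ S m))%C) n).
      - eapply Rle_trans; [apply (Cmod_sum_n_le _ (fun m => Cmod h ^ 2 * v m))|].
        + intros k. rewrite Cmod_mult.
          eapply Rle_trans; [apply Rmult_le_compat_l; [apply Cmod_ge_0|]|].
          { apply (pow_second_order z h rho); [unfold rho; lra|exact Hzh]. }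
          right. unfold v. rewrite Rabs_pos_eq.
          * unfold PS_derive, u. ring.
          * unfold PS_derive, u. repeat apply Rmult_le_pos; try apply pos_INR; [apply Cmod_ge_0|apply pow_le; unfold rho; lra].
        + rewrite (sum_n_mult_l (K := R_Ring)).
          change (Cmod h ^ 2 * sum_n v n <= K * Cmod h ^ 2). rewrite (Rmult_comm K).
          apply Rmult_le_compat_l; [apply pow_le, Cmod_ge_0|apply HsK].
      - assert (E1 : forall w m, Sf w (S m) = (Sf w m + a (S m) * w ^ S m)%C) by (intros; apply sum_Sn_C).
        assert (E2 : forall m, Sd (S m) = (Sd m + RtoC (INR (S (S m))) * a (S (S m)) * z ^ S m)%C) by (intros; apply sum_Sn_C).
        induction n.
        + rewrite sum_0_C, !E1, E2. unfold Sf, Sd. rewrite !sum_0_C. simpl. rewrite ?RtoC_plus.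
          Cring.
        + rewrite sum_Sn_C, IHn, (E1 _ (S (S n))), (E1 z (S (S n))), (E2 (S n)).
          Cring. }
    apply le_epsilon. intros eps Heps.
    assert (Hlt : Cmod (z + h) < 1) by (unfold rho in Hzh; lra).
    destruct (proj1 (is_pseries_C _ _ _) (Ha (z + h)%C Hlt) (eps / 3)) as [N1 H1]; [lra|].
    destruct (proj1 (is_pseries_C _ _ _) (Ha z Hz) (eps / 3)) as [N2 H2]; [lra|].
    destruct (proj1 (is_pseries_C _ _ _) Hd (eps / 3)) as [N3 H3]; [lra|].
    set (N := (N1 + N2 + N3)%nat).
    specialize (H1 (S (S N)) ltac:(unfold N; lia)). specialize (H2 (S (S N)) ltac:(unfold N; lia)).
    specialize (H3 (S N) ltac:(unfold N; lia)). specialize (B N).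
    fold (Sf (z + h)%C (S (S N))) in H1. fold (Sf z (S (S N))) in H2. fold (Sd (S N)) in H3.
    replace (f (z + h)%C - f z - d * h)%C
      with (((Sf (z + h)%C (S (S N)) - Sf z (S (S N)) - Sd (S N) * h) + (Sf z (S (S N)) - f z))
        - ((Sf (z + h)%C (S (S N)) - f (z + h)%C) - (Sd (S N) - d) * h))%C by ring.
    eapply Rle_trans; [apply Cmod_minus_le|].
    eapply Rle_trans; [apply Rplus_le_compat; [apply Cmod_triangle|apply Cmod_minus_le]|].
    rewrite (Cmod_mult (Sd (S N) - d)).
    assert (Cmod (Sd (S N) - d) * Cmod h <= (eps / 3) * 1).
    { apply Rmult_le_compat; [apply Cmod_ge_0|apply Cmod_ge_0|lra|lra]. }
    lra. }
  intros eps Heps.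
  exists (Rmin ((1 - Cmod z) / 2) (eps / (K + 1))). split.
  { apply Rmin_pos; [lra|apply Rdiv_lt_0_compat; lra]. }
  intros w Hw.
  assert (W1 := Rlt_le_trans _ _ _ Hw (Rmin_l _ _)). assert (W2 := Rlt_le_trans _ _ _ Hw (Rmin_r _ _)).
  specialize (key (w - z)%C ltac:(lra)). replace (z + (w - z))%C with w in key by ring.
  eapply Rle_trans; [exact key|].
  assert (Hc : 0 <= Cmod (w - z)) by apply Cmod_ge_0.
  assert (K * Cmod (w - z) <= eps).
  { apply Rle_trans with ((K + 1) * (eps / (K + 1))); [apply Rmult_le_compat; lra|].
    right; field; lra. }
  simpl. rewrite Rmult_1_r, <- Rmult_assoc. apply Rmult_le_compat_r; assumption.
Qed.

(** The Taylor series integrated term by term. On the disk it replaces every appeal to homotopy of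
    paths: an integral along a curve becomes a difference of two values of F. *)
Lemma holomorphic_primitive (f : C -> C) : holomorphic f ->
  exists F, forall z, Cmod z < 1 -> Cderiv F z (f z).
Proof.
  intros Hf. destruct (holomorphic_taylor f Hf) as [a [Ha _]].
  set (A := fun n => match n with O => RtoC 0 | S m => (a m / RtoC (INR (S m)))%C end).
  assert (HA : forall n, (RtoC (INR (S n)) * A (S n))%C = a n).
  { intros n. unfold A. field. apply RtoC_neq_0, not_0_INR. lia. }
  assert (Hrad : Rbar_le 1 (CV_radius (fun n => Cmod (A n)))).
  { rewrite <- CV_radius_derive.
    apply (CV_radius_expansion a f 1); [lra|exact Ha|]. intros n. unfold PS_derive.
    rewrite <- (HA n), Cmod_mult, Cmod_R, Rabs_mult, (Rabs_pos_eq (Cmod _)) by apply Cmod_ge_0. lra. }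
  assert (Hex : forall z, exists l, Cmod z < 1 -> is_pseries A z l).
  { intros z. destruct (Rlt_dec (Cmod z) 1) as [L|L].
    - destruct (ex_pseries_abs A z) as [l Hl]; [apply Rbar_lt_le_trans with 1; [exact L|exact Hrad]|].
      exists l. intros _; exact Hl.
    - exists (RtoC 0). intros L'; contradiction. }
  set (F := fun z => proj1_sig (constructive_indefinite_description _ (Hex z))).
  assert (HF : expansion_on_disk A F).
  { intros z Hz. unfold F. destruct (constructive_indefinite_description _ (Hex z)) as [l Hl]. apply Hl, Hz. }
  exists F. intros z Hz. destruct (pseries_derivable A F z HF Hz) as [d [Hd1 Hd2]].
  replace (f z) with d; [exact Hd2|].
  assert (Hd3 : is_pseries a z d).
  { rewrite is_pseries_C in *. intros eps Heps. destruct (Hd1 eps Heps) as [N HN]. exists N. intros n Hn.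
    rewrite (sum_n_ext _ (fun k => (RtoC (INR (S k)) * A (S k) * z ^ k)%C)); [apply HN, Hn|].
    intros k. rewrite HA. reflexivity. }
  assert (Hfz := Ha z Hz).
  apply Ceq_minus, Cmod_eq_0, Rle_antisym; [|apply Cmod_ge_0].
  apply le_epsilon. intros eps Heps. rewrite Rplus_0_l.
  destruct (proj1 (is_pseries_C _ _ _) Hd3 (eps / 2)) as [N1 H1]; [lra|].
  destruct (proj1 (is_pseries_C _ _ _) Hfz (eps / 2)) as [N2 H2]; [lra|].
  specialize (H1 (N1 + N2)%nat ltac:(lia)). specialize (H2 (N1 + N2)%nat ltac:(lia)).
  set (s := sum_n (fun k => (a k * z ^ k)%C) (N1 + N2)) in *.
  replace (d - f z)%C with ((s - f z) - (s - d))%C by ring.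
  eapply Rle_trans; [apply Cmod_minus_le|]. lra.
Qed.

(** * Kernel estimates *)

Lemma Ceq_eps (x y : C) : (forall eps, 0 < eps -> Cmod (x - y) <= eps) -> x = y.
Proof.
  intros H. apply Ceq_minus, Cmod_eq_0, Rle_antisym; [|apply Cmod_ge_0].
  apply le_epsilon. intros eps Heps. rewrite Rplus_0_l. apply H, Heps.
Qed.

Lemma Rpower_pos (x y : R) : 0 < Rpower x y.
Proof. apply exp_pos. Qed.

Lemma Rpower_base_le (x y a : R) : 0 <= a -> 0 < x <= y -> Rpower x a <= Rpower y a.
Proof. intros Ha Hx. apply Rle_Rpower_l; [exact Ha|lra]. Qed.

Lemma Rpower_base_le_neg (x y a : R) : a <= 0 -> 0 < x <= y -> Rpower y a <= Rpower x a.
Proof.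
  intros Ha Hx. replace a with (- (- a)) by ring. rewrite !(Rpower_Ropp _ (- a)).
  apply Rinv_le_contravar; [apply Rpower_pos|]. apply Rpower_base_le; lra.
Qed.

Lemma Rpower_small (a eps : R) : 0 < a -> 0 < eps ->
  exists d, 0 < d /\ forall x, 0 < x <= d -> Rpower x a <= eps.
Proof.
  intros Ha He. exists (Rpower eps (/ a)). split; [apply Rpower_pos|].
  intros x Hx. eapply Rle_trans; [apply Rpower_base_le; [lra|exact Hx]|].
  rewrite Rpower_mult, Rinv_l, Rpower_1 by lra. lra.
Qed.

Lemma Rpower_inv_base (x a : R) : 0 < x -> Rpower (/ x) a = Rpower x (- a).
Proof. intros Hx. unfold Rpower. rewrite ln_Rinv by exact Hx. f_equal. ring. Qed.

Lemma is_derive_Rpower_one_minus (a x : R) : x < 1 ->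
  is_derive (fun x => Rpower (1 - x) a) x (- a * Rpower (1 - x) (a - 1)).
Proof.
  intros Hx.
  evar_last.
  - apply (is_derive_comp (fun y => Rpower y a) (fun x => 1 - x) x).
    + apply is_derive_Reals, derivable_pt_lim_power. lra.
    + apply (is_derive_minus (fun _ => 1) (fun x => x)); [apply is_derive_const|apply is_derive_id].
  - unfold scal, minus, plus, opp, zero, one; simpl. unfold mult; simpl. ring.
Qed.

Lemma continuous_Rpower_one_minus (a x : R) : x < 1 -> continuous (fun x => Rpower (1 - x) a) x.
Proof.
  intros Hx. apply (ex_derive_continuous (V := R_NormedModule)).
  eexists. apply is_derive_Rpower_one_minus, Hx.
Qed.

Lemma is_RInt_Rpower_one_minus (a s t : R) : 0 < a < 1 -> s <= t -> t < 1 ->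
  is_RInt (fun x => Rpower (1 - x) (- a)) s t ((Rpower (1 - s) (1 - a) - Rpower (1 - t) (1 - a)) / (1 - a)).
Proof.
  intros Ha Hst Ht.
  evar_last.
  - apply (is_RInt_derive (V := R_CompleteNormedModule) (fun x => - / (1 - a) * Rpower (1 - x) (1 - a))).
    + intros x. rewrite Rmin_left, Rmax_right by lra. intros Hx.
      evar_last.
      * apply (is_derive_scal (fun x => Rpower (1 - x) (1 - a))).
        apply is_derive_Rpower_one_minus. lra.
      * replace (1 - a - 1) with (- a) by ring. field. lra.
    + intros x. rewrite Rmin_left, Rmax_right by lra. intros Hx.
      apply continuous_Rpower_one_minus. lra.
  - unfold minus, plus, opp; simpl. field. lra.
Qed.

Lemma CInt_tail_bound (g : R -> C) (B a s t : R) : 0 < a < 1 -> 0 <= B -> s <= t < 1 ->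
  (forall x, s <= x <= t -> Ccont_curve g x) ->
  (forall x, s < x < t -> Cmod (g x) <= B * Rpower (1 - x) (- a)) ->
  Cmod (CInt g s t) <= B / (1 - a) * Rpower (1 - s) (1 - a).
Proof.
  intros Ha HB Hst Hg Hle.
  eapply Rle_trans.
  - apply (Cmod_CInt_le g (fun x => B * Rpower (1 - x) (- a)) s t); [lra| | |exact Hle].
    + apply CInt_correct_le; [lra|]. exact Hg.
    + apply (is_RInt_scal (V := R_NormedModule) (fun x => Rpower (1 - x) (- a)) s t B).
      apply is_RInt_Rpower_one_minus; lra.
  - unfold scal; simpl; unfold mult; simpl. assert (P := Rpower_pos (1 - t) (1 - a)).
    replace (B / (1 - a) * Rpower (1 - s) (1 - a)) with (B * ((Rpower (1 - s) (1 - a) - 0) / (1 - a))) by (field; lra).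
    apply Rmult_le_compat_l; [exact HB|]. apply Rmult_le_compat_r; [left; apply Rinv_0_lt_compat; lra|lra].
Qed.

(** The improper integral is produced together with its rate of convergence, and all later uses
    compare truncated integrals with L through that rate. *)
Lemma CInt_improper (g : R -> C) (B a : R) : 0 < a < 1 -> 0 <= B ->
  (forall x, 0 <= x < 1 -> Ccont_curve g x) ->
  (forall x, 0 <= x < 1 -> Cmod (g x) <= B * Rpower (1 - x) (- a)) ->
  exists L, forall t, 0 <= t < 1 -> Cmod (CInt g 0 t - L) <= B / (1 - a) * Rpower (1 - t) (1 - a).
Proof.
  intros Ha HB Hg Hle.
  set (K := B / (1 - a)). assert (HK : 0 <= K) by (apply Rdiv_le_0_compat; lra).
  assert (D : forall s t, 0 <= s -> s <= t -> t < 1 -> Cmod (CInt g 0 t - CInt g 0 s) <= K * Rpower (1 - s) (1 - a)).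
  { intros s t Hs Hst Ht. rewrite <- (CInt_Chasles g 0 s t) by (try lra; intros; apply Hg; lra).
    replace (CInt g 0 s + CInt g s t - CInt g 0 s)%C with (CInt g s t) by ring.
    apply CInt_tail_bound; try lra; intros; [apply Hg|apply Hle]; lra. }
  (* The limit is taken along these cut-offs; the estimate D extends it to every t. *)
  set (T := fun n => 1 - / INR (S n)).
  assert (HT : forall n, 0 < / INR (S n) <= 1).
  { intros n. assert (1 <= INR (S n)) by (rewrite S_INR; generalize (pos_INR n); lra).
    split; [apply Rinv_0_lt_compat; lra|]. replace 1 with (/ 1) by apply Rinv_1. apply Rinv_le_contravar; lra. }
  assert (HT2 : forall n m, (n <= m)%nat -> T n <= T m).
  { intros n m Hnm. unfold T. assert (/ INR (S m) <= / INR (S n)); [|lra].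
    apply Rinv_le_contravar; [apply lt_0_INR; lia|apply le_INR; lia]. }
  assert (HT3 : forall d, 0 < d -> exists n, / INR (S n) <= d).
  { intros d Hd. destruct (archimed_cor1 d Hd) as [N [HN1 HN2]]. exists N.
    left. eapply Rle_lt_trans; [|exact HN1]. apply Rinv_le_contravar; [apply lt_0_INR; lia|apply le_INR; lia]. }
  assert (Cau : forall eps, 0 < eps -> exists N, forall n m, (N <= n)%nat -> (n <= m)%nat ->
     Cmod (CInt g 0 (T m) - CInt g 0 (T n)) <= eps).
  { intros eps Heps.
    destruct (Rpower_small (1 - a) (eps / (K + 1))) as [d [Hd Hd']]; [lra|apply Rdiv_lt_0_compat; lra|].
    destruct (HT3 d Hd) as [N HN]. exists N. intros n m Hn Hm.
    assert (HTn := HT n). assert (HTm := HT m). assert (Hnm := HT2 n m Hm). assert (HNn := HT2 N n Hn).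
    eapply Rle_trans; [apply D; unfold T in *; lra|].
    apply Rle_trans with ((K + 1) * (eps / (K + 1))).
    - apply Rmult_le_compat; [lra|left; apply Rpower_pos|lra|]. apply Hd'. unfold T in *; lra.
    - right; field; lra. }
  assert (Lim : forall P : C -> R, (forall u v, P (u - v)%C = P u - P v) -> (forall u, Rabs (P u) <= Cmod u) ->
     exists l : R, is_lim_seq (fun n => P (CInt g 0 (T n))) l).
  { intros P H1 H2. apply ex_lim_seq_cauchy_corr. intros [eps Heps]. simpl.
    destruct (Cau (eps / 2)) as [N HN]; [lra|]. exists N. intros n m Hn Hm.
    rewrite <- H1. eapply Rle_lt_trans; [apply H2|].
    apply Rle_lt_trans with (eps / 2); [|lra].
    destruct (Nat.le_ge_cases n m) as [L|L]; [rewrite Cmod_minus_sym; apply HN; assumption|apply HN; assumption]. }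
  destruct (Lim Re re_minus re_le_Cmod) as [lr Hr]. destruct (Lim Im im_minus im_le_Cmod) as [li Hi].
  exists ((lr, li) : C). intros t Ht.
  apply le_epsilon. intros eps Heps.
  apply is_lim_seq_spec in Hr, Hi.
  destruct (Hr (mkposreal (eps / 2) ltac:(lra))) as [N1 HN1].
  destruct (Hi (mkposreal (eps / 2) ltac:(lra))) as [N2 HN2].
  destruct (HT3 (1 - t) ltac:(lra)) as [N3 HN3].
  set (N := (N1 + N2 + N3)%nat).
  specialize (HN1 N ltac:(unfold N; lia)). specialize (HN2 N ltac:(unfold N; lia)). cbn [pos] in HN1, HN2.
  assert (HN4 := HT2 N3 N ltac:(unfold N; lia)). assert (HTN := HT N).
  replace (CInt g 0 t - (lr, li))%C with ((CInt g 0 (T N) - (lr, li)) - (CInt g 0 (T N) - CInt g 0 t))%C by ring.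
  eapply Rle_trans; [apply Cmod_minus_le|]. rewrite Rplus_comm. apply Rplus_le_compat.
  - apply D; unfold T in *; lra.
  - eapply Rle_trans; [apply Cmod_le_Rabs|]. rewrite re_minus, im_minus. cbn [Re Im fst snd].
    unfold Re, Im in *. lra.
Qed.

(** The alternating series gives t - t^3 / 6 <= sin t, and t <= PI / 2 <= 2 makes t^2 <= 4. *)
Lemma sin_ge_third (t : R) : 0 <= t <= PI / 2 -> t / 3 <= sin t.
Proof.
  intros Ht. assert (HP := PI_4).
  destruct (pre_sin_bound t 0) as [H _]; [lra|lra|].
  unfold sin_approx, sin_term in H. simpl in H.
  assert (t * t <= 4) by nra. assert (0 <= t * (4 - t * t)) by (apply Rmult_le_pos; lra). lra.
Qed.

(** For |t| <= PI / 2 the imaginary part r sin t suffices. Beyond that cos t <= 0, so the point is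
    at distance at least r >= 1/2 from the nonnegative axis, and |t| / 8 <= 1/2 since PI <= 4. *)
Lemma circle_point_dist_angle (r x t : R) : 1 / 2 <= r -> 0 <= x -> - PI <= t <= PI ->
  Rabs t / 8 <= Cmod (RtoC r * cis t - RtoC x).
Proof.
  intros Hr Hx Ht. assert (HP := PI_4). assert (HP0 := PI_RGT_0).
  assert (Hre : Re (RtoC r * cis t - RtoC x)%C = r * cos t - x).
  { rewrite re_minus, re_scal_l. reflexivity. }
  assert (Him : Im (RtoC r * cis t - RtoC x)%C = r * sin t).
  { rewrite im_minus, im_scal_l. simpl. ring. }
  destruct (Rle_dec (Rabs t) (PI / 2)) as [L|L].
  - eapply Rle_trans; [|apply im_le_Cmod]. rewrite Him, Rabs_mult, (Rabs_pos_eq r) by lra.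
    assert (Hs : Rabs t / 3 <= Rabs (sin t)).
    { destruct (Rle_dec 0 t) as [T|T].
      - rewrite (Rabs_pos_eq t) in * by lra. eapply Rle_trans; [apply sin_ge_third; lra|apply Rle_abs].
      - rewrite (Rabs_left t) in * by lra. rewrite <- Rabs_Ropp, <- sin_neg.
        eapply Rle_trans; [apply sin_ge_third; lra|apply Rle_abs]. }
    assert (0 <= Rabs t) by apply Rabs_pos.
    apply Rle_trans with (1 / 2 * (Rabs t / 3)); [lra|]. apply Rmult_le_compat; lra.
  - assert (Hc : cos t <= 0).
    { destruct (Rle_dec 0 t) as [T|T].
      - rewrite (Rabs_pos_eq t) in L by lra. apply cos_le_0; lra.
      - rewrite (Rabs_left t) in L by lra. rewrite <- cos_neg. apply cos_le_0; lra. }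
    assert (Ht1 : Rabs t <= PI) by (apply Rabs_le; lra).
    apply Rle_trans with r; [lra|].
    apply Rsqr_incr_0_var; [|apply Cmod_ge_0].
    rewrite !Rsqr_pow2, Cmod2_alt, Hre, Him.
    assert (S := sin2_cos2 t). unfold Rsqr in S.
    assert (0 <= r * x * - cos t) by (apply Rmult_le_pos; [apply Rmult_le_pos; lra|lra]).
    assert (0 <= x * x) by nra.
    replace ((r * cos t - x) ^ 2 + (r * sin t) ^ 2)
      with (r * r * (sin t * sin t + cos t * cos t) + 2 * (r * x * - cos t) + x * x) by ring.
    rewrite S. simpl. lra.
Qed.

(** Averages the radial bound d / 2 and the angular bound |t| / 8. *)
Lemma circle_point_dist (r x t d : R) : 1 / 2 <= r -> 0 <= x -> - PI <= t <= PI -> d / 2 <= Rabs (r - x) ->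
  (d + Rabs t) / 16 <= Cmod (RtoC r * cis t - RtoC x).
Proof.
  intros Hr Hx Ht Hd.
  assert (A1 := circle_point_dist_angle r x t Hr Hx Ht).
  assert (A2 : Rabs (r - x) <= Cmod (RtoC r * cis t - RtoC x)).
  { assert (B1 := Cmod_triangle_minus (RtoC r * cis t) (RtoC x)).
    assert (B2 := Cmod_triangle_minus (RtoC x) (RtoC r * cis t)). rewrite Cmod_minus_sym in B2.
    rewrite Cmod_circle_point, Cmod_R, Rabs_pos_eq in B1, B2 by lra. apply Rabs_le; lra. }
  assert (0 <= Rabs t) by apply Rabs_pos. lra.
Qed.

Lemma is_RInt_kernel (d : R) : 0 < d ->
  is_RInt (fun t => / (d + Rabs t)) (- PI) PI (2 * ln ((d + PI) / d)).
Proof.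
  intros Hd. assert (HP := PI_RGT_0).
  rewrite ln_div by lra.
  replace (2 * (ln (d + PI) - ln d)) with (plus (ln (d + PI) - ln d) (ln (d + PI) - ln d))
    by (unfold plus; simpl; ring).
  apply (is_RInt_Chasles (V := R_NormedModule) _ (- PI) 0 PI).
  - apply (is_RInt_ext (V := R_NormedModule) (fun t => / (d - t))).
    { intros t. rewrite Rmin_left, Rmax_right by lra. intros Ht. rewrite Rabs_left by lra. reflexivity. }
    replace (ln (d + PI) - ln d) with (minus ((fun t => - ln (d - t)) 0) ((fun t => - ln (d - t)) (- PI))).
    2:{ unfold minus, plus, opp; simpl. rewrite Rminus_0_r. replace (d - - PI) with (d + PI) by ring. ring. }
    apply (is_RInt_derive (V := R_CompleteNormedModule) (fun t => - ln (d - t))).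
    + intros t. rewrite Rmin_left, Rmax_right by lra. intros Ht. auto_derive; [lra|field; lra].
    + intros t. rewrite Rmin_left, Rmax_right by lra. intros Ht.
      apply (ex_derive_continuous (V := R_NormedModule)). auto_derive. lra.
  - apply (is_RInt_ext (V := R_NormedModule) (fun t => / (d + t))).
    { intros t. rewrite Rmin_left, Rmax_right by lra. intros Ht. rewrite Rabs_pos_eq by lra. reflexivity. }
    replace (ln (d + PI) - ln d) with (minus ((fun t => ln (d + t)) PI) ((fun t => ln (d + t)) 0)).
    2:{ unfold minus, plus, opp; simpl. rewrite Rplus_0_r. ring. }
    apply (is_RInt_derive (V := R_CompleteNormedModule) (fun t => ln (d + t))).
    + intros t. rewrite Rmin_left, Rmax_right by lra. intros Ht. auto_derive; [lra|field; lra].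
    + intros t. rewrite Rmin_left, Rmax_right by lra. intros Ht.
      apply (ex_derive_continuous (V := R_NormedModule)). auto_derive. lra.
Qed.

(** The Cauchy kernel at distance d from the circle costs only a logarithm after integration,
    instead of the factor 1 / d of a pointwise estimate. The 5 bounds d + PI. *)
Lemma Cmod_CInt_kernel_le (g : R -> C) (B d : R) : 0 < d <= 1 -> 0 <= B -> (forall t, Ccont_curve g t) ->
  (forall t, - PI <= t <= PI -> Cmod (g t) <= B / (d + Rabs t)) ->
  Cmod (CInt g (- PI) PI) <= 2 * B * ln (5 / d).
Proof.
  intros Hd HB Hg Hle. assert (HP := PI_4). assert (HP0 := PI_RGT_0).
  eapply Rle_trans.
  - apply (Cmod_CInt_le g (fun t => B * / (d + Rabs t)) (- PI) PI); [lra| | |].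
    + apply CInt_correct_everywhere, Hg.
    + apply (is_RInt_scal (V := R_NormedModule) (fun t => / (d + Rabs t)) (- PI) PI B).
      apply is_RInt_kernel; lra.
    + intros t Ht. apply Hle. lra.
  - unfold scal; simpl; unfold mult; simpl.
    assert (ln ((d + PI) / d) <= ln (5 / d)).
    { apply ln_le; [apply Rdiv_lt_0_compat; lra|]. apply Rmult_le_compat_r; [left; apply Rinv_0_lt_compat; lra|lra]. }
    replace (2 * B * ln (5 / d)) with (B * (2 * ln (5 / d))) by ring.
    apply Rmult_le_compat_l; lra.
Qed.

(** * Convergence of the Hilbert coefficients *)

Lemma ln_le_Rpower (y s : R) : 0 < s -> ln y <= Rpower y s / s.
Proof.
  intros Hs. apply Rle_div_r; [exact Hs|].
  unfold Rpower. generalize (exp_ineq1_le (s * ln y)). lra.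
Qed.

Lemma exp_le_compat (x y : R) : x <= y -> exp x <= exp y.
Proof. intros [H|H]; [left; apply exp_increasing, H|right; rewrite H; reflexivity]. Qed.

Lemma pow_le_exp (y x : R) (n : nat) : 0 <= y -> y <= exp x -> y ^ n <= exp (INR n * x).
Proof.
  intros Hy H. induction n.
  - simpl. rewrite Rmult_0_l, exp_0. lra.
  - rewrite S_INR. simpl. replace ((INR n + 1) * x) with (x + INR n * x) by ring. rewrite exp_plus.
    apply Rmult_le_compat; [exact Hy|apply pow_le, Hy|exact H|exact IHn].
Qed.

(** At t = 1 this writes a partial sum of the Hilbert series as the integral over [0, 1] of x^n
    times the Taylor polynomial. *)
Lemma is_CInt_poly (c : nat -> C) (n N : nat) (t : R) :
  is_CInt (fun x => RtoC x ^ n * sum_n (fun k => (c k * RtoC x ^ k)%C) N)%C 0 t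
    (sum_n (fun k => (c k / RtoC (INR (n + k + 1)) * RtoC t ^ (n + k + 1))%C) N).
Proof.
  assert (mono : forall k, is_CInt (fun x => RtoC x ^ n * (c k * RtoC x ^ k))%C 0 t
     (c k / RtoC (INR (n + k + 1)) * RtoC t ^ (n + k + 1))%C).
  { intros k. set (m := (n + k)%nat).
    assert (Hm : RtoC (INR (m + 1)) <> 0%C) by (apply RtoC_neq_0, not_0_INR; lia).
    replace (c k / RtoC (INR (m + 1)) * RtoC t ^ (m + 1))%C
      with ((fun x => c k / RtoC (INR (m + 1)) * RtoC (x ^ (m + 1)))%C t - (fun x => c k / RtoC (INR (m + 1)) * RtoC (x ^ (m + 1)))%C 0)%C.
    2:{ cbv beta. rewrite RtoC_pow.
        replace (0 ^ (m + 1)) with 0 by (rewrite pow_ne_zero by lia; reflexivity).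
        Cring. }
    apply (is_CInt_FTC (fun x => c k / RtoC (INR (m + 1)) * RtoC (x ^ (m + 1)))%C).
    - intros x _.
      assert (D : is_curve_derive (fun x => RtoC (x ^ (m + 1))) x (RtoC (INR (m + 1)) * RtoC (x ^ m))%C).
      { rewrite <- RtoC_mult. split; cbn [Re Im RtoC fst snd].
        - evar_last; [apply (is_derive_pow (fun x => x) (m + 1) x 1), (is_derive_id (K := R_AbsRing))|].
          replace (pred (m + 1)) with m by lia. ring.
        - apply (is_derive_const (K := R_AbsRing) (V := R_NormedModule) 0). }
      replace (RtoC x ^ n * (c k * RtoC x ^ k))%C
        with ((c k / RtoC (INR (m + 1))) * (RtoC (INR (m + 1)) * RtoC (x ^ m)))%C.
      + apply (is_curve_derive_comp (fun w => c k / RtoC (INR (m + 1)) * w)%C (fun x => RtoC (x ^ (m + 1)))); [apply Cderiv_linear|exact D].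
      + rewrite RtoC_pow. assert (Em : (RtoC x ^ m)%C = (RtoC x ^ n * RtoC x ^ k)%C) by (unfold m; apply Cpow_add_r).
        rewrite Em. field. exact Hm.
    - intros x _. apply Ccont_curve_mult; [apply (Ccont_curve_pow RtoC), Ccont_curve_RtoC|].
      apply Ccont_curve_mult; [apply Ccont_curve_const|apply (Ccont_curve_pow RtoC), Ccont_curve_RtoC]. }
  induction N.
  - rewrite sum_0_C. eapply is_CInt_ext; [|apply mono]. intros x _. cbv beta. rewrite sum_0_C. reflexivity.
  - rewrite sum_Sn_C. eapply is_CInt_ext; [|apply (is_CInt_plus _ _ _ _ _ _ IHN (mono (S N)))].
    intros x _. cbv beta. rewrite sum_Sn_C.
    Cring.
Qed.

Lemma Ccont_curve_sum_n (c : nat -> R -> C) (N : nat) (t : R) :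
  (forall k, Ccont_curve (c k) t) -> Ccont_curve (fun x => sum_n (fun k => c k x) N) t.
Proof.
  intros H. induction N.
  - eapply Ccont_curve_ext; [|apply (H 0%nat)]. intros s. rewrite sum_0_C. reflexivity.
  - eapply Ccont_curve_ext; [|apply (Ccont_curve_plus _ _ _ IHN (H (S N)))]. intros s. cbv beta. rewrite sum_Sn_C. reflexivity.
Qed.

Section Growth.
Variables (f : C -> C) (a : nat -> C) (al M : R).
Hypothesis Hal : 0 < al < 1.
Hypothesis HM : 0 <= M.
Hypothesis Hf : holomorphic f.
Hypothesis Ha : expansion_on_disk a f.
Hypothesis Hgrowth : forall z, Cmod z < 1 -> Cmod (f z) <= M * Rpower (1 - Cmod z) (- al).

Let psum (N : nat) (x : R) : C := sum_n (fun k => (a k * RtoC x ^ k)%C) N.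

Let cf (x : R) : 0 <= x < 1 -> Ccont_curve (fun x => f (RtoC x)) x.
Proof.
  intros Hx. apply (Ccont_curve_comp f RtoC); [|apply Ccont_curve_RtoC].
  destruct (Hf (RtoC x)) as [l Hl]; [rewrite Cmod_R, Rabs_pos_eq; lra|]. exact (Cderiv_Ccont _ _ _ Hl).
Qed.

Let growth_real (x : R) : 0 <= x < 1 -> Cmod (f (RtoC x)) <= M * Rpower (1 - x) (- al).
Proof.
  intros Hx. assert (H := Hgrowth (RtoC x)). rewrite Cmod_R, (Rabs_pos_eq x) in H by lra. apply H; lra.
Qed.

Section Step.
Variable N : nat.
Hypothesis HN : (4 <= N)%nat.
Let d := / INR N.
(** The size of Taylor remainders and Taylor polynomials at distance about d from the circle: M (d /
    2)^(-al) bounds f on the circles used, 16 comes from the distance to the kernel's pole, the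
    logarithm from integrating the kernel. Thus Q is O(N^al ln N), and a factor 1 / N suffices to
    make it small. *)
Let Q := 16 * M * Rpower (d / 2) (- al) * ln (5 / d).

Let Hd : 0 < d <= 1 / 4.
Proof.
  assert (4 <= INR N) by (replace 4 with (INR 4) by (simpl; ring); apply le_INR, HN).
  unfold d. split; [apply Rinv_0_lt_compat; lra|].
  replace (1 / 4) with (/ 4) by lra. apply Rinv_le_contravar; lra.
Qed.

Let HdN : INR N * d = 1.
Proof. unfold d. field. apply not_0_INR. lia. Qed.

Let Hln : 0 <= ln (5 / d).
Proof.
  rewrite <- ln_1. apply ln_le; [lra|]. apply Rle_div_r; lra.
Qed.

Let HQ : 0 <= Q.
Proof.
  unfold Q. apply Rmult_le_pos; [|exact Hln]. apply Rmult_le_pos; [lra|left; apply Rpower_pos].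
Qed.

Let circ_f (r t : R) : 0 < r < 1 -> Cmod (f (RtoC r * cis t)%C) <= M * Rpower (1 - r) (- al).
Proof.
  intros Hr. assert (H := Hgrowth (RtoC r * cis t)%C). rewrite Cmod_circle_point in H by lra. apply H; lra.
Qed.

Let inv_bound (r x t : R) : 1 / 2 <= r < 1 -> 0 <= x -> - PI <= t <= PI -> d / 2 <= Rabs (r - x) ->
  (1 - RtoC x / (RtoC r * cis t))%C <> 0%C /\ / Cmod (1 - RtoC x / (RtoC r * cis t)) <= 16 / (d + Rabs t).
Proof.
  intros Hr Hx Ht Hdist.
  assert (D := circle_point_dist r x t d ltac:(lra) Hx Ht Hdist).
  assert (Ht0 := Rabs_pos t).
  assert (N0 := circle_point_neq_0 r t ltac:(lra)).
  assert (E : (1 - RtoC x / (RtoC r * cis t) = (RtoC r * cis t - RtoC x) / (RtoC r * cis t))%C).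
  { unfold Cdiv, Cminus. rewrite Cmult_plus_distr_r, Cinv_r by exact N0. ring. }
  assert (Em : Cmod (1 - RtoC x / (RtoC r * cis t)) = Cmod (RtoC r * cis t - RtoC x) / r).
  { rewrite E, Cmod_div by exact N0. rewrite (Cmod_circle_point r t) by lra. reflexivity. }
  assert (L : (d + Rabs t) / 16 <= Cmod (1 - RtoC x / (RtoC r * cis t))).
  { rewrite Em. eapply Rle_trans; [exact D|]. apply Rle_div_r; [lra|].
    rewrite <- (Rmult_1_r (Cmod (RtoC r * cis t - RtoC x))) at 2.
    apply Rmult_le_compat_l; [apply Cmod_ge_0|lra]. }
  split; [apply Cmod_gt_0; lra|].
  replace (16 / (d + Rabs t)) with (/ ((d + Rabs t) / 16)) by (field; lra).
  apply Rinv_le_contravar; lra.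
Qed.

(** The circle of radius 1 - d / 2 keeps distance d / 2 from x. The factor (x / (1 - d))^(N+1) is
    retained, since its integral over [0, 1 - d] supplies the factor 1 / N. *)
Let remainder_bound (x : R) : 0 <= x <= 1 - d -> Cmod (f (RtoC x) - psum N x) <= Q * (x / (1 - d)) ^ S N.
Proof.
  intros Hx. assert (HP := PI_RGT_0). assert (HP2 := PI2_1).
  set (r := 1 - d / 2). assert (Hr : 1 / 2 <= r < 1) by (unfold r; lra).
  assert (Hmx : Cmod (RtoC x) = x) by (rewrite Cmod_R, Rabs_pos_eq; lra).
  assert (T := taylor_formula f r Hf ltac:(lra) (RtoC x) ltac:(rewrite Hmx; unfold r; lra) N).
  replace (psum N x) with (sum_n (fun k => (taylor_coeff f r k * RtoC x ^ k)%C) N).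
  2:{ apply sum_n_ext. intros k. rewrite (expansion_coeff a f Hf Ha r k) by lra. reflexivity. }
  rewrite T at 1. set (s := sum_n _ N).
  replace (s + taylor_rem f r (RtoC x) (S N) - s)%C with (taylor_rem f r (RtoC x) (S N)) by ring.
  unfold taylor_rem. rewrite Cmod_div by (apply RtoC_neq_0; lra).
  rewrite Cmod_R, (Rabs_pos_eq (2 * PI)) by lra. apply Rle_div_l; [lra|].
  set (B := 16 * M * Rpower (d / 2) (- al) * (x / (1 - d)) ^ S N).
  assert (Hq : 0 <= x / (1 - d)) by (apply Rdiv_le_0_compat; lra).
  assert (HB : 0 <= B).
  { unfold B. apply Rmult_le_pos; [apply Rmult_le_pos; [lra|left; apply Rpower_pos]|apply pow_le, Hq]. }
  eapply Rle_trans.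
  - apply (Cmod_CInt_kernel_le _ B d); [lra|exact HB| |].
    + intros t. apply (Ccont_curve_taylor_rem r ltac:(lra) (RtoC x) ltac:(rewrite Hmx; unfold r; lra)
        (fun t => f (RtoC r * cis t)%C) (S N) t).
      apply (Ccont_curve_circle f r Hf ltac:(lra)).
    + intros t Ht. cbv beta.
      destruct (inv_bound r x t Hr ltac:(lra) Ht) as [I1 I2].
      { rewrite Rabs_pos_eq; unfold r; lra. }
      rewrite Cmod_div by exact I1. rewrite Cmod_mult, Cmod_pow, Cmod_quot by lra. rewrite Hmx.
      replace (B / (d + Rabs t)) with ((M * Rpower (1 - r) (- al) * (x / (1 - d)) ^ S N) * (16 / (d + Rabs t))).
      2:{ unfold B. replace (1 - r) with (d / 2) by (unfold r; ring). field. generalize (Rabs_pos t). lra. }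
      unfold Rdiv at 1. apply Rmult_le_compat.
      * apply Rmult_le_pos; [apply Cmod_ge_0|apply pow_le, Rdiv_le_0_compat; lra].
      * left. apply Rinv_0_lt_compat. apply Cmod_gt_0, I1.
      * apply Rmult_le_compat; [apply Cmod_ge_0|apply pow_le, Rdiv_le_0_compat; lra|apply circ_f; lra|].
        apply pow_incr. split; [apply Rdiv_le_0_compat; lra|].
        apply Rmult_le_compat_l; [lra|]. apply Rinv_le_contravar; unfold r; lra.
      * exact I2.
  - unfold B, Q.
    set (u := (x / (1 - d)) ^ S N). assert (Hu : 0 <= u) by (apply pow_le, Hq).
    replace (2 * (16 * M * Rpower (d / 2) (- al) * u) * ln (5 / d)) with (Q * u * 2) by (unfold Q; ring).
    fold Q. apply Rmult_le_compat_l; [apply Rmult_le_pos; assumption|lra].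
Qed.

Let geom_sum (u : C) (n : nat) : (1 - u)%C <> 0%C -> sum_n (fun k => u ^ k)%C n = ((1 - u ^ S n) / (1 - u))%C.
Proof.
  intros Hu. induction n.
  - rewrite sum_0_C. simpl. field. exact Hu.
  - rewrite sum_Sn_C, IHn. match goal with |- ?x = ?y => change (@eq C x y) end.
    rewrite !(Cpow_S u). field. exact Hu.
Qed.

(** Near 1 the polynomial is not compared with f, which may be unbounded there, but estimated alone.
    Its coefficients are taken on the smaller circle of radius 1 - 2 d, so that x lies at distance
    at least d outside; the geometric sum (1 - u^(N+1)) / (1 - u) then needs only a bound on
    |u|^(N+1). *)
Let psum_bound (x : R) : 1 - d <= x <= 1 -> Cmod (psum N x) <= Q * (1 + exp 5).
Proof.
  intros Hx. assert (HP := PI_RGT_0). assert (HP2 := PI2_1).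
  set (r := 1 - 2 * d). assert (Hr : 1 / 2 <= r < 1) by (unfold r; lra).
  (* For d <= 1/4 one has 1 / r <= 1 + 4 d <= exp (4 d), and (N + 1) 4 d = 4 + 4 d <= 5. *)
  assert (Hpw : (/ r) ^ S N <= exp 5).
  { apply Rle_trans with (exp (INR (S N) * (4 * d))).
    - apply pow_le_exp; [left; apply Rinv_0_lt_compat; lra|].
      eapply Rle_trans; [|apply exp_ineq1_le].
      apply Rmult_le_reg_r with r; [lra|]. rewrite Rinv_l by lra. unfold r. nra.
    - apply exp_le_compat. rewrite S_INR.
      replace ((INR N + 1) * (4 * d)) with (4 * (INR N * d) + 4 * d) by ring. rewrite HdN. lra. }
  set (g := fun t => (f (RtoC r * cis t) * sum_n (fun k => (RtoC x / (RtoC r * cis t)) ^ k) N)%C).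
  assert (Hg : forall t, Ccont_curve g t).
  { intros t. apply Ccont_curve_mult; [apply (Ccont_curve_circle f r Hf ltac:(lra))|].
    apply Ccont_curve_sum_n. intros k. apply (Ccont_curve_pow (fun t => RtoC x / (RtoC r * cis t))%C).
    apply Ccont_curve_div; [apply circle_point_neq_0; lra|apply Ccont_curve_const|apply Ccont_curve_circle_point]. }
  assert (E : psum N x = (CInt g (- PI) PI / RtoC (2 * PI))%C).
  { assert (H2P : RtoC (2 * PI) <> 0%C) by (apply RtoC_neq_0; lra).
    cut (forall n, CInt (fun t => f (RtoC r * cis t) * sum_n (fun k => (RtoC x / (RtoC r * cis t)) ^ k) n)%C (- PI) PI
       = (psum n x * RtoC (2 * PI))%C).
    { intros K. unfold g. rewrite (K N). field. exact H2P. }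
    assert (T : forall k, is_CInt (fun t => f (RtoC r * cis t) * (RtoC x / (RtoC r * cis t)) ^ k)%C (- PI) PI (a k * RtoC x ^ k * RtoC (2 * PI))%C).
    { intros k. rewrite (expansion_coeff a f Hf Ha r k) by lra. unfold taylor_coeff.
      apply (is_CInt_ext (fun t => RtoC x ^ k * (f (RtoC r * cis t) / (RtoC r * cis t) ^ k))%C).
      - intros t _. unfold Cdiv. rewrite (Cpow_mult_l (RtoC x) (/ _)), Cpow_inv by (apply circle_point_neq_0; lra). ring.
      - match goal with |- is_CInt _ _ _ (?c / _ * _ * _)%C => replace (c / RtoC (2 * PI) * RtoC x ^ k * RtoC (2 * PI))%C with (RtoC x ^ k * c)%C by (field; exact H2P) end.
        apply is_CInt_scal, CInt_correct_everywhere. intros t.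
        apply Ccont_curve_div; [apply Cpow_nz, circle_point_neq_0; lra|apply (Ccont_curve_circle f r Hf ltac:(lra))|].
        apply (Ccont_curve_pow (fun t => RtoC r * cis t)%C), Ccont_curve_circle_point. }
    intros n. apply is_CInt_unique. induction n.
    - unfold psum. rewrite sum_0_C. eapply is_CInt_ext; [|apply T]. intros t _. cbv beta. rewrite sum_0_C. reflexivity.
    - replace (psum (S n) x * RtoC (2 * PI))%C with (psum n x * RtoC (2 * PI) + a (S n) * RtoC x ^ (S n) * RtoC (2 * PI))%C.
      2:{ unfold psum. rewrite sum_Sn_C. Cring. }
      eapply is_CInt_ext; [|apply (is_CInt_plus _ _ _ _ _ _ IHn (T (S n)))]. intros t _. cbv beta.
      rewrite sum_Sn_C. Cring. }
  rewrite E, Cmod_div by (apply RtoC_neq_0; lra).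
  rewrite Cmod_R, (Rabs_pos_eq (2 * PI)) by lra. apply Rle_div_l; [lra|].
  assert (He := exp_pos 5).
  set (B := 16 * M * Rpower (d / 2) (- al) * (1 + exp 5)).
  assert (HB : 0 <= B).
  { unfold B. apply Rmult_le_pos; [apply Rmult_le_pos; [lra|left; apply Rpower_pos]|lra]. }
  eapply Rle_trans.
  - apply (Cmod_CInt_kernel_le g B d); [lra|exact HB|exact Hg|].
    intros t Ht. unfold g.
    destruct (inv_bound r x t Hr ltac:(lra) Ht) as [I1 I2].
    { rewrite Rabs_minus_sym, Rabs_pos_eq; unfold r; lra. }
    rewrite geom_sum by exact I1. rewrite Cmod_mult, Cmod_div by exact I1.
    replace (B / (d + Rabs t)) with ((M * Rpower (d / 2) (- al)) * ((1 + exp 5) * (16 / (d + Rabs t)))).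
    2:{ unfold B. field. generalize (Rabs_pos t). lra. }
    apply Rmult_le_compat; [apply Cmod_ge_0| | |].
    + apply Rdiv_le_0_compat; [apply Cmod_ge_0|apply Cmod_gt_0, I1].
    + eapply Rle_trans; [apply circ_f; lra|]. apply Rmult_le_compat_l; [exact HM|].
      apply Rpower_base_le_neg; [lra|unfold r; lra].
    + unfold Rdiv at 1. apply Rmult_le_compat; [apply Cmod_ge_0|left; apply Rinv_0_lt_compat, Cmod_gt_0, I1| |exact I2].
      eapply Rle_trans; [apply Cmod_minus_le|]. rewrite Cmod_1, Cmod_pow. apply Rplus_le_compat_l.
      eapply Rle_trans; [|exact Hpw]. rewrite Cmod_div by (apply circle_point_neq_0; lra).
      rewrite Cmod_circle_point, Cmod_R, Rabs_pos_eq by lra.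
      apply pow_incr. split; [apply Rdiv_le_0_compat; lra|].
      unfold Rdiv. rewrite <- (Rmult_1_l (/ r)) at 2. apply Rmult_le_compat_r; [left; apply Rinv_0_lt_compat; lra|lra].
  - replace (2 * B * ln (5 / d)) with (Q * (1 + exp 5) * 2) by (unfold Q, B; ring).
    apply Rmult_le_compat_l; [apply Rmult_le_pos; lra|lra].
Qed.

(** The interval [1 - d, 1] has length d and contributes at most Q (1 + exp 5) d. On [0, 1 - d] the
    integral of (x / (1 - d))^(N+1) is (1 - d) / (N + 2) <= d, which contributes Q d. *)
Lemma hilbert_partial_sum (n : nat) :
  Cmod (sum_n (fun k => (a k / RtoC (INR (n + k + 1)))%C) N
     - CInt (fun x => RtoC x ^ n * f (RtoC x))%C 0 (1 - / INR N))
  <= (2 + exp 5) * (16 * M * Rpower (/ INR N / 2) (- al) * ln (5 / / INR N)) * / INR N.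
Proof.
  fold d. fold Q.
  assert (Cp : forall x, Ccont_curve (fun x => RtoC x ^ n * psum N x)%C x).
  { intros x. apply Ccont_curve_mult; [apply (Ccont_curve_pow RtoC), Ccont_curve_RtoC|].
    apply (Ccont_curve_sum_n (fun k x => a k * RtoC x ^ k)%C). intros k.
    apply Ccont_curve_mult; [apply Ccont_curve_const|apply (Ccont_curve_pow RtoC), Ccont_curve_RtoC]. }
  assert (Cf : forall x, 0 <= x <= 1 - d -> Ccont_curve (fun x => RtoC x ^ n * f (RtoC x))%C x).
  { intros x Hx. apply Ccont_curve_mult; [apply (Ccont_curve_pow RtoC), Ccont_curve_RtoC|apply cf; lra]. }
  assert (E : sum_n (fun k => (a k / RtoC (INR (n + k + 1)))%C) N = CInt (fun x => RtoC x ^ n * psum N x)%C 0 1).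
  { symmetry. apply is_CInt_unique.
    rewrite (sum_n_ext _ (fun k => (a k / RtoC (INR (n + k + 1)) * RtoC 1 ^ (n + k + 1))%C)).
    - apply is_CInt_poly.
    - intros k. rewrite Cpow_1_l. Cring. }
  rewrite E, <- (CInt_Chasles _ 0 (1 - d) 1) by (try lra; intros; apply Cp).
  set (I1 := CInt _ 0 (1 - d)). set (I2 := CInt _ (1 - d) 1). set (I3 := CInt _ 0 (1 - d)).
  assert (X1 : forall x, 0 <= x <= 1 -> Cmod (RtoC x ^ n) <= 1).
  { intros x Hx. rewrite Cmod_pow, Cmod_R, Rabs_pos_eq by lra. rewrite <- (pow1 n). apply pow_incr. lra. }
  replace (I1 + I2 - I3)%C with (I2 - (I3 - I1))%C by ring.
  eapply Rle_trans; [apply Cmod_minus_le|].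
  assert (B2 : Cmod I2 <= Q * (1 + exp 5) * d).
  { apply Rle_trans with (Q * (1 + exp 5) * (1 - (1 - d))); [|right; ring].
    apply (Cmod_CInt_le_const (fun x => RtoC x ^ n * psum N x)%C); [lra|apply CInt_correct_everywhere, Cp|].
    intros x Hx. rewrite Cmod_mult. rewrite <- (Rmult_1_l (Q * (1 + exp 5))).
    apply Rmult_le_compat; [apply Cmod_ge_0|apply Cmod_ge_0|apply X1; lra|apply psum_bound; lra]. }
  assert (B1 : Cmod (I3 - I1) <= Q * d).
  { assert (HI : is_CInt (fun x => RtoC x ^ n * f (RtoC x) - RtoC x ^ n * psum N x)%C 0 (1 - d) (I3 - I1)).
    { apply is_CInt_minus; [|apply CInt_correct_everywhere, Cp].
      apply CInt_correct_le; [lra|]. exact Cf. }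
    eapply Rle_trans.
    - apply (Cmod_CInt_le (fun x => RtoC x ^ n * f (RtoC x) - RtoC x ^ n * psum N x)%C (fun x => Q * (x / (1 - d)) ^ S N) 0 (1 - d)); [lra|exact HI| |].
      + apply (is_RInt_scal (V := R_NormedModule) (fun x => (x / (1 - d)) ^ S N) 0 (1 - d) Q ((1 - d) / INR (S (S N)))).
        evar_last.
        * apply (is_RInt_derive (V := R_CompleteNormedModule) (fun x => (1 - d) / INR (S (S N)) * (x / (1 - d)) ^ S (S N))).
          { intros x _. auto_derive; [exact I|].
            assert (INR (S (S N)) <> 0) by (apply not_0_INR; lia).
            replace (match N with 0%nat => 1 | S _ => INR N + 1 end + 1) with (INR (S (S N))) by (rewrite !S_INR; destruct N; simpl; ring).
            change (x * / (1 - d)) with (x / (1 - d)).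
            simpl pow. field. split; [lra|exact H]. }
          { intros x _. apply (ex_derive_continuous (V := R_NormedModule)). auto_derive. exact I. }
        * unfold minus, plus, opp; cbn -[INR pow Rdiv].
          replace (0 / (1 - d)) with 0 by (field; lra). rewrite pow_i by lia.
          replace ((1 - d) / (1 - d)) with 1 by (field; lra). rewrite pow1. ring.
      + intros x Hx. replace (RtoC x ^ n * f (RtoC x) - RtoC x ^ n * psum N x)%C with (RtoC x ^ n * (f (RtoC x) - psum N x))%C by ring.
        rewrite Cmod_mult. rewrite <- (Rmult_1_l (Q * _)).
        apply Rmult_le_compat; [apply Cmod_ge_0|apply Cmod_ge_0|apply X1; lra|apply remainder_bound; lra].
    - unfold scal; cbn -[INR Rdiv]; unfold mult; cbn -[INR Rdiv]. apply Rmult_le_compat_l; [exact HQ|].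
      assert (INR N <= INR (S (S N))) by (apply le_INR; lia).
      assert (0 < INR N) by (apply lt_0_INR; lia).
      unfold Rdiv. rewrite <- (Rmult_1_l d) at 2. apply Rmult_le_compat; [lra|left; apply Rinv_0_lt_compat; lra|lra|].
      unfold d. apply Rinv_le_contravar; lra. }
  lra.
Qed.

End Step.

(** The error is of order N^(al - 1) ln N. Half of the available decay, N^((1 - al) / 2), absorbs
    the logarithm and the other half tends to 0. *)
Lemma hilbert_error_small (eps : R) : 0 < eps -> exists N0, forall N, (N0 <= N)%nat -> (4 <= N)%nat ->
  (2 + exp 5) * (16 * M * Rpower (/ INR N / 2) (- al) * ln (5 / / INR N)) * / INR N <= eps.
Proof.
  intros Heps. set (s := (1 - al) / 2). assert (Hs : 0 < s) by (unfold s; lra).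
  set (K := (2 + exp 5) * 16 * M * 2 * Rpower (5 / 2) s / s).
  assert (He := exp_pos 5). assert (Hp := Rpower_pos (5 / 2) s).
  assert (HK : 0 <= K).
  { unfold K. apply Rdiv_le_0_compat; [|exact Hs]. repeat apply Rmult_le_pos; lra. }
  destruct (Rpower_small s (eps / (K + 1)) Hs) as [y0 [Hy0 Hy]]; [apply Rdiv_lt_0_compat; lra|].
  destruct (archimed_cor1 y0 Hy0) as [N0 [HN0 HN0']].
  exists N0. intros N HN H4.
  assert (HNpos : 0 < INR N) by (apply lt_0_INR; lia).
  set (y := / INR N / 2).
  assert (Hyp : 0 < / INR N) by (apply Rinv_0_lt_compat, HNpos).
  assert (Hy1 : 0 < y) by (unfold y; lra).
  assert (Hy2 : y <= y0).
  { unfold y. assert (/ INR N <= / INR N0) by (apply Rinv_le_contravar; [apply lt_0_INR; lia|apply le_INR; lia]). lra. }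
  specialize (Hy y (conj Hy1 Hy2)).
  assert (L : ln (5 / / INR N) <= Rpower (5 / 2) s * Rpower y (- s) / s).
  { eapply Rle_trans; [apply (ln_le_Rpower _ s Hs)|].
    right. f_equal. rewrite <- Rpower_inv_base by exact Hy1.
    rewrite Rpower_mult_distr; [|lra|apply Rinv_0_lt_compat, Hy1]. f_equal. unfold y. field. lra. }
  fold y. assert (Ey : / INR N = 2 * y) by (unfold y; field; lra). clearbody y. rewrite Ey in L |- *.
  assert (P1 := Rpower_pos y (- al)).
  apply Rle_trans with ((2 + exp 5) * (16 * M * Rpower y (- al) * (Rpower (5 / 2) s * Rpower y (- s) / s)) * (2 * y)).
  { apply Rmult_le_compat_r; [lra|]. apply Rmult_le_compat_l; [lra|]. apply Rmult_le_compat_l; [|exact L].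
    apply Rmult_le_pos; lra. }
  replace ((2 + exp 5) * (16 * M * Rpower y (- al) * (Rpower (5 / 2) s * Rpower y (- s) / s)) * (2 * y))
    with (K * (Rpower y (- al) * Rpower y (- s) * Rpower y 1)) by (rewrite (Rpower_1 y) by exact Hy1; unfold K; field; lra).
  rewrite <- !Rpower_plus. replace (- al + - s + 1) with s by (unfold s; field).
  apply Rle_trans with ((K + 1) * (eps / (K + 1))); [|right; field; lra].
  apply Rmult_le_compat; [lra|left; apply Rpower_pos|lra|exact Hy].
Qed.

(** The value b n is the moment of x^n f over [0, 1). The first property feeds the integral
    representation of H f, the second ties the moments to the series in the definition of the
    operator. *)
Lemma hilbert_coeff_exists : exists b : nat -> C,
  (forall n t, 0 <= t < 1 -> Cmod (CInt (fun x => RtoC x ^ n * f (RtoC x))%C 0 t - b n) <= M / (1 - al) * Rpower (1 - t) (1 - al)) /\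
  (forall n, is_series (fun k => Cdiv (a k) (RtoC (INR (n + k + 1)))) (b n)).
Proof.
  assert (H : forall n, exists L, forall t, 0 <= t < 1 ->
    Cmod (CInt (fun x => RtoC x ^ n * f (RtoC x))%C 0 t - L) <= M / (1 - al) * Rpower (1 - t) (1 - al)).
  { intros n. apply CInt_improper; [exact Hal|exact HM| |].
    - intros x Hx. apply Ccont_curve_mult; [apply (Ccont_curve_pow RtoC), Ccont_curve_RtoC|apply cf; lra].
    - intros x Hx. rewrite Cmod_mult, <- (Rmult_1_l (M * _)).
      apply Rmult_le_compat; [apply Cmod_ge_0|apply Cmod_ge_0| |apply growth_real, Hx].
      rewrite Cmod_pow, Cmod_R, Rabs_pos_eq by lra. rewrite <- (pow1 n). apply pow_incr. lra. }
  exists (fun n => proj1_sig (constructive_indefinite_description _ (H n))).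
  assert (Hb := fun n => proj2_sig (constructive_indefinite_description _ (H n))). cbv beta in Hb.
  set (b := fun n => proj1_sig (constructive_indefinite_description _ (H n))) in *.
  split; [exact Hb|]. intros n. apply is_series_C. intros eps Heps.
  destruct (hilbert_error_small (eps / 3)) as [N1 H1]; [lra|].
  assert (HK : 0 <= M / (1 - al)) by (apply Rdiv_le_0_compat; lra).
  destruct (Rpower_small (1 - al) (eps / 3 / (M / (1 - al) + 1))) as [d [Hd Hd']]; [lra|apply Rdiv_lt_0_compat; lra|].
  destruct (archimed_cor1 d Hd) as [N2 [HN2 HN2']].
  exists (4 + N1 + N2)%nat. intros N HN.
  assert (HN4 : 4 <= INR N) by (replace 4 with (INR 4) by (simpl; ring); apply le_INR; lia).
  assert (HNd : 0 < / INR N <= 1 / 4).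
  { split; [apply Rinv_0_lt_compat; lra|]. replace (1 / 4) with (/ 4) by lra. apply Rinv_le_contravar; lra. }
  assert (HNd2 : / INR N <= d).
  { left. eapply Rle_lt_trans; [|exact HN2]. apply Rinv_le_contravar; [apply lt_0_INR; lia|apply le_INR; lia]. }
  assert (E1 := hilbert_partial_sum N ltac:(lia) n).
  specialize (H1 N ltac:(lia) ltac:(lia)).
  assert (E2 := Hb n (1 - / INR N) ltac:(lra)).
  replace (1 - (1 - / INR N)) with (/ INR N) in E2 by ring.
  specialize (Hd' (/ INR N) ltac:(lra)).
  assert (E3 : M / (1 - al) * Rpower (/ INR N) (1 - al) <= eps / 3).
  { apply Rle_trans with ((M / (1 - al) + 1) * (eps / 3 / (M / (1 - al) + 1))); [|right; field; lra].
    apply Rmult_le_compat; [exact HK|left; apply Rpower_pos|lra|exact Hd']. }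
  set (I0 := CInt _ 0 (1 - / INR N)) in *.
  set (s := sum_n _ N) in *. fold (b n) in E2.
  change (Cmod (s - b n) < eps).
  replace (s - b n)%C with ((s - I0) + (I0 - b n))%C by ring.
  eapply Rle_lt_trans; [apply Cmod_triangle|]. lra.
Qed.

End Growth.

(** * The operator as an integral over a path *)

Lemma geom_sum_n_le (x : R) (N : nat) : 0 <= x < 1 -> sum_n (fun k => x ^ k) N <= / (1 - x).
Proof.
  intros Hx. apply Rmult_le_reg_r with (1 - x); [lra|]. rewrite Rinv_l by lra.
  assert (E : sum_n (fun k => x ^ k) N * (1 - x) = 1 - x ^ S N).
  { induction N.
    - rewrite sum_O. simpl. ring.
    - rewrite sum_Sn. change ((sum_n (fun k => x ^ k) N + x ^ S N) * (1 - x) = 1 - x ^ S (S N)).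
      rewrite Rmult_plus_distr_r, IHN. simpl. ring. }
  rewrite E. assert (0 <= x ^ S N) by (apply pow_le; lra). lra.
Qed.

Lemma Cmod_one_minus_ge (w : C) : 1 - Cmod w <= Cmod (1 - w).
Proof. generalize (Cmod_triangle_minus 1 w). rewrite Cmod_1. lra. Qed.

Lemma one_minus_neq_0 (w : C) : Cmod w < 1 -> (1 - w)%C <> 0%C.
Proof. intros H. apply Cmod_gt_0. generalize (Cmod_one_minus_ge w). lra. Qed.

Definition moebius_path (z : C) (t : R) : C := (RtoC t / (1 - (1 - RtoC t) * z))%C.

Lemma moebius_den (z : C) (t : R) : 0 <= t <= 1 -> 1 - (1 - t) * Cmod z <= Cmod (1 - (1 - RtoC t) * z).
Proof.
  intros Ht. eapply Rle_trans; [|apply Cmod_one_minus_ge].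
  rewrite Cmod_mult, <- RtoC_minus, Cmod_R, Rabs_pos_eq by lra. lra.
Qed.

Lemma moebius_path_bound (z : C) (t : R) : Cmod z < 1 -> 0 <= t < 1 ->
  Cmod (moebius_path z t) <= t / (1 - (1 - t) * Cmod z).
Proof.
  intros Hz Ht. assert (Hz0 := Cmod_ge_0 z). assert (D := moebius_den z t ltac:(lra)).
  assert (P : 0 < 1 - (1 - t) * Cmod z) by nra.
  unfold moebius_path. rewrite Cmod_div by (apply Cmod_gt_0; lra).
  rewrite Cmod_R, Rabs_pos_eq by lra. unfold Rdiv. apply Rmult_le_compat_l; [lra|].
  apply Rinv_le_contravar; lra.
Qed.

Section Growth.
Variables (f : C -> C) (a : nat -> C) (al M : R).
Hypothesis Hal : 0 < al < 1.
Hypothesis HM : 0 <= M.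
Hypothesis Hf : holomorphic f.
Hypothesis Ha : expansion_on_disk a f.
Hypothesis Hgrowth : forall z, Cmod z < 1 -> Cmod (f z) <= M * Rpower (1 - Cmod z) (- al).

Section Moments.
Variable b : nat -> C.
Hypothesis Hb : forall n t, 0 <= t < 1 ->
  Cmod (CInt (fun x => RtoC x ^ n * f (RtoC x))%C 0 t - b n) <= M / (1 - al) * Rpower (1 - t) (1 - al).

Let K := M / (1 - al).
Let HK : 0 <= K.
Proof. apply Rdiv_le_0_compat; lra. Qed.

(** The case t = 0 of the rate, where the truncated integral is empty. *)
Lemma moment_limit_le (n : nat) : Cmod (b n) <= K.
Proof.
  assert (H := Hb n 0 ltac:(lra)).
  rewrite (is_CInt_unique _ 0 0 0) in H.
  - replace (0 - b n)%C with (- b n)%C in H by ring. rewrite Cmod_opp, Rminus_0_r in H.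
    replace (Rpower 1 (1 - al)) with 1 in H; [fold K in H; lra|].
    unfold Rpower. rewrite ln_1, Rmult_0_r, exp_0. reflexivity.
  - split; apply (is_RInt_point (V := R_NormedModule)).
Qed.

Let cf (x : R) : 0 <= x < 1 -> Ccont_curve (fun x => f (RtoC x)) x.
Proof.
  intros Hx. apply (Ccont_curve_comp f RtoC); [|apply Ccont_curve_RtoC].
  destruct (Hf (RtoC x)) as [l Hl]; [rewrite Cmod_R, Rabs_pos_eq; lra|]. exact (Cderiv_Ccont _ _ _ Hl).
Qed.

Section AtPoint.
Variable z : C.
Hypothesis Hz : Cmod z < 1.

Let Hxz (x : R) : 0 <= x <= 1 -> Cmod (RtoC x * z) <= Cmod z.
Proof.
  intros Hx. rewrite Cmod_mult, Cmod_R, Rabs_pos_eq by lra.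
  assert (0 <= Cmod z) by apply Cmod_ge_0. rewrite <- (Rmult_1_l (Cmod z)) at 2. apply Rmult_le_compat_r; lra.
Qed.

Let Ccont_curve_xz (x : R) : Ccont_curve (fun x => RtoC x * z)%C x.
Proof. apply Ccont_curve_mult; [apply Ccont_curve_RtoC|apply Ccont_curve_const]. Qed.

(** Expands 1 / (1 - x z) into a finite geometric sum; the last term carries (x z)^(N+1), and (1 -
    x)^(-al) is integrated from 0. *)
Let cauchy_transform_partial (t : R) (N : nat) : 0 <= t < 1 ->
  Cmod (CInt (fun x => f (RtoC x) / (1 - RtoC x * z))%C 0 t
        - sum_n (fun n => (CInt (fun x => RtoC x ^ n * f (RtoC x)) 0 t * z ^ n)%C) N)
   <= K / (1 - Cmod z) * Cmod z ^ S N.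
Proof.
  intros Ht. assert (Hz0 := Cmod_ge_0 z).
  assert (Cg : forall k x, 0 <= x < 1 -> Ccont_curve (fun x => f (RtoC x) * (RtoC x * z) ^ k / (1 - RtoC x * z))%C x).
  { intros k x Hx. apply (Ccont_curve_div (fun x => f (RtoC x) * (RtoC x * z) ^ k)%C (fun x => 1 - RtoC x * z)%C).
    - apply one_minus_neq_0. eapply Rle_lt_trans; [apply Hxz; lra|exact Hz].
    - apply Ccont_curve_mult; [apply cf, Hx|]. apply (Ccont_curve_pow (fun x => RtoC x * z)%C), Ccont_curve_xz.
    - apply Ccont_curve_minus; [apply Ccont_curve_const|apply Ccont_curve_xz]. }
  assert (E : forall n, is_CInt (fun x => f (RtoC x) / (1 - RtoC x * z))%C 0 t
     (sum_n (fun n => (CInt (fun x => RtoC x ^ n * f (RtoC x)) 0 t * z ^ n)%C) n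
       + CInt (fun x => f (RtoC x) * (RtoC x * z) ^ S n / (1 - RtoC x * z))%C 0 t)).
  { assert (Mo : forall k, is_CInt (fun x => z ^ k * (RtoC x ^ k * f (RtoC x)))%C 0 t (z ^ k * CInt (fun x => RtoC x ^ k * f (RtoC x))%C 0 t)).
    { intros k. apply is_CInt_scal, CInt_correct_le; [lra|]. intros x Hx.
      apply Ccont_curve_mult; [apply (Ccont_curve_pow RtoC), Ccont_curve_RtoC|apply cf; lra]. }
    assert (Re : forall k, is_CInt (fun x => f (RtoC x) * (RtoC x * z) ^ k / (1 - RtoC x * z))%C 0 t
       (CInt (fun x => f (RtoC x) * (RtoC x * z) ^ k / (1 - RtoC x * z))%C 0 t)).
    { intros k. apply CInt_correct_le; [lra|]. intros x Hx. apply Cg. lra. }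
    assert (St : forall k, CInt (fun x => f (RtoC x) * (RtoC x * z) ^ k / (1 - RtoC x * z))%C 0 t
      = (z ^ k * CInt (fun x => RtoC x ^ k * f (RtoC x)) 0 t + CInt (fun x => f (RtoC x) * (RtoC x * z) ^ S k / (1 - RtoC x * z)) 0 t)%C).
    { intros k. apply is_CInt_unique.
      eapply is_CInt_ext; [|apply (is_CInt_plus _ _ _ _ _ _ (Mo k) (Re (S k)))].
      intros x. rewrite Rmin_left, Rmax_right by lra. intros Hx. cbv beta.
      rewrite Cpow_S, !Cpow_mult_l. field. apply one_minus_neq_0. eapply Rle_lt_trans; [apply Hxz; lra|exact Hz]. }
    assert (E0 : is_CInt (fun x => f (RtoC x) / (1 - RtoC x * z))%C 0 t (CInt (fun x => f (RtoC x) * (RtoC x * z) ^ 0 / (1 - RtoC x * z))%C 0 t)).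
    { eapply is_CInt_ext; [|apply (Re 0%nat)]. intros x _. simpl. rewrite Cmult_1_r. reflexivity. }
    intros n.
    replace (sum_n (fun n => (CInt (fun x => RtoC x ^ n * f (RtoC x)) 0 t * z ^ n)%C) n
       + CInt (fun x => f (RtoC x) * (RtoC x * z) ^ S n / (1 - RtoC x * z)) 0 t)%C
      with (CInt (fun x => f (RtoC x) * (RtoC x * z) ^ 0 / (1 - RtoC x * z))%C 0 t); [exact E0|].
    induction n.
    - rewrite sum_0_C, (St 0%nat). Cring.
    - rewrite sum_Sn_C, IHn, (St (S n)). Cring. }
  rewrite (is_CInt_unique _ _ _ _ (E N)). set (s := sum_n _ N). set (J := CInt _ 0 t).
  replace (s + J - s)%C with J by ring.
  set (B := M * (/ (1 - Cmod z) * Cmod z ^ S N)).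
  assert (HB : 0 <= B).
  { apply Rmult_le_pos; [exact HM|]. apply Rmult_le_pos; [left; apply Rinv_0_lt_compat; lra|apply pow_le, Hz0]. }
  apply Rle_trans with (B / (1 - al) * Rpower (1 - 0) (1 - al)).
  - apply CInt_tail_bound; [exact Hal|exact HB|lra| |].
    + intros x Hx. apply Cg. lra.
    + intros x Hx. assert (X := Hxz x ltac:(lra)).
      rewrite Cmod_div by (apply one_minus_neq_0; lra). rewrite Cmod_mult, Cmod_pow.
      replace (B * Rpower (1 - x) (- al)) with ((M * Rpower (1 - x) (- al)) * Cmod z ^ S N * / (1 - Cmod z)) by (unfold B; ring).
      unfold Rdiv. apply Rmult_le_compat.
      * apply Rmult_le_pos; [apply Cmod_ge_0|apply pow_le, Cmod_ge_0].
      * left. apply Rinv_0_lt_compat, Cmod_gt_0, one_minus_neq_0. lra.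
      * apply Rmult_le_compat; [apply Cmod_ge_0|apply pow_le, Cmod_ge_0| |apply pow_incr; split; [apply Cmod_ge_0|exact X]].
        assert (G := Hgrowth (RtoC x)). rewrite Cmod_R, (Rabs_pos_eq x) in G by lra. apply G; lra.
      * apply Rinv_le_contravar; [lra|]. generalize (Cmod_one_minus_ge (RtoC x * z)). lra.
  - rewrite Rminus_0_r. replace (Rpower 1 (1 - al)) with 1 by (unfold Rpower; rewrite ln_1, Rmult_0_r, exp_0; reflexivity).
    right. unfold B, K. field. lra.
Qed.

(** The rate in [Hb] does not depend on n, so summing it against |z|^n costs only 1 / (1 - |z|).
    With t fixed, N tends to infinity in both expansions, which exchanges series and integral. *)
Lemma cauchy_transform_limit (gz : C) (t : R) :
  is_pseries b z gz -> 0 <= t < 1 ->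
  Cmod (CInt (fun x => f (RtoC x) / (1 - RtoC x * z))%C 0 t - gz) <= K / (1 - Cmod z) * Rpower (1 - t) (1 - al).
Proof.
  intros Hg Ht. assert (Hz0 := Cmod_ge_0 z).
  apply le_epsilon. intros eps Heps.
  rewrite is_pseries_C in Hg. destruct (Hg (eps / 2)) as [N1 HN1]; [lra|].
  destruct (pow_small (Cmod z) (K / (1 - Cmod z)) (eps / 2)) as [N2 HN2]; [lra|apply Rdiv_le_0_compat; lra|lra|].
  set (N := (N1 + N2)%nat).
  specialize (HN1 N ltac:(unfold N; lia)). specialize (HN2 (S N) ltac:(unfold N; lia)).
  assert (P := cauchy_transform_partial t N Ht).
  set (J := CInt _ 0 t) in *. set (s := sum_n _ N) in P. set (sb := sum_n _ N) in HN1.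
  assert (D : Cmod (s - sb) <= K / (1 - Cmod z) * Rpower (1 - t) (1 - al)).
  { assert (Es : (s - sb)%C = sum_n (fun n => ((CInt (fun x => RtoC x ^ n * f (RtoC x)) 0 t - b n) * z ^ n)%C) N).
    { unfold s, sb. clear. induction N.
      - rewrite !sum_0_C. Cring.
      - rewrite !sum_Sn_C, <- IHN. Cring. }
    rewrite Es. eapply Rle_trans; [apply (Cmod_sum_n_le _ (fun n => K * Rpower (1 - t) (1 - al) * Cmod z ^ n))|].
    - intros n. rewrite Cmod_mult, Cmod_pow. apply Rmult_le_compat_r; [apply pow_le, Hz0|apply Hb, Ht].
    - rewrite (sum_n_mult_l (K := R_Ring)).
      change (K * Rpower (1 - t) (1 - al) * sum_n (fun n => Cmod z ^ n) N <= K / (1 - Cmod z) * Rpower (1 - t) (1 - al)).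
      replace (K / (1 - Cmod z) * Rpower (1 - t) (1 - al)) with (K * Rpower (1 - t) (1 - al) * / (1 - Cmod z)) by (field; lra).
      apply Rmult_le_compat_l; [apply Rmult_le_pos; [exact HK|left; apply Rpower_pos]|].
      apply geom_sum_n_le. lra. }
  replace (J - gz)%C with ((J - s) + ((s - sb) + (sb - gz)))%C by ring.
  eapply Rle_trans; [apply Cmod_triangle|].
  eapply Rle_trans; [apply Rplus_le_compat_l, Cmod_triangle|]. lra.
Qed.

(** The integrand h = f (w) / (1 - w z) has a primitive G on the disk, so both truncated integrals
    are differences of values of G and share the starting point 0. Their end points are joined by a
    curve of length O(1 - T) that keeps distance (1 - T) (1 - r) from the unit circle; there h is
    O((1 - T)^(-al)), and the product has the required rate. *)
Lemma path_change (gz : C) :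
  is_pseries b z gz ->
  exists L, 0 <= L /\ forall t, 0 <= t < 1 ->
    Cmod (CInt (fun t => f (moebius_path z t) / (1 - (1 - RtoC t) * z))%C 0 t - gz) <= L * Rpower (1 - t) (1 - al).
Proof.
  intros Hg. assert (Hz0 := Cmod_ge_0 z). set (r := Cmod z) in *.
  set (h := fun w => (f w / (1 - w * z))%C).
  assert (Hwz : forall w, Cmod w < 1 -> Cmod (w * z) <= r).
  { intros w Hw. rewrite Cmod_mult. fold r. rewrite <- (Rmult_1_l r) at 2. apply Rmult_le_compat_r; lra. }
  assert (Hh : holomorphic h).
  { intros w Hw. destruct (Hf w Hw) as [l Hl]. eexists.
    apply (Cderiv_div f (fun w => 1 - w * z)%C).
    - apply one_minus_neq_0. eapply Rle_lt_trans; [apply Hwz, Hw|exact Hz].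
    - exact Hl.
    - apply Cderiv_minus; [apply Cderiv_const|]. apply (Cderiv_mult (fun w => w) (fun _ => z)); [apply Cderiv_id|apply Cderiv_const]. }
  destruct (holomorphic_primitive h Hh) as [G HG].
  assert (Hhc : forall (p : R -> C) t, Cmod (p t) < 1 -> Ccont_curve p t -> Ccont_curve (fun t => h (p t)) t).
  { intros p t Hp Hc. apply (Ccont_curve_comp h p); [|exact Hc]. destruct (Hh _ Hp) as [l Hl]. exact (Cderiv_Ccont _ _ _ Hl). }
  (* The first summand is the rate along the real segment, the second the bound for the joining
     curve. *)
  exists (K / (1 - r) + M * Rpower (1 - r) (- al) * / (1 - r) * / (1 - r) ^ 2).
  assert (Q1 : 0 < / (1 - r)) by (apply Rinv_0_lt_compat; lra).
  assert (Q2 : 0 < / (1 - r) ^ 2) by (apply Rinv_0_lt_compat, pow_lt; lra).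
  assert (Q3 := Rpower_pos (1 - r) (- al)).
  split.
  { apply Rplus_le_le_0_compat; [apply Rdiv_le_0_compat; lra|].
    apply Rmult_le_pos; [apply Rmult_le_pos; [apply Rmult_le_pos; lra|lra]|lra]. }
  intros T HT.
  assert (I1 : CInt (fun x => h (RtoC x)) 0 T = (G (RtoC T) - G (RtoC 0))%C).
  { apply is_CInt_unique. apply (is_CInt_FTC_le (fun x => G (RtoC x))); [lra| |]; intros x Hx.
    - apply is_curve_derive_Cderiv, HG. rewrite Cmod_R, Rabs_pos_eq; lra.
    - apply Hhc; [rewrite Cmod_R, Rabs_pos_eq; lra|apply Ccont_curve_RtoC]. }
  assert (Hden : forall t, 0 <= t <= 1 -> (1 - (1 - RtoC t) * z)%C <> 0%C).
  { intros t Ht. apply Cmod_gt_0. assert (D := moebius_den z t Ht). fold r in D. nra. }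
  assert (Hphi : forall t, 0 <= t < 1 -> Cmod (moebius_path z t) < 1).
  { intros t Ht. eapply Rle_lt_trans; [apply moebius_path_bound; [exact Hz|exact Ht]|]. fold r. apply Rlt_div_l; nra. }
  assert (Hphic : forall t, 0 <= t <= 1 -> Ccont_curve (fun t => 1 - (1 - RtoC t) * z)%C t).
  { intros t Ht. apply Ccont_curve_minus; [apply Ccont_curve_const|]. apply Ccont_curve_mult; [|apply Ccont_curve_const].
    apply Ccont_curve_minus; [apply Ccont_curve_const|apply Ccont_curve_RtoC]. }
  assert (I2 : CInt (fun t => f (moebius_path z t) / (1 - (1 - RtoC t) * z))%C 0 T = (G (moebius_path z T) - G (moebius_path z 0))%C).
  { apply is_CInt_unique. apply (is_CInt_FTC_le (fun x => G (moebius_path z x))); [lra| |]; intros x Hx.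
    - assert (Hd := Hden x ltac:(lra)). assert (Hp := Hphi x ltac:(lra)).
      (* The path has derivative (1 - z) / D^2 with D = 1 - (1 - x) z, and 1 - w z = (1 - z) / D on
         it, so h (w) dw reduces to f (w) / D dx. *)
      replace (f (moebius_path z x) / (1 - (1 - RtoC x) * z))%C
        with (h (moebius_path z x) * ((1 * (1 - (1 - RtoC x) * z) - RtoC x * (0 - ((0 - 1) * z + (1 - RtoC x) * 0)))
          / ((1 - (1 - RtoC x) * z) * (1 - (1 - RtoC x) * z))))%C.
      + apply (is_curve_derive_comp G (moebius_path z)); [apply HG, Hp|].
        apply (is_curve_derive_Cderiv (fun w => w / (1 - (1 - w) * z))%C).
        apply (Cderiv_div (fun w => w) (fun w => 1 - (1 - w) * z)%C); [exact Hd|apply Cderiv_id|].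
        apply Cderiv_minus; [apply Cderiv_const|].
        apply (Cderiv_mult (fun w => 1 - w)%C (fun _ => z)); [|apply Cderiv_const].
        apply Cderiv_minus; [apply Cderiv_const|apply Cderiv_id].
      + unfold h.
        assert (E : (1 - moebius_path z x * z = (1 - z) / (1 - (1 - RtoC x) * z))%C).
        { unfold moebius_path. field. exact Hd. }
        rewrite E. field. split; [exact Hd|]. apply (one_minus_neq_0 z Hz).
    - apply Ccont_curve_div; [apply Hden; lra| |apply Hphic; lra].
      apply (Ccont_curve_comp f (moebius_path z)).
      + destruct (Hf (moebius_path z x) (Hphi x ltac:(lra))) as [l Hl]. exact (Cderiv_Ccont _ _ _ Hl).
      + apply Ccont_curve_div; [apply Hden; lra|apply Ccont_curve_RtoC|apply Hphic; lra]. }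
  (* The segment from T to the end of the path is swept by s |-> moebius_path with z replaced by s z. *)
  set (p := fun s : R => (RtoC T / (1 - (1 - RtoC T) * (RtoC s * z)))%C).
  set (p' := fun s : R => (RtoC T * (1 - RtoC T) * z / ((1 - (1 - RtoC T) * (RtoC s * z)) * (1 - (1 - RtoC T) * (RtoC s * z))))%C).
  assert (Hpd : forall s, 0 <= s <= 1 -> 1 - (1 - T) * r <= Cmod (1 - (1 - RtoC T) * (RtoC s * z))).
  { intros s Hs. eapply Rle_trans; [|apply Cmod_one_minus_ge].
    rewrite !Cmod_mult, <- RtoC_minus, !Cmod_R, !Rabs_pos_eq by lra. fold r.
    assert ((1 - T) * (s * r) <= (1 - T) * (1 * r)) by (apply Rmult_le_compat_l; [lra|apply Rmult_le_compat_r; lra]). lra. }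
  assert (Hpos : 0 < 1 - (1 - T) * r) by nra.
  assert (Hp1 : forall s, 0 <= s <= 1 -> Cmod (p s) <= T / (1 - (1 - T) * r)).
  { intros s Hs. assert (D := Hpd s Hs). unfold p. rewrite Cmod_div by (apply Cmod_gt_0; lra).
    rewrite Cmod_R, Rabs_pos_eq by lra. unfold Rdiv. apply Rmult_le_compat_l; [lra|]. apply Rinv_le_contravar; lra. }
  (* After clearing the denominator the two sides differ by (1 - T)^2 r (1 - r). *)
  assert (Hp2 : T / (1 - (1 - T) * r) <= 1 - (1 - T) * (1 - r)).
  { apply Rle_div_l; [exact Hpos|].
    replace ((1 - (1 - T) * (1 - r)) * (1 - (1 - T) * r)) with (T + (1 - T) * (1 - T) * (r * (1 - r))) by ring.
    assert (0 <= (1 - T) * (1 - T)) by (apply Rmult_le_pos; lra).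
    assert (0 <= r * (1 - r)) by (apply Rmult_le_pos; lra).
    assert (0 <= (1 - T) * (1 - T) * (r * (1 - r))) by (apply Rmult_le_pos; lra). lra. }
  assert (Hpc : forall s, Ccont_curve (fun s => 1 - (1 - RtoC T) * (RtoC s * z))%C s).
  { intros s. apply Ccont_curve_minus; [apply Ccont_curve_const|]. apply Ccont_curve_mult; [apply Ccont_curve_const|].
    apply Ccont_curve_mult; [apply Ccont_curve_RtoC|apply Ccont_curve_const]. }
  assert (H1T : 0 < (1 - T) * (1 - r)) by (apply Rmult_lt_0_compat; lra).
  assert (I3 : is_CInt (fun s => h (p s) * p' s)%C 0 1 (G (p 1) - G (p 0))%C).
  { apply (is_CInt_FTC_le (fun s => G (p s))); [lra| |]; intros s Hs.
    - assert (Hd : (1 - (1 - RtoC T) * (RtoC s * z))%C <> 0%C) by (apply Cmod_gt_0; generalize (Hpd s Hs); lra).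
      apply (is_curve_derive_comp G p); [apply HG; generalize (Hp1 s Hs); lra|].
      replace (p' s) with ((0 * (1 - (1 - RtoC T) * (RtoC s * z)) - RtoC T * (0 - (1 - RtoC T) * (1 * z + RtoC s * 0)))
         / ((1 - (1 - RtoC T) * (RtoC s * z)) * (1 - (1 - RtoC T) * (RtoC s * z))))%C.
      2:{ unfold p'. field. exact Hd. }
      apply (is_curve_derive_Cderiv (fun w => RtoC T / (1 - (1 - RtoC T) * (w * z)))%C).
      apply (Cderiv_div (fun _ => RtoC T) (fun w => 1 - (1 - RtoC T) * (w * z))%C); [exact Hd|apply Cderiv_const|].
      apply Cderiv_minus; [apply Cderiv_const|]. apply Cderiv_scal.
      apply (Cderiv_mult (fun w => w) (fun _ => z)); [apply Cderiv_id|apply Cderiv_const].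
    - assert (Hd : (1 - (1 - RtoC T) * (RtoC s * z))%C <> 0%C) by (apply Cmod_gt_0; generalize (Hpd s Hs); lra).
      apply Ccont_curve_mult.
      + apply Hhc; [generalize (Hp1 s Hs); lra|]. apply Ccont_curve_div; [exact Hd|apply Ccont_curve_const|apply Hpc].
      + apply Ccont_curve_div; [apply Cmult_neq_0; exact Hd|apply Ccont_curve_const|]. apply Ccont_curve_mult; apply Hpc. }
  assert (B3 : Cmod (G (p 1) - G (p 0)) <= M * Rpower (1 - r) (- al) * / (1 - r) * / (1 - r) ^ 2 * Rpower (1 - T) (1 - al)).
  { eapply Rle_trans.
    - apply (Cmod_CInt_le_const (fun s => h (p s) * p' s)%C 0 1 (M * Rpower ((1 - T) * (1 - r)) (- al) * / (1 - r) * ((1 - T) * / (1 - r) ^ 2))); [lra|exact I3|].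
      intros s Hs. assert (Q := Hp1 s ltac:(lra)). assert (D := Hpd s ltac:(lra)). rewrite Cmod_mult.
      apply Rmult_le_compat; [apply Cmod_ge_0|apply Cmod_ge_0| |].
      + unfold h. rewrite Cmod_div.
        2:{ apply one_minus_neq_0. eapply Rle_lt_trans; [apply Hwz; lra|exact Hz]. }
        unfold Rdiv. apply Rmult_le_compat; [apply Cmod_ge_0| | |].
        * left. apply Rinv_0_lt_compat, Cmod_gt_0, one_minus_neq_0. eapply Rle_lt_trans; [apply Hwz; lra|exact Hz].
        * eapply Rle_trans; [apply Hgrowth; lra|]. apply Rmult_le_compat_l; [exact HM|].
          apply Rpower_base_le_neg; lra.
        * apply Rinv_le_contravar; [lra|]. generalize (Cmod_one_minus_ge (p s * z)), (Hwz (p s)). intros X Y. specialize (Y ltac:(lra)). lra.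
      + unfold p'. rewrite Cmod_div by (apply Cmult_neq_0; apply Cmod_gt_0; lra).
        rewrite !Cmod_mult, <- RtoC_minus, !Cmod_R, !(Rabs_pos_eq) by lra. fold r.
        set (m := Cmod _).
        assert (Hm : 1 - r <= m) by (unfold m; rewrite <- RtoC_minus in D; nra).
        unfold Rdiv. apply Rmult_le_compat.
        * apply Rmult_le_pos; [apply Rmult_le_pos; lra|exact Hz0].
        * left. apply Rinv_0_lt_compat. apply Rmult_lt_0_compat; lra.
        * assert (T * (1 - T) * r <= 1 * (1 - T) * 1).
          { apply Rmult_le_compat; [apply Rmult_le_pos; lra|lra|apply Rmult_le_compat_r; lra|lra]. }
          lra.
        * apply Rinv_le_contravar; [apply pow_lt; lra|]. simpl. rewrite Rmult_1_r. apply Rmult_le_compat; lra.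
    - right. rewrite <- Rpower_mult_distr by lra.
      replace (1 - al) with (- al + 1) by ring. rewrite Rpower_plus, Rpower_1 by lra. ring. }
  assert (E0 : moebius_path z 0 = RtoC 0).
  { unfold moebius_path. unfold Cdiv. ring. }
  assert (E1 : p 1 = moebius_path z T).
  { unfold p, moebius_path. f_equal. ring. }
  assert (E2 : p 0 = RtoC T).
  { unfold p. field. }
  rewrite E1, E2 in B3.
  assert (B1 := cauchy_transform_limit gz T Hg HT). fold r in B1.
  change (CInt (fun x => f (RtoC x) / (1 - RtoC x * z))%C 0 T) with (CInt (fun x => h (RtoC x)) 0 T) in B1.
  rewrite I1 in B1. rewrite I2, E0.
  replace (G (moebius_path z T) - G 0 - gz)%C with ((G (RtoC T) - G 0 - gz) + (G (moebius_path z T) - G (RtoC T)))%C by ring.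
  eapply Rle_trans; [apply Cmod_triangle|]. rewrite Rmult_plus_distr_r. apply Rplus_le_compat; assumption.
Qed.

End AtPoint.
End Moments.

(** Any admissible value g has the moments as coefficients, because a convergent series has only one
    sum. *)
Lemma hilbert_path (g : C -> C) (z : C) : Cmod z < 1 -> hilbert f g ->
  exists L, 0 <= L /\ forall t, 0 <= t < 1 ->
    Cmod (CInt (fun t => f (moebius_path z t) / (1 - (1 - RtoC t) * z))%C 0 t - g z) <= L * Rpower (1 - t) (1 - al).
Proof.
  intros Hz (a' & b' & Ha' & Hb' & Hg & _).
  destruct (hilbert_coeff_exists f a' al M Hal HM Hf Ha' Hgrowth) as [b [Hb1 Hb2]].
  apply (path_change b Hb1 z Hz).
  assert (E : forall n, b n = b' n).
  { intros n. apply Ceq_eps. intros eps Heps.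
    destruct (proj1 (is_series_C _ _) (Hb2 n) (eps / 2)) as [N1 H1]; [lra|].
    destruct (proj1 (is_series_C _ _) (Hb' n) (eps / 2)) as [N2 H2]; [lra|].
    specialize (H1 (N1 + N2)%nat ltac:(lia)). specialize (H2 (N1 + N2)%nat ltac:(lia)).
    set (s := sum_n _ _) in H1. change (sum_n _ _) with s in H2.
    replace (b n - b' n)%C with ((s - b' n) - (s - b n))%C by ring.
    eapply Rle_trans; [apply Cmod_minus_le|]. lra. }
  assert (Hgz := Hg z Hz). rewrite is_pseries_C in *. intros eps Heps. destruct (Hgz eps Heps) as [N HN].
  exists N. intros n Hn. rewrite (sum_n_ext _ (fun k => (b' k * z ^ k)%C)); [apply HN, Hn|].
  intros k. rewrite E. reflexivity.
Qed.

(** The moments are bounded in n, so their power series converges on the whole disk and is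
    differentiable there. *)
Lemma hilbert_exists : exists g, hilbert f g.
Proof.
  destruct (hilbert_coeff_exists f a al M Hal HM Hf Ha Hgrowth) as [b [Hb1 Hb2]].
  assert (Hrad : Rbar_le 1 (CV_radius (fun n => Cmod (b n)))).
  { destruct (CV_radius_bounded (fun n => Cmod (b n))) as [H _]. apply H.
    exists (M / (1 - al)). intros n. rewrite pow1, Rmult_1_r, Rabs_pos_eq by apply Cmod_ge_0.
    apply moment_limit_le, Hb1. }
  assert (Hex : forall z, exists l, Cmod z < 1 -> is_pseries b z l).
  { intros z. destruct (Rlt_dec (Cmod z) 1) as [L|L].
    - destruct (ex_pseries_abs b z) as [l Hl]; [apply Rbar_lt_le_trans with 1; [exact L|exact Hrad]|].
      exists l. intros _; exact Hl.
    - exists (RtoC 0). intros L'; contradiction. }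
  set (g := fun z => proj1_sig (constructive_indefinite_description _ (Hex z))).
  assert (Hg : expansion_on_disk b g).
  { intros z Hz. unfold g. destruct (constructive_indefinite_description _ (Hex z)) as [l Hl]. apply Hl, Hz. }
  exists g, a, b. split; [exact Ha|]. split; [exact Hb2|]. split; [exact Hg|].
  intros z Hz. destruct (pseries_derivable b g z Hg Hz) as [d [_ Hd]]. exists d. apply is_derive_Cderiv, Hd.
Qed.

End Growth.

(** * The weight and the radial integrand *)

(** For a nonnegative integrand the truncated integrals increase, so a common bound makes the
    improper integral their supremum. Continuity at 0 leaves 1 as the only improper end point. *)
Lemma RInt_gen_bounded (k : R -> R) (B : R) :
  (forall t, 0 <= t < 1 -> continuous k t) -> (forall t, 0 <= t < 1 -> 0 <= k t) ->
  (forall t, 0 <= t < 1 -> RInt k 0 t <= B) ->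
  is_RInt_gen k (at_point 0) (at_left 1) (RInt_gen k (at_point 0) (at_left 1)) /\
  (forall t, 0 <= t < 1 -> RInt k 0 t <= RInt_gen k (at_point 0) (at_left 1)) /\
  (forall eps, 0 < eps -> exists t0, 0 <= t0 < 1 /\
    forall t, t0 <= t < 1 -> RInt_gen k (at_point 0) (at_left 1) - eps <= RInt k 0 t) /\
  RInt_gen k (at_point 0) (at_left 1) <= B.
Proof.
  intros Hc Hpos HB.
  assert (Hex : forall s t, 0 <= s -> s <= t -> t < 1 -> ex_RInt k s t).
  { intros s t Hs Hst Ht. apply (ex_RInt_continuous (V := R_CompleteNormedModule)).
    intros x. rewrite Rmin_left, Rmax_right by lra. intros Hx. apply Hc. lra. }
  assert (Hmono : forall s t, 0 <= s -> s <= t -> t < 1 -> RInt k 0 s <= RInt k 0 t).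
  { intros s t Hs Hst Ht.
    assert (C := RInt_Chasles k 0 s t (Hex 0 s ltac:(lra) ltac:(lra) ltac:(lra)) (Hex s t Hs Hst Ht)).
    change (RInt k 0 s + RInt k s t = RInt k 0 t) in C.
    assert (0 <= RInt k s t). { apply RInt_ge_0; [exact Hst|apply Hex; assumption|]. intros; apply Hpos; lra. }
    lra. }
  destruct (completeness (fun y => exists t, 0 <= t < 1 /\ y = RInt k 0 t)) as [l [Hl1 Hl2]].
  - exists B. intros y [t [Ht ->]]. apply HB, Ht.
  - exists (RInt k 0 0), 0. split; [lra|reflexivity].
  - assert (Hle : forall t, 0 <= t < 1 -> RInt k 0 t <= l) by (intros t Ht; apply Hl1; exists t; split; [exact Ht|reflexivity]).
    assert (Hge : forall eps, 0 < eps -> exists t0, 0 <= t0 < 1 /\ forall t, t0 <= t < 1 -> l - eps <= RInt k 0 t).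
    { intros eps Heps.
      destruct (classic (exists t, 0 <= t < 1 /\ l - eps <= RInt k 0 t)) as [[t [Ht Hlt]]|Hno].
      - exists t. split; [exact Ht|]. intros s Hs. eapply Rle_trans; [exact Hlt|]. apply Hmono; lra.
      - exfalso. assert (l <= l - eps); [|lra]. apply Hl2. intros y [t [Ht ->]].
        destruct (Rle_dec (RInt k 0 t) (l - eps)) as [H|H]; [exact H|].
        exfalso. apply Hno. exists t. split; [exact Ht|lra]. }
    assert (Hgen : is_RInt_gen k (at_point 0) (at_left 1) l).
    { intros P [[e He] HP]. destruct (Hge (e / 2)) as [t0 [Ht0 Hge0]]; [lra|].
      apply (Filter_prod _ _ _ (fun x => x = 0) (fun y => t0 < y < 1)).
      - reflexivity.
      - exists (mkposreal (1 - t0) ltac:(lra)). intros y Hy Hy1.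
        unfold ball in Hy; simpl in Hy. unfold AbsRing_ball, abs, minus, plus, opp in Hy; simpl in Hy.
        apply Rabs_def2 in Hy. lra.
      - intros x y -> Hy. exists (RInt k 0 y). split.
        + apply (RInt_correct (V := R_CompleteNormedModule)), Hex; lra.
        + apply HP. unfold ball; simpl. unfold AbsRing_ball, abs, minus, plus, opp; simpl.
          assert (A1 := Hle y ltac:(lra)). assert (A2 := Hge0 y ltac:(lra)). apply Rabs_def1; lra. }
    assert (El : RInt_gen k (at_point 0) (at_left 1) = l) by (apply is_RInt_gen_unique, Hgen).
    rewrite El. split; [exact Hgen|]. split; [exact Hle|]. split; [exact Hge|].
    apply Hl2. intros y [t [Ht ->]]. apply HB, Ht.
Qed.

Lemma Rpower_two_le (a : R) : a <= 1 -> Rpower 2 a <= 2.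
Proof.
  intros H. apply Rle_trans with (Rpower 2 1); [apply Rle_Rpower; lra|rewrite Rpower_1; lra].
Qed.

Definition weight (al x : R) : R := Rpower (1 - x ^ 2) al * log_factor al x.

Section Weight.
Variable al : R.
Hypothesis Hal : 0 < al < 1.

Let inv_al : 1 < / al.
Proof. rewrite <- Rinv_1. apply Rinv_lt_contravar; lra. Qed.

Lemma one_minus_sqr_pos (x : R) : 0 <= x < 1 -> 0 < 1 - x ^ 2 <= 1.
Proof. intros Hx. simpl. split; nra. Qed.

Lemma log_factor_eq (x : R) : 0 <= x < 1 -> log_factor al x = ln 2 + / al - ln (1 - x ^ 2).
Proof.
  intros Hx. destruct (one_minus_sqr_pos x Hx) as [H1 H2]. unfold log_factor. assert (E := exp_pos (1 / al)).
  rewrite ln_div, ln_mult, ln_exp by lra. unfold Rdiv. ring.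
Qed.

Lemma ln_le_0 (y : R) : 0 < y <= 1 -> ln y <= 0.
Proof. intros H. rewrite <- ln_1. apply ln_le; lra. Qed.

Lemma ln_2_pos : 0 < ln 2.
Proof. rewrite <- ln_1. apply ln_increasing; lra. Qed.

Lemma log_factor_ge_1 (x : R) : 0 <= x < 1 -> 1 <= log_factor al x.
Proof.
  intros Hx. rewrite log_factor_eq by exact Hx.
  assert (L := ln_le_0 _ (one_minus_sqr_pos x Hx)). assert (P := ln_2_pos). lra.
Qed.

Lemma weight_pos (x : R) : 0 <= x < 1 -> 0 < weight al x.
Proof.
  intros Hx. unfold weight. apply Rmult_lt_0_compat; [apply Rpower_pos|].
  generalize (log_factor_ge_1 x Hx). lra.
Qed.

(* With u = al (ln 2 - ln y) >= 0 the quantity is a constant times (1 + u) exp (- u). *)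
Lemma profile_increasing (x y : R) : 0 < x <= y -> y <= 2 ->
  Rpower x al * (ln 2 + / al - ln x) <= Rpower y al * (ln 2 + / al - ln y).
Proof.
  intros Hx Hy.
  assert (E : forall w, 0 < w -> Rpower w al * (ln 2 + / al - ln w) =
    Rpower 2 al / al * (exp (- (al * (ln 2 - ln w))) * (1 + al * (ln 2 - ln w)))).
  { intros w Hw. unfold Rpower.
    replace (exp (al * ln w)) with (exp (al * ln 2) * exp (- (al * (ln 2 - ln w)))) by (rewrite <- exp_plus; f_equal; ring).
    field. lra. }
  rewrite !E by lra. apply Rmult_le_compat_l.
  { apply Rdiv_le_0_compat; [left; apply Rpower_pos|lra]. }
  set (u := al * (ln 2 - ln y)). set (v := al * (ln 2 - ln x)).
  assert (L1 : ln x <= ln y) by (apply ln_le; lra). assert (L2 : ln y <= ln 2) by (apply ln_le; lra).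
  assert (Hu : 0 <= u) by (apply Rmult_le_pos; lra).
  assert (Huv : u <= v) by (apply Rmult_le_compat_l; lra).
  replace (exp (- u)) with (exp (- v) * exp (v - u)) by (rewrite <- exp_plus; f_equal; ring).
  rewrite Rmult_assoc. apply Rmult_le_compat_l; [left; apply exp_pos|].
  assert (Ex := exp_ineq1_le (v - u)).
  apply Rle_trans with ((1 + (v - u)) * (1 + u)); [|apply Rmult_le_compat_r; lra].
  assert (0 <= (v - u) * u) by (apply Rmult_le_pos; lra). lra.
Qed.

Lemma weight_decreasing (x y : R) : 0 <= x <= y -> y < 1 -> weight al y <= weight al x.
Proof.
  intros Hx Hy. unfold weight. rewrite !log_factor_eq by lra.
  destruct (one_minus_sqr_pos x) as [A1 A2]; [lra|]. destruct (one_minus_sqr_pos y) as [B1 B2]; [lra|].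
  apply profile_increasing; [|lra]. split; [exact B1|]. simpl. nra.
Qed.

Section Radius.
Variable r : R.
Hypothesis Hr : 0 <= r < 1.

Let den (t : R) := (t - 1) * r + 1.
Let phi (t : R) := t / (1 - (1 - t) * r).

Lemma den_bounds (t : R) : 0 <= t < 1 -> 0 < den t /\ t <= den t <= 1 /\ 1 - r <= den t.
Proof.
  clear inv_al Hal. intros Ht. unfold den. repeat split; nra. Qed.

Lemma den_upper (t : R) : 0 <= t < 1 -> den t <= t + (1 - r).
Proof.
  clear inv_al Hal. intros Ht. unfold den. nra. Qed.

Lemma phi_range (t : R) : 0 <= t < 1 -> 0 <= phi t < 1.
Proof.
  clear inv_al Hal.
  intros Ht. destruct (den_bounds t Ht) as (D1 & D2 & D3). unfold den, phi in *.
  split; [apply Rdiv_le_0_compat; lra|]. apply Rlt_div_l; nra.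
Qed.

(** The numerator is (den t - t) (den t + t), and den t - t = (1 - t) (1 - r). *)
Lemma one_minus_phi_sqr (t : R) : 0 <= t < 1 ->
  1 - phi t ^ 2 = (1 - t) * (1 - r) * (den t + t) / den t ^ 2.
Proof.
  clear inv_al Hal.
  intros Ht. destruct (den_bounds t Ht) as (D1 & _). unfold den, phi in *.
  field. lra.
Qed.

(** The explicit integrand is a quotient of weights at r and phi t, times the factor 1 / (1 - (1 -
    t) r) of the substitution. The power (1 - r)^al cancels, and den^(2 al) from 1 - phi^2 together
    with this factor gives the exponent 2 al - 1. *)
Lemma norm_integrand_eq (t : R) : 0 <= t < 1 ->
  norm_integrand al r t = weight al r / ((1 - (1 - t) * r) * weight al (phi t)).
Proof.
  intros Ht. destruct (den_bounds t Ht) as (D1 & D2 & D3).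
  assert (L1 := log_factor_ge_1 r Hr). assert (L2 := log_factor_ge_1 (phi t) (phi_range t Ht)).
  unfold norm_integrand, weight. fold (den t). fold (phi t).
  replace (1 - (1 - t) * r) with (den t) by (unfold den; ring).
  replace (1 - r ^ 2) with ((1 - r) * (1 + r)) by ring.
  rewrite one_minus_phi_sqr by exact Ht.
  replace ((t - 1) * r + 1 + t) with (den t + t) by (unfold den; ring).
  assert (E : Rpower ((1 - t) * (1 - r) * (den t + t) / den t ^ 2) al * Rpower (den t) (2 * al - 1) * den t
     = Rpower (1 - t) al * Rpower (1 - r) al * Rpower (den t + t) al).
  { assert (0 < (1 - t) * (1 - r)) by (apply Rmult_lt_0_compat; lra).
    assert (0 < (1 - t) * (1 - r) * (den t + t)) by (apply Rmult_lt_0_compat; lra).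
    replace (den t) with (Rpower (den t) 1) at 4 by (apply Rpower_1; exact D1).
    rewrite Rmult_assoc, <- Rpower_plus. replace (2 * al - 1 + 1) with (2 * al) by ring.
    rewrite <- Rpower_mult. replace (Rpower (den t) 2) with (den t ^ 2) by (rewrite <- Rpower_pow by exact D1; reflexivity).
    rewrite !Rpower_mult_distr; try lra.
    - f_equal. field. lra.
    - apply Rdiv_lt_0_compat; [lra|apply pow_lt, D1].
    - apply pow_lt, D1. }
  assert (P1 := Rpower_pos (1 - t) al). assert (P2 := Rpower_pos (1 - r) al). assert (P3 := Rpower_pos (den t + t) al).
  assert (P4 := Rpower_pos (den t) (2 * al - 1)).
  assert (P5 := Rpower_pos ((1 - t) * (1 - r) * (den t + t) / den t ^ 2) al).
  rewrite <- (Rpower_mult_distr (1 - r) (1 + r)) by lra.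
  set (A := Rpower ((1 - t) * (1 - r) * (den t + t) / den t ^ 2) al) in *.
  apply (Rmult_eq_reg_r (Rpower (1 - t) al * Rpower (den t + t) al * log_factor al (phi t) * (den t * A))).
  2:{ repeat apply Rmult_integral_contrapositive_currified; lra. }
  transitivity (Rpower (1 + r) al * Rpower (den t) (2 * al - 1) * log_factor al r * (den t * A)).
  - field. repeat split; lra.
  - transitivity (Rpower (1 - r) al * Rpower (1 + r) al * log_factor al r * Rpower (1 - t) al * Rpower (den t + t) al).
    + replace (Rpower (1 + r) al * Rpower (den t) (2 * al - 1) * log_factor al r * (den t * A))
        with (Rpower (1 + r) al * log_factor al r * (A * Rpower (den t) (2 * al - 1) * den t)) by ring.
      rewrite E. ring.
    + field. repeat split; lra.
Qed.

Lemma norm_integrand_pos (t : R) : 0 <= t < 1 -> 0 < norm_integrand al r t.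
Proof.
  intros Ht. rewrite norm_integrand_eq by exact Ht. destruct (den_bounds t Ht) as (D1 & _).
  apply Rdiv_lt_0_compat; [apply weight_pos, Hr|]. apply Rmult_lt_0_compat; [unfold den in D1; lra|].
  apply weight_pos, phi_range, Ht.
Qed.

Lemma norm_integrand_continuous (t : R) : 0 <= t < 1 -> continuous (norm_integrand al r) t.
Proof.
  intros Ht. destruct (den_bounds t Ht) as (D1 & D2 & D3).
  assert (L2 := log_factor_ge_1 (phi t) (phi_range t Ht)).
  assert (Q := one_minus_sqr_pos _ (phi_range t Ht)).
  assert (Ee := exp_pos (1 / al)).
  apply (ex_derive_continuous (V := R_NormedModule)).
  unfold norm_integrand, log_factor, Rpower in *. fold (phi t) in *. unfold den, phi in *.
  auto_derive.
  repeat split; try lra.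
  - change (1 - (t / (1 - (1 - t) * r)) ^ 2 <> 0). lra.
  - change (0 < 2 * exp (1 / al) / (1 - (t / (1 - (1 - t) * r)) ^ 2)).
    apply Rdiv_lt_0_compat; lra.
  - apply Rgt_not_eq. apply Rmult_lt_0_compat; [apply Rmult_lt_0_compat; apply exp_pos|].
    change (0 < ln (2 * exp (1 / al) / (1 - (t / (1 - (1 - t) * r)) ^ 2))). lra.
Qed.

(** From den t >= t one gets 1 - phi^2 <= (1 - r^2) (2 / t), so the logarithms differ by at most ln
    (2 / t), whatever r is. *)
Lemma log_ratio_upper (t : R) : 0 < t < 1 -> log_factor al r <= log_factor al (phi t) + ln (2 / t).
Proof.
  intros Ht. destruct (den_bounds t ltac:(lra)) as (D1 & D2 & D3).
  rewrite !log_factor_eq by (try exact Hr; apply phi_range; lra).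
  assert (H : ln (1 - phi t ^ 2) <= ln ((1 - r ^ 2) * (2 / t))).
  { destruct (one_minus_sqr_pos _ (phi_range t ltac:(lra))) as [Q1 Q2].
    apply ln_le; [exact Q1|]. rewrite one_minus_phi_sqr by lra.
    apply Rle_div_l; [apply pow_lt, D1|].
    replace ((1 - r ^ 2) * (2 / t) * den t ^ 2) with ((1 - r) * ((1 + r) * (2 * (den t * (den t * / t))))) by (field; lra).
    replace ((1 - t) * (1 - r) * (den t + t)) with ((1 - r) * ((1 - t) * (den t + t))) by ring.
    apply Rmult_le_compat_l; [lra|]. apply Rmult_le_compat; [lra|lra|lra|].
    assert (1 <= den t * / t). { apply Rmult_le_reg_r with t; [lra|]. rewrite Rmult_assoc, Rinv_l by lra. lra. }
    assert (den t * 1 <= den t * (den t * / t)) by (apply Rmult_le_compat_l; lra). lra. }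
  destruct (one_minus_sqr_pos r Hr) as [R1 R2].
  rewrite ln_mult in H by (try lra; apply Rdiv_lt_0_compat; lra). lra.
Qed.

(** A majorant independent of r. The powers of den contribute at most t^(al - 1); the quotient of
    logarithms is at most (1 + 2 / al) (2 / t)^(al / 2), which leaves the integrable exponent al / 2
    - 1. *)
Lemma norm_integrand_upper (t : R) : 0 < t < 1 ->
  norm_integrand al r t <= 8 * (1 + 2 / al) * (Rpower t (al / 2 - 1) + Rpower (1 - t) (- al)).
Proof.
  intros Ht. destruct (den_bounds t ltac:(lra)) as (D1 & D2 & D3).
  assert (L1 := log_factor_ge_1 r Hr). assert (L2 := log_factor_ge_1 (phi t) (phi_range t ltac:(lra))).
  assert (LR := log_ratio_upper t Ht).
  set (q := Rpower (2 / t) (al / 2)).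
  assert (H2t : 1 <= 2 / t) by (apply Rle_div_r; lra).
  assert (Hq : 1 <= q).
  { unfold q. rewrite <- (Rpower_O (2 / t)) by lra. apply Rle_Rpower; lra. }
  assert (Hratio : log_factor al r / log_factor al (phi t) <= q * (1 + 2 / al)).
  { apply Rle_div_l; [lra|].
    assert (Hl := ln_le_Rpower (2 / t) (al / 2) ltac:(lra)). fold q in Hl.
    replace (q / (al / 2)) with (q * (2 / al)) in Hl by (field; lra).
    assert (X : 0 <= q * (2 / al)) by (apply Rmult_le_pos; [lra|apply Rdiv_le_0_compat; lra]).
    apply Rle_trans with (log_factor al (phi t) + q * (2 / al)); [lra|].
    replace (q * (1 + 2 / al) * log_factor al (phi t)) with (q * log_factor al (phi t) + q * (2 / al) * log_factor al (phi t)) by ring.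
    apply Rplus_le_compat.
    - rewrite <- (Rmult_1_l (log_factor al (phi t))) at 1. apply Rmult_le_compat_r; lra.
    - rewrite <- (Rmult_1_r (q * (2 / al))) at 1. apply Rmult_le_compat_l; lra. }
  assert (Eq : norm_integrand al r t = Rpower (1 + r) al * (Rpower (den t) (2 * al - 1) * Rpower (den t + t) (- al)) * Rpower (1 - t) (- al)
     * (log_factor al r / log_factor al (phi t))).
  { unfold norm_integrand. fold (den t). fold (phi t). rewrite !Rpower_Ropp.
    assert (P1 := Rpower_pos (1 - t) al). assert (P3 := Rpower_pos (den t + t) al).
    field. repeat split; lra. }
  rewrite Eq.
  assert (B1 : Rpower (1 + r) al <= 2).
  { eapply Rle_trans; [apply Rpower_base_le; [lra|split; [|apply Rplus_le_compat_l with (r2 := 1)]; lra]|].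
    replace (1 + 1) with 2 by ring. apply Rpower_two_le; lra. }
  assert (B2 : Rpower (den t) (2 * al - 1) * Rpower (den t + t) (- al) <= Rpower t (al - 1)).
  { apply Rle_trans with (Rpower (den t) (2 * al - 1) * Rpower (den t) (- al)).
    - apply Rmult_le_compat_l; [left; apply Rpower_pos|]. apply Rpower_base_le_neg; lra.
    - rewrite <- Rpower_plus. replace (2 * al - 1 + - al) with (al - 1) by ring. apply Rpower_base_le_neg; lra. }
  assert (Hqt : Rpower t (al - 1) * q <= 2 * Rpower t (al / 2 - 1)).
  { unfold q, Rdiv at 1. rewrite <- Rpower_mult_distr by (try lra; apply Rinv_0_lt_compat; lra).
    rewrite Rpower_inv_base by lra.
    replace (Rpower t (al - 1) * (Rpower 2 (al / 2) * Rpower t (- (al / 2))))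
      with (Rpower 2 (al / 2) * (Rpower t (al - 1) * Rpower t (- (al / 2)))) by ring.
    rewrite <- Rpower_plus. replace (al - 1 + - (al / 2)) with (al / 2 - 1) by field.
    apply Rmult_le_compat_r; [left; apply Rpower_pos|].
    apply Rpower_two_le; lra. }
  (* On each half of (0, 1) one of the two factors is at most 2; the sum separates the singularities
     at 0 and 1. *)
  assert (Hsplit : Rpower t (al / 2 - 1) * Rpower (1 - t) (- al) <= 2 * (Rpower t (al / 2 - 1) + Rpower (1 - t) (- al))).
  { assert (P1 := Rpower_pos t (al / 2 - 1)). assert (P2 := Rpower_pos (1 - t) (- al)).
    assert (Half : forall b, -1 <= b <= 0 -> Rpower (1 / 2) b <= 2).
    { intros b Hb. replace (1 / 2) with (/ 2) by lra. rewrite Rpower_inv_base by lra.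
      apply Rpower_two_le; lra. }
    destruct (Rle_dec t (1 / 2)) as [T|T].
    - assert (Rpower (1 - t) (- al) <= 2).
      { eapply Rle_trans; [|apply (Half (- al)); lra]. apply Rpower_base_le_neg; lra. }
      apply Rle_trans with (Rpower t (al / 2 - 1) * 2); [apply Rmult_le_compat_l; lra|lra].
    - assert (Rpower t (al / 2 - 1) <= 2).
      { eapply Rle_trans; [|apply (Half (al / 2 - 1)); lra]. apply Rpower_base_le_neg; lra. }
      apply Rle_trans with (2 * Rpower (1 - t) (- al)); [apply Rmult_le_compat_r; lra|lra]. }
  assert (P0 := Rpower_pos (1 + r) al). assert (P1 := Rpower_pos (1 - t) (- al)). assert (P2 := Rpower_pos t (al - 1)).
  assert (P3 : 0 < Rpower (den t) (2 * al - 1) * Rpower (den t + t) (- al)) by (apply Rmult_lt_0_compat; apply Rpower_pos).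
  assert (P4 : 0 < log_factor al r / log_factor al (phi t)) by (apply Rdiv_lt_0_compat; lra).
  assert (P5 : 0 < 1 + 2 / al) by (assert (0 < 2 / al) by (apply Rdiv_lt_0_compat; lra); lra).
  apply Rle_trans with (2 * Rpower t (al - 1) * Rpower (1 - t) (- al) * (q * (1 + 2 / al))).
  { apply Rmult_le_compat; [|lra| |exact Hratio].
    - apply Rmult_le_pos; [apply Rmult_le_pos; lra|lra].
    - apply Rmult_le_compat_r; [lra|]. apply Rmult_le_compat; lra. }
  replace (2 * Rpower t (al - 1) * Rpower (1 - t) (- al) * (q * (1 + 2 / al)))
    with (2 * (1 + 2 / al) * ((Rpower t (al - 1) * q) * Rpower (1 - t) (- al))) by ring.
  replace (8 * (1 + 2 / al) * (Rpower t (al / 2 - 1) + Rpower (1 - t) (- al)))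
    with (2 * (1 + 2 / al) * (2 * (2 * (Rpower t (al / 2 - 1) + Rpower (1 - t) (- al))))) by ring.
  apply Rmult_le_compat_l; [lra|].
  apply Rle_trans with (2 * Rpower t (al / 2 - 1) * Rpower (1 - t) (- al)); [apply Rmult_le_compat_r; lra|].
  rewrite Rmult_assoc. apply Rmult_le_compat_l; [lra|exact Hsplit].
Qed.

(** The majorant is singular at 0, so it is integrated from s > 0 only. The piece over [0, s] is
    small by a bound M for the continuous integrand; M may depend on r, since it disappears as s
    tends to 0. *)
Lemma norm_integrand_integral_bound (T : R) : 0 <= T < 1 ->
  RInt (norm_integrand al r) 0 T <= 8 * (1 + 2 / al) * (2 / al + 1 / (1 - al)).
Proof.
  intros HT. set (k := norm_integrand al r). set (K := 8 * (1 + 2 / al)).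
  assert (HK : 0 < K).
  { unfold K. assert (0 < 2 / al) by (apply Rdiv_lt_0_compat; lra). lra. }
  assert (H2 : 0 < 2 / al + 1 / (1 - al)).
  { assert (0 < 2 / al) by (apply Rdiv_lt_0_compat; lra). assert (0 < 1 / (1 - al)) by (apply Rdiv_lt_0_compat; lra). lra. }
  assert (Hc : forall t, 0 <= t <= T -> continuous k t) by (intros; apply norm_integrand_continuous; lra).
  assert (Hex : forall s t, 0 <= s -> s <= t -> t <= T -> ex_RInt k s t).
  { intros s t Hs Hst Ht. apply (ex_RInt_continuous (V := R_CompleteNormedModule)).
    intros x. rewrite Rmin_left, Rmax_right by lra. intros Hx. apply Hc. lra. }
  destruct (continuous_bounded k 0 T ltac:(lra) Hc) as [M [HM0 HM]].
  assert (Hmain : forall s, 0 < s <= T -> RInt k s T <= K * (2 / al + 1 / (1 - al))).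
  { intros s Hs.
    set (P := fun t => K * (2 / al * Rpower t (al / 2) + - / (1 - al) * Rpower (1 - t) (1 - al))).
    assert (HI : is_RInt (fun t => K * (Rpower t (al / 2 - 1) + Rpower (1 - t) (- al))) s T (P T - P s)).
    { apply (is_RInt_derive (V := R_CompleteNormedModule) P).
      - intros t. rewrite Rmin_left, Rmax_right by lra. intros Ht. unfold P.
        apply is_derive_scal. apply (is_derive_plus (fun t => 2 / al * Rpower t (al / 2)) (fun t => - / (1 - al) * Rpower (1 - t) (1 - al))).
        + evar_last; [apply (is_derive_scal (fun t => Rpower t (al / 2)))|].
          * apply is_derive_Reals, derivable_pt_lim_power. lra.
          * field. lra.
        + evar_last; [apply (is_derive_scal (fun t => Rpower (1 - t) (1 - al)))|].
          * apply is_derive_Rpower_one_minus. lra.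
          * replace (1 - al - 1) with (- al) by ring. field. lra.
      - intros t. rewrite Rmin_left, Rmax_right by lra. intros Ht.
        apply (ex_derive_continuous (V := R_NormedModule)). unfold Rpower. auto_derive. lra. }
    eapply Rle_trans.
    - apply (is_RInt_le k (fun t => K * (Rpower t (al / 2 - 1) + Rpower (1 - t) (- al))) s T); [lra| |exact HI|].
      + apply (RInt_correct (V := R_CompleteNormedModule)), Hex; lra.
      + intros t Ht. apply norm_integrand_upper. lra.
    - unfold P. rewrite <- Rmult_minus_distr_l. apply Rmult_le_compat_l; [lra|].
      assert (Q1 := Rpower_pos s (al / 2)). assert (Q2 := Rpower_pos (1 - T) (1 - al)).
      assert (Q3 : Rpower T (al / 2) <= 1).
      { rewrite <- (Rpower_O 1) by lra. apply Rle_trans with (Rpower 1 (al / 2)).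
        - apply Rpower_base_le; lra.
        - unfold Rpower. rewrite ln_1, !Rmult_0_r. lra. }
      assert (Q4 : Rpower (1 - s) (1 - al) <= 1).
      { apply Rle_trans with (Rpower 1 (1 - al)).
        - apply Rpower_base_le; lra.
        - unfold Rpower. rewrite ln_1, Rmult_0_r, exp_0. lra. }
      assert (Q5 : 0 < 2 / al) by (apply Rdiv_lt_0_compat; lra).
      assert (Q6 : 0 < / (1 - al)) by (apply Rinv_0_lt_compat; lra).
      replace (1 / (1 - al)) with (/ (1 - al)) by (field; lra).
      assert (2 / al * Rpower T (al / 2) <= 2 / al * 1) by (apply Rmult_le_compat_l; lra).
      assert (/ (1 - al) * Rpower (1 - s) (1 - al) <= / (1 - al) * 1) by (apply Rmult_le_compat_l; lra).
      assert (0 < 2 / al * Rpower s (al / 2)) by (apply Rmult_lt_0_compat; lra).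
      assert (0 < / (1 - al) * Rpower (1 - T) (1 - al)) by (apply Rmult_lt_0_compat; lra).
      lra. }
  apply le_epsilon. intros eps Heps.
  destruct (Req_dec T 0) as [E|E].
  { rewrite E, RInt_point. unfold zero; simpl. assert (0 < K * (2 / al + 1 / (1 - al))) by (apply Rmult_lt_0_compat; lra). lra. }
  set (s := Rmin T (eps / (M + 1))).
  assert (Hs0 : 0 < s) by (apply Rmin_pos; [lra|apply Rdiv_lt_0_compat; lra]).
  assert (Hs1 : s <= T) by apply Rmin_l. assert (Hs2 : s <= eps / (M + 1)) by apply Rmin_r.
  assert (C := RInt_Chasles k 0 s T (Hex 0 s ltac:(lra) ltac:(lra) ltac:(lra)) (Hex s T ltac:(lra) ltac:(lra) ltac:(lra))).
  change (RInt k 0 s + RInt k s T = RInt k 0 T) in C. rewrite <- C.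
  assert (Hsmall : RInt k 0 s <= M * s).
  { eapply Rle_trans.
    - apply (RInt_le k (fun _ => M) 0 s); [lra|apply Hex; lra|apply ex_RInt_const|]. intros t Ht. apply HM. lra.
    - rewrite RInt_const. unfold scal; simpl; unfold mult; simpl. lra. }
  assert (Mle : M * s <= eps).
  { apply Rle_trans with ((M + 1) * (eps / (M + 1))); [apply Rmult_le_compat; lra|right; field; lra]. }
  assert (X := Hmain s ltac:(lra)). lra.
Qed.

End Radius.
End Weight.

(** * The norm as a supremum of radial integrals *)

Lemma analytic_holomorphic (f : C -> C) : analytic_on_disk f <-> holomorphic f.
Proof.
  split; intros H z Hz; destruct (H z Hz) as [l Hl]; exists l; apply is_derive_Cderiv, Hl.
Qed.

(** * The extremal function *)

Section Extremal.
Variable al : R.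
Hypothesis Hal : 0 < al < 1.

Lemma Cmod_sqr_lt_1 (z : C) : Cmod z < 1 -> Cmod (z * z) < 1.
Proof. intros Hz. assert (Hz0 := Cmod_ge_0 z). rewrite Cmod_mult. nra. Qed.

(* A holomorphic logarithm of 1 - z^2, obtained as a primitive. *)
Lemma log_one_minus_sqr : exists L : C -> C,
  (forall z, Cmod z < 1 -> exists l, Cderiv L z l) /\
  (forall z, Cmod z < 1 -> Re (L z) = ln (Cmod (1 - z * z))) /\
  (forall x, 0 <= x < 1 -> L (RtoC x) = RtoC (ln (1 - x ^ 2))).
Proof.
  (* The logarithmic derivative of 1 - w^2. *)
  set (q := fun w : C => (- (2) * w / (1 - w * w))%C).
  assert (Hne : forall w, Cmod w < 1 -> (1 - w * w)%C <> 0%C) by (intros w Hw; apply one_minus_neq_0, Cmod_sqr_lt_1, Hw).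
  assert (Hsq : forall w, Cderiv (fun w => 1 - w * w)%C w (0 - (1 * w + w * 1))).
  { intros w. apply Cderiv_minus; [apply Cderiv_const|]. apply (Cderiv_mult (fun w => w) (fun w => w)); apply Cderiv_id. }
  assert (Hq : holomorphic q).
  { intros w Hw. eexists. apply (Cderiv_div (fun w => - (2) * w)%C (fun w => 1 - w * w)%C).
    - apply Hne, Hw.
    - apply Cderiv_linear.
    - apply Hsq. }
  destruct (holomorphic_primitive q Hq) as [P HP].
  set (L := fun w => (P w - P 0)%C).
  assert (HL : forall w, Cmod w < 1 -> Cderiv L w (q w)).
  { intros w Hw. replace (q w) with (q w - 0)%C by ring. apply Cderiv_minus; [apply HP, Hw|apply Cderiv_const]. }
  assert (Hray : forall z t, Cmod z < 1 -> 0 <= t <= 1 -> Cmod (RtoC t * z) < 1).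
  { intros z t Hz Ht. rewrite Cmod_mult, Cmod_R, Rabs_pos_eq by lra.
    assert (Hz0 := Cmod_ge_0 z). nra. }
  assert (Hexp : forall z, Cmod z < 1 -> cexp (L z) = (1 - z * z)%C).
  { intros z Hz.
    (* Its derivative vanishes, so it is constant along the segment from 0 to z, with value 1 at
       0. *)
    set (E := fun w => ((1 - w * w) * cexp (- L w))%C).
    assert (HE : forall w, Cmod w < 1 -> Cderiv E w 0).
    { intros w Hw. replace (RtoC 0) with ((0 - (1 * w + w * 1)) * cexp (- L w) + (1 - w * w) * (cexp (- L w) * (0 - q w)))%C.
      - apply (Cderiv_mult (fun w => 1 - w * w)%C (fun w => cexp (- L w))); [apply Hsq|]. apply (Cderiv_comp cexp (fun w => - L w)%C); [apply Cderiv_cexp|].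
        apply (Cderiv_ext (fun w => 0 - L w)%C); [intros; ring|]. apply Cderiv_minus; [apply Cderiv_const|apply HL, Hw].
      - unfold q. field. apply Hne, Hw. }
    assert (I : is_CInt (fun _ => 0%C) 0 1 (E (RtoC 1 * z)%C - E (RtoC 0 * z)%C)).
    { apply (is_CInt_FTC_le (fun t => E (RtoC t * z)%C)); [lra| |]; intros t Ht.
      - replace (RtoC 0) with (0 * z)%C by ring.
        apply (is_curve_derive_Cderiv (fun w => E (w * z)%C)). apply (Cderiv_comp E (fun w => w * z)%C); [apply HE, Hray; assumption|].
        apply (Cderiv_ext (fun w => z * w)%C); [intros; ring|apply Cderiv_linear].
      - apply Ccont_curve_const. }
    apply is_CInt_unique in I. rewrite (is_CInt_unique _ _ _ _ (is_CInt_const 0 0 1)) in I.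
    replace (RtoC 1 * z)%C with z in I by ring. replace (RtoC 0 * z)%C with (RtoC 0) in I by ring.
    assert (E0 : E 0%C = 1%C).
    { unfold E, L. replace (- (P 0 - P 0))%C with (RtoC 0) by ring. rewrite cexp_0. ring. }
    rewrite E0 in I. assert (Ez : E z = 1%C).
    { replace (E z) with ((E z - 1) + 1)%C by ring. rewrite <- I. ring. }
    unfold E in Ez. rewrite cexp_opp in Ez.
    replace (cexp (L z)) with (cexp (L z) * ((1 - z * z) * / cexp (L z)))%C by (rewrite Ez; ring).
    field. apply cexp_neq_0. }
  assert (Hre : forall z, Cmod z < 1 -> Re (L z) = ln (Cmod (1 - z * z))).
  { intros z Hz. rewrite <- (Hexp z Hz), Cmod_cexp, ln_exp. reflexivity. }
  exists L. split; [|split; [exact Hre|]].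
  - intros z Hz. exists (q z). apply HL, Hz.
  - intros x Hx.
    (* The identity for exp L determines this imaginary part only modulo 2 PI; integrating the
       real-valued q along the real axis gives exactly 0. *)
    assert (Him : Im (L (RtoC x)) = 0).
    { assert (I : is_CInt (fun t => q (RtoC t)) 0 x (L (RtoC x) - L (RtoC 0))%C).
      { apply (is_CInt_FTC_le (fun t => L (RtoC t))); [lra| |]; intros t Ht;
        assert (Hmt : Cmod (RtoC t) < 1) by (rewrite Cmod_R, Rabs_pos_eq; lra).
        - apply is_curve_derive_Cderiv, HL, Hmt.
        - apply (Ccont_curve_comp q RtoC); [|apply Ccont_curve_RtoC]. destruct (Hq _ Hmt) as [l Hl]. exact (Cderiv_Ccont _ _ _ Hl). }
      destruct I as [_ I].
      assert (E0 : L (RtoC 0) = 0%C) by (unfold L; ring). rewrite E0 in I.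
      replace (Im (L (RtoC x) - 0)%C) with (Im (L (RtoC x))) in I by (rewrite im_minus; simpl; ring).
      apply (is_RInt_unique (V := R_CompleteNormedModule)) in I. rewrite <- I.
      rewrite (RInt_ext _ (fun _ => 0)).
      - rewrite RInt_const. unfold scal; simpl; unfold mult; simpl. ring.
      - intros t. rewrite Rmin_left, Rmax_right by lra. intros Ht.
        assert (Hq' : q (RtoC t) = RtoC (- (2) * t / (1 - t * t))).
        { unfold q. rewrite RtoC_div by nra. rewrite RtoC_mult, RtoC_minus, RtoC_mult, RtoC_opp. reflexivity. }
        rewrite Hq'. reflexivity. }
    assert (Hmx : Cmod (RtoC x) < 1) by (rewrite Cmod_R, Rabs_pos_eq; lra).
    assert (Hr := Hre _ Hmx). rewrite <- RtoC_mult, <- RtoC_minus, Cmod_R, Rabs_pos_eq in Hr by nra.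
    replace (1 - x ^ 2) with (1 - x * x) by ring. rewrite <- Hr.
    destruct (L (RtoC x)) as [u v]. simpl in *. rewrite Him. reflexivity.
Qed.

(** The denominator c - L has real part c - ln |1 - z^2| >= 1 / al, so it has no zero and its
    modulus is at least that real part. The unit-ball estimate is then [profile_increasing] between
    1 - |z|^2 and |1 - z^2| <= 2. *)
Lemma extremal_function : exists f : C -> C, holomorphic f /\
  (forall z, Cmod z < 1 -> weight al (Cmod z) * Cmod (f z) <= 1) /\
  (forall x, 0 <= x < 1 -> f (RtoC x) = RtoC (/ weight al x)).
Proof.
  destruct log_one_minus_sqr as (L & HL & Hre & Hreal).
  set (c := ln 2 + / al).
  assert (Hia : 0 < / al) by (apply Rinv_0_lt_compat; lra).
  assert (Hpos : forall z, Cmod z < 1 -> 0 < Cmod (1 - z * z) <= 2 /\ / al <= c - Re (L z)).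
  { intros z Hz. assert (Hs := Cmod_sqr_lt_1 z Hz). assert (H1 := Cmod_one_minus_ge (z * z)).
    assert (H2 : Cmod (1 - z * z) <= 2) by (eapply Rle_trans; [apply Cmod_minus_le|rewrite Cmod_1; lra]).
    split; [lra|]. rewrite (Hre z Hz). unfold c. assert (ln (Cmod (1 - z * z)) <= ln 2) by (apply ln_le; lra). lra. }
  assert (Hden : forall z, Cmod z < 1 -> c - Re (L z) <= Cmod (RtoC c - L z)).
  { intros z Hz. eapply Rle_trans; [apply Rle_abs|].
    replace (c - Re (L z)) with (Re (RtoC c - L z)%C) by reflexivity. apply re_le_Cmod. }
  assert (Hne : forall z, Cmod z < 1 -> (RtoC c - L z)%C <> 0%C).
  { intros z Hz. apply Cmod_gt_0. generalize (Hden z Hz), (proj2 (Hpos z Hz)). lra. }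
  exists (fun z => cexp (- RtoC al * L z) / (RtoC c - L z))%C. split; [|split].
  - intros z Hz. destruct (HL z Hz) as [l Hl]. eexists.
    apply (Cderiv_div (fun z => cexp (- RtoC al * L z)) (fun z => RtoC c - L z)%C).
    + apply Hne, Hz.
    + apply (Cderiv_comp cexp (fun z => - RtoC al * L z)%C); [apply Cderiv_cexp|apply Cderiv_scal, Hl].
    + apply Cderiv_minus; [apply Cderiv_const|exact Hl].
  - intros z Hz. destruct (Hpos z Hz) as [[P1 P2] P3]. assert (D := Hden z Hz).
    assert (Hz0 := Cmod_ge_0 z).
    rewrite Cmod_div by (apply Hne, Hz). rewrite Cmod_cexp.
    replace (Re (- RtoC al * L z)%C) with (- al * ln (Cmod (1 - z * z))).
    2:{ rewrite <- Hre by exact Hz. rewrite <- RtoC_opp, re_scal_l. reflexivity. }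
    change (exp (- al * ln (Cmod (1 - z * z)))) with (Rpower (Cmod (1 - z * z)) (- al)).
    unfold weight. rewrite (log_factor_eq al (Cmod z)) by (split; [exact Hz0|exact Hz]).
    set (y := Cmod (1 - z * z)) in *.
    assert (Hxy : 1 - Cmod z ^ 2 <= y).
    { eapply Rle_trans; [|apply Cmod_one_minus_ge]. rewrite Cmod_mult. simpl. lra. }
    destruct (one_minus_sqr_pos (Cmod z) (conj Hz0 Hz)) as [Q1 Q2].
    assert (V := profile_increasing al Hal (1 - Cmod z ^ 2) y (conj Q1 Hxy) P2).
    fold c in V. fold c. rewrite (Hre z Hz) in D, P3. fold y in D, P3.
    assert (Y := Rpower_pos y al).
    rewrite Rpower_Ropp.
    apply Rle_trans with (Rpower y al * (c - ln y) * (/ Rpower y al / Cmod (RtoC c - L z))).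
    + apply Rmult_le_compat_r; [|exact V]. apply Rdiv_le_0_compat; [left; apply Rinv_0_lt_compat, Y|lra].
    + replace (Rpower y al * (c - ln y) * (/ Rpower y al / Cmod (RtoC c - L z))) with ((c - ln y) / Cmod (RtoC c - L z)) by (field; split; lra).
      apply Rle_div_l; lra.
  - intros x Hx. rewrite (Hreal x Hx).
    destruct (one_minus_sqr_pos x Hx) as [Q1 Q2].
    assert (W := weight_pos al Hal x Hx). unfold weight in *. rewrite (log_factor_eq al x Hx) in *. fold c in W |- *.
    set (l := ln (1 - x ^ 2)) in *.
    assert (Hc : 0 < c - l) by (generalize (Rpower_pos (1 - x ^ 2) al); nra).
    rewrite <- RtoC_opp, <- RtoC_mult, <- RtoC_minus.
    replace (cexp (RtoC (- al * l))) with (RtoC (Rpower (1 - x ^ 2) (- al))).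
    2:{ unfold cexp, Rpower. cbn [Re Im RtoC fst snd]. fold l. rewrite cos_0, sin_0. unfold RtoC. f_equal; ring. }
    rewrite <- RtoC_div by lra. f_equal. rewrite Rpower_Ropp. field. split; [lra|]. generalize (Rpower_pos (1 - x ^ 2) al). lra.
Qed.

End Extremal.

(** * Boundedness and the exact norm *)

Section Norm.
Variable al : R.
Hypothesis Hal : 0 < al < 1.

Definition radial_integral (r : R) : R := RInt_gen (norm_integrand al r) (at_point 0) (at_left 1).

Definition radial_bound : R := 8 * (1 + 2 / al) * (2 / al + 1 / (1 - al)).

Lemma radial_integral_spec (r : R) : 0 <= r < 1 ->
  is_RInt_gen (norm_integrand al r) (at_point 0) (at_left 1) (radial_integral r) /\
  (forall t, 0 <= t < 1 -> RInt (norm_integrand al r) 0 t <= radial_integral r) /\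
  (forall eps, 0 < eps -> exists t0, 0 <= t0 < 1 /\
    forall t, t0 <= t < 1 -> radial_integral r - eps <= RInt (norm_integrand al r) 0 t) /\
  radial_integral r <= radial_bound.
Proof.
  intros Hr. apply RInt_gen_bounded.
  - intros t Ht. apply norm_integrand_continuous; assumption.
  - intros t Ht. left. apply norm_integrand_pos; assumption.
  - intros t Ht. apply norm_integrand_integral_bound; assumption.
Qed.

Lemma radial_integral_ge_0 (r : R) : 0 <= r < 1 -> 0 <= radial_integral r.
Proof.
  intros Hr. destruct (radial_integral_spec r Hr) as (_ & H & _). specialize (H 0 ltac:(lra)).
  rewrite RInt_point in H. exact H.
Qed.

Lemma korenblum_norm_le (f : C -> C) (N : R) :
  Rbar_le (korenblum_log_norm al f) N <-> forall z, Cmod z < 1 -> weight al (Cmod z) * Cmod (f z) <= N.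
Proof.
  unfold korenblum_log_norm. match goal with |- Rbar_le (Lub_Rbar ?E) _ <-> _ => destruct (Lub_Rbar_correct E) as [U L] end.
  split.
  - intros H z Hz. change (Rbar_le (weight al (Cmod z) * Cmod (f z)) N).
    eapply Rbar_le_trans; [|exact H]. apply U. exists z. split; [exact Hz|reflexivity].
  - intros H. apply L. intros y [z [Hz ->]]. apply (H z Hz).
Qed.

Lemma korenblum_norm_finite (f : C -> C) : Rbar_lt (korenblum_log_norm al f) p_infty ->
  exists N, korenblum_log_norm al f = Finite N /\ 0 <= N.
Proof.
  intros H.
  assert (H0 : Rbar_le 0 (korenblum_log_norm al f)).
  { unfold korenblum_log_norm. match goal with |- Rbar_le _ (Lub_Rbar ?E) => destruct (Lub_Rbar_correct E) as [U _] end.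
    apply Rbar_le_trans with (weight al (Cmod 0) * Cmod (f 0)).
    - simpl. rewrite Cmod_0. apply Rmult_le_pos; [left; apply weight_pos; lra|apply Cmod_ge_0].
    - apply U. exists (RtoC 0). split; [|reflexivity]. unfold unit_disk. rewrite Cmod_0. lra. }
  destruct (korenblum_log_norm al f) as [N| |]; simpl in *; try contradiction.
  exists N. split; [reflexivity|exact H0].
Qed.

Lemma weight_ge (x : R) : 0 <= x < 1 -> Rpower (1 - x) al <= weight al x.
Proof.
  intros Hx. unfold weight. assert (L := log_factor_ge_1 al Hal x Hx).
  rewrite <- (Rmult_1_r (Rpower (1 - x) al)).
  apply Rmult_le_compat; [left; apply Rpower_pos|lra| |exact L].
  apply Rpower_base_le; [lra|]. simpl. nra.
Qed.

(** Dropping the logarithm, which is at least 1, leaves the power growth on which convergence and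
    change of path rest; the full weight returns in the sharp estimate. *)
Lemma korenblum_growth (f : C -> C) (N : R) : 0 <= N ->
  (forall z, Cmod z < 1 -> weight al (Cmod z) * Cmod (f z) <= N) ->
  forall z, Cmod z < 1 -> Cmod (f z) <= N * Rpower (1 - Cmod z) (- al).
Proof.
  intros HN H z Hz. assert (Hz' := conj (Cmod_ge_0 z) Hz). specialize (H z Hz).
  assert (W := weight_ge _ Hz'). rewrite Rpower_Ropp. assert (P := Rpower_pos (1 - Cmod z) al).
  apply Rle_div_r; [exact P|]. eapply Rle_trans; [|exact H]. rewrite Rmult_comm.
  apply Rmult_le_compat_r; [apply Cmod_ge_0|exact W].
Qed.

Lemma moebius_path_real (r t : R) : 0 <= r < 1 -> 0 <= t < 1 ->
  moebius_path (RtoC r) t = RtoC (t / (1 - (1 - t) * r)).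
Proof.
  intros Hr Ht. unfold moebius_path. rewrite RtoC_div by nra.
  rewrite !RtoC_minus, RtoC_mult, RtoC_minus. reflexivity.
Qed.

(** Truncation at T bounds |g z| by a pointwise estimate of the integrand on [0, T] plus an error L
    (1 - T)^(1 - al). The constant L depends on z, but T is chosen after z, so the sharp constant is
    preserved. *)
Lemma hilbert_upper_bound (f g : C -> C) (N : R) : 0 <= N -> holomorphic f ->
  (forall z, Cmod z < 1 -> weight al (Cmod z) * Cmod (f z) <= N) -> hilbert f g ->
  forall z, Cmod z < 1 -> weight al (Cmod z) * Cmod (g z) <= N * radial_integral (Cmod z).
Proof.
  intros HN Hf Hle Hg z Hz. assert (Hz' := conj (Cmod_ge_0 z) Hz).
  assert (Gr := korenblum_growth f N HN Hle).
  destruct (hilbert_path f al N Hal HN Hf Gr g z Hz Hg) as (L & HL0 & HL).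
  set (r := Cmod z) in *. assert (W := weight_pos al Hal r Hz').
  destruct (radial_integral_spec r Hz') as (_ & Hint & _).
  rewrite Rmult_comm. apply Rle_div_r; [exact W|].
  apply le_epsilon. intros eps Heps.
  destruct (Rpower_small (1 - al) (eps / (L + 1))) as [d [Hd Hd']]; [lra|apply Rdiv_lt_0_compat; lra|].
  set (T := Rmax 0 (1 - d)).
  assert (HT : 0 <= T < 1) by (unfold T; split; [apply Rmax_l|apply Rmax_lub_lt; lra]).
  assert (HT2 : 1 - T <= d) by (unfold T; generalize (Rmax_r 0 (1 - d)); lra).
  specialize (HL T HT). specialize (Hd' (1 - T) ltac:(lra)).
  assert (Hden : forall t, 0 <= t < 1 -> 0 < 1 - (1 - t) * r) by (intros; nra).
  set (J := CInt (fun t => f (moebius_path z t) / (1 - (1 - RtoC t) * z))%C 0 T) in *.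
  assert (HJ : Cmod J <= N / weight al r * RInt (norm_integrand al r) 0 T).
  { apply (Cmod_CInt_le (fun t => f (moebius_path z t) / (1 - (1 - RtoC t) * z))%C (fun t => N / weight al r * norm_integrand al r t) 0 T); [lra| | |].
    - apply CInt_correct_le; [lra|]. intros t Ht.
      assert (Hd0 : (1 - (1 - RtoC t) * z)%C <> 0%C).
      { apply Cmod_gt_0. generalize (moebius_den z t ltac:(lra)), (Hden t ltac:(lra)). fold r. lra. }
      assert (Hcd : Ccont_curve (fun t => 1 - (1 - RtoC t) * z)%C t).
      { apply Ccont_curve_minus; [apply Ccont_curve_const|]. apply Ccont_curve_mult; [|apply Ccont_curve_const].
        apply Ccont_curve_minus; [apply Ccont_curve_const|apply Ccont_curve_RtoC]. }
      apply Ccont_curve_div; [exact Hd0| |exact Hcd].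
      apply (Ccont_curve_comp f (moebius_path z)).
      + destruct (Hf (moebius_path z t)) as [l Hl]; [|exact (Cderiv_Ccont _ _ _ Hl)].
        eapply Rle_lt_trans; [apply moebius_path_bound; [exact Hz|lra]|]. fold r.
        apply Rlt_div_l; [apply Hden; lra|]. nra.
      + apply Ccont_curve_div; [exact Hd0|apply Ccont_curve_RtoC|exact Hcd].
    - apply (is_RInt_scal (V := R_NormedModule) (norm_integrand al r)).
      apply (RInt_correct (V := R_CompleteNormedModule)), (ex_RInt_continuous (V := R_CompleteNormedModule)).
      intros t. rewrite Rmin_left, Rmax_right by lra. intros Ht. apply norm_integrand_continuous; [exact Hal|exact Hz'|lra].
    - intros t Ht. rewrite (norm_integrand_eq al Hal r Hz' t) by lra.
      assert (D := moebius_den z t ltac:(lra)). fold r in D. specialize (Hden t ltac:(lra)).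
      assert (B := moebius_path_bound z t Hz ltac:(lra)). fold r in B.
      assert (Ph : 0 <= t / (1 - (1 - t) * r) < 1) by (split; [apply Rdiv_le_0_compat; lra|apply Rlt_div_l; nra]).
      assert (W2 := weight_pos al Hal _ Ph).
      assert (Hphi : Cmod (moebius_path z t) < 1) by lra.
      assert (Hm := Hle _ Hphi).
      assert (Wd := weight_decreasing al Hal _ _ (conj (Cmod_ge_0 (moebius_path z t)) B) (proj2 Ph)).
      rewrite Cmod_div by (apply Cmod_gt_0; lra).
      replace (N / weight al r * (weight al r / ((1 - (1 - t) * r) * weight al (t / (1 - (1 - t) * r)))))
        with ((N / weight al (t / (1 - (1 - t) * r))) * / (1 - (1 - t) * r)) by (field; repeat split; lra).
      unfold Rdiv at 1. apply Rmult_le_compat; [apply Cmod_ge_0|left; apply Rinv_0_lt_compat; lra| |apply Rinv_le_contravar; lra].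
      apply Rle_div_r; [exact W2|]. rewrite Rmult_comm.
      eapply Rle_trans; [apply Rmult_le_compat_r; [apply Cmod_ge_0|exact Wd]|exact Hm]. }
  specialize (Hint T HT).
  assert (HN2 : 0 <= N / weight al r) by (apply Rdiv_le_0_compat; lra).
  replace (g z) with (J - (J - g z))%C by ring.
  eapply Rle_trans; [apply Cmod_minus_le|]. apply Rplus_le_compat.
  - eapply Rle_trans; [exact HJ|]. unfold Rdiv. rewrite (Rmult_assoc N), (Rmult_assoc N), (Rmult_comm (radial_integral r)).
    apply Rmult_le_compat_l; [exact HN|]. apply Rmult_le_compat_l; [left; apply Rinv_0_lt_compat, W|exact Hint].
  - eapply Rle_trans; [exact HL|]. apply Rle_trans with ((L + 1) * (eps / (L + 1))); [|right; field; lra].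
    apply Rmult_le_compat; [exact HL0|left; apply Rpower_pos|lra|exact Hd'].
Qed.

(** For z = r the path stays on the real axis, where f is 1 / weight; the integrand is then exactly
    [norm_integrand] divided by [weight al r], and no inequality loses anything. *)
Lemma hilbert_extremal (f g : C -> C) (r : R) : holomorphic f -> 0 <= r < 1 ->
  (forall z, Cmod z < 1 -> weight al (Cmod z) * Cmod (f z) <= 1) ->
  (forall x, 0 <= x < 1 -> f (RtoC x) = RtoC (/ weight al x)) -> hilbert f g ->
  g (RtoC r) = RtoC (radial_integral r / weight al r).
Proof.
  intros Hf Hr Hle Hx Hg.
  assert (Hmr : Cmod (RtoC r) < 1) by (rewrite Cmod_R, Rabs_pos_eq; lra).
  assert (Gr := korenblum_growth f 1 ltac:(lra) Hle).
  destruct (hilbert_path f al 1 Hal ltac:(lra) Hf Gr g _ Hmr Hg) as (L & HL0 & HL).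
  destruct (radial_integral_spec r Hr) as (_ & Hint & Hlim & _).
  assert (W := weight_pos al Hal r Hr).
  apply Ceq_eps. intros eps Heps.
  destruct (Rpower_small (1 - al) (eps / 2 / (L + 1))) as [d [Hd Hd']]; [lra|apply Rdiv_lt_0_compat; lra|].
  destruct (Hlim (eps / 2 * weight al r)) as [t0 [Ht0 Hlim']]; [apply Rmult_lt_0_compat; lra|].
  set (T := Rmax t0 (1 - d)).
  assert (HT : 0 <= T < 1) by (unfold T; split; [eapply Rle_trans; [|apply Rmax_l]; lra|apply Rmax_lub_lt; lra]).
  assert (HT2 : 1 - T <= d) by (unfold T; generalize (Rmax_r t0 (1 - d)); lra).
  assert (HT3 : t0 <= T) by apply Rmax_l.
  specialize (HL T HT). specialize (Hd' (1 - T) ltac:(lra)). specialize (Hint T HT). specialize (Hlim' T ltac:(lra)).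
  assert (EJ : CInt (fun t => f (moebius_path (RtoC r) t) / (1 - (1 - RtoC t) * RtoC r))%C 0 T = RtoC (RInt (norm_integrand al r) 0 T / weight al r)).
  { apply is_CInt_unique.
    apply (is_CInt_ext (fun t => RtoC (/ weight al r * norm_integrand al r t))).
    - intros t. rewrite Rmin_left, Rmax_right by lra. intros Ht.
      assert (Hden : 0 < 1 - (1 - t) * r) by nra.
      assert (Ph : 0 <= t / (1 - (1 - t) * r) < 1) by (split; [apply Rdiv_le_0_compat; lra|apply Rlt_div_l; nra]).
      assert (W2 := weight_pos al Hal _ Ph).
      rewrite moebius_path_real by lra. rewrite Hx by exact Ph.
      rewrite <- RtoC_minus, <- RtoC_mult, <- RtoC_minus, <- RtoC_div by lra. f_equal.
      rewrite (norm_integrand_eq al Hal r Hr t) by lra. field. repeat split; lra.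
    - split; cbn [Re Im RtoC fst snd].
      + unfold Rdiv. rewrite Rmult_comm. apply (is_RInt_scal (V := R_NormedModule) (norm_integrand al r)).
        apply (RInt_correct (V := R_CompleteNormedModule)), (ex_RInt_continuous (V := R_CompleteNormedModule)).
        intros t. rewrite Rmin_left, Rmax_right by lra. intros Ht. apply norm_integrand_continuous; [exact Hal|exact Hr|lra].
      + evar_last; [apply (is_RInt_const (V := R_NormedModule) 0 T 0)|]. unfold scal; simpl; unfold mult; simpl. ring. }
  rewrite EJ in HL. set (j := RInt (norm_integrand al r) 0 T) in *.
  replace (g (RtoC r) - RtoC (radial_integral r / weight al r))%C
    with ((RtoC (j / weight al r) - RtoC (radial_integral r / weight al r)) - (RtoC (j / weight al r) - g (RtoC r)))%C by ring.
  eapply Rle_trans; [apply Cmod_minus_le|]. replace eps with (eps / 2 + eps / 2) by field.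
  apply Rplus_le_compat.
  - rewrite <- RtoC_minus, Cmod_R.
    replace (j / weight al r - radial_integral r / weight al r) with ((j - radial_integral r) / weight al r) by (field; lra).
    unfold Rdiv at 1. rewrite Rabs_mult, (Rabs_pos_eq (/ weight al r)) by (left; apply Rinv_0_lt_compat, W).
    apply Rle_div_l; [exact W|]. apply Rabs_le; lra.
  - eapply Rle_trans; [exact HL|]. apply Rle_trans with ((L + 1) * (eps / 2 / (L + 1))); [|right; field; lra].
    apply Rmult_le_compat; [exact HL0|left; apply Rpower_pos|lra|exact Hd'].
Qed.

Definition radial_sup : Rbar := Lub_Rbar (fun y => exists r, 0 <= r < 1 /\ y = radial_integral r).

Lemma radial_sup_ge (r : R) : 0 <= r < 1 -> Rbar_le (radial_integral r) radial_sup.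
Proof.
  intros Hr. destruct (Lub_Rbar_correct (fun y => exists r, 0 <= r < 1 /\ y = radial_integral r)) as [U _].
  apply U. exists r. split; [exact Hr|reflexivity].
Qed.

Lemma hilbert_defined (f : C -> C) (N : R) : 0 <= N -> holomorphic f ->
  (forall z, Cmod z < 1 -> weight al (Cmod z) * Cmod (f z) <= N) -> exists g, hilbert f g.
Proof.
  intros HN Hf Hle. destruct (holomorphic_taylor f Hf) as [a [Ha _]].
  exact (hilbert_exists f a al N Hal HN Hf Ha (korenblum_growth f N HN Hle)).
Qed.

Lemma hilbert_bounded : bounded_operator (korenblum_log al) (korenblum_log al)
  (korenblum_log_norm al) (korenblum_log_norm al) hilbert.
Proof.
  exists radial_bound. intros f [Hf Hfin]. apply analytic_holomorphic in Hf.
  destruct (korenblum_norm_finite f Hfin) as (N & EN & HN).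
  assert (Hle := proj1 (korenblum_norm_le f N) ltac:(rewrite EN; apply Rbar_le_refl)).
  destruct (hilbert_defined f N HN Hf Hle) as [g Hg].
  assert (Hgn : Rbar_le (korenblum_log_norm al g) (radial_bound * N)).
  { apply korenblum_norm_le. intros z Hz. eapply Rle_trans; [apply (hilbert_upper_bound f g N HN Hf Hle Hg z Hz)|].
    rewrite Rmult_comm. apply Rmult_le_compat_r; [exact HN|].
    apply (radial_integral_spec (Cmod z) (conj (Cmod_ge_0 z) Hz)). }
  exists g. split; [exact Hg|]. split.
  - split.
    + destruct Hg as (a & b & _ & _ & _ & H). exact H.
    + eapply Rbar_le_lt_trans; [exact Hgn|exact I].
  - rewrite EN. exact Hgn.
Qed.

Lemma hilbert_norm_eq : hilbert_korenblum_log_norm al = radial_sup.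
Proof.
  unfold hilbert_korenblum_log_norm, operator_norm, Rbar_lub.
  match goal with |- proj1_sig ?s = _ => destruct (proj2_sig s) as [U L]; set (S := proj1_sig s) in * end.
  assert (H0 := radial_integral_ge_0 0 ltac:(lra)).
  apply Rbar_le_antisym.
  - apply L. intros y (f & g & [Hf Hfin] & Hn & Hg & ->).
    apply analytic_holomorphic in Hf.
    assert (Hle := proj1 (korenblum_norm_le f 1) Hn).
    (* An infinite supremum bounds everything, and the value at r = 0 excludes minus infinity. *)
    destruct radial_sup as [s| |] eqn:Es.
    + apply korenblum_norm_le. intros z Hz.
      eapply Rle_trans; [apply (hilbert_upper_bound f g 1 ltac:(lra) Hf Hle Hg z Hz)|].
      rewrite Rmult_1_l. assert (X := radial_sup_ge (Cmod z) (conj (Cmod_ge_0 z) Hz)). rewrite Es in X. exact X.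
    + destruct (korenblum_log_norm al g); exact I.
    + assert (X := radial_sup_ge 0 ltac:(lra)). rewrite Es in X. contradiction.
  - destruct (Lub_Rbar_correct (fun y => exists r, 0 <= r < 1 /\ y = radial_integral r)) as [_ L'].
    apply L'. intros y (r & Hr & ->).
    (* The same function serves every r. *)
    destruct (extremal_function al Hal) as (f & Hf & Hle & Hx).
    destruct (hilbert_defined f 1 ltac:(lra) Hf Hle) as [g Hg].
    assert (Hn : Rbar_le (korenblum_log_norm al f) 1) by (apply korenblum_norm_le, Hle).
    apply Rbar_le_trans with (korenblum_log_norm al g).
    + assert (W := weight_pos al Hal r Hr).
      assert (E := hilbert_extremal f g r Hf Hr Hle Hx Hg).
      assert (Hmr : Cmod (RtoC r) = r) by (rewrite Cmod_R, Rabs_pos_eq; lra).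
      replace (radial_integral r) with (weight al (Cmod (RtoC r)) * Cmod (g (RtoC r))).
      * unfold korenblum_log_norm. match goal with |- Rbar_le _ (Lub_Rbar ?E) => destruct (Lub_Rbar_correct E) as [U' _] end.
        apply U'. exists (RtoC r). split; [unfold unit_disk; rewrite Hmr; lra|reflexivity].
      * rewrite E, Hmr, Cmod_R, Rabs_pos_eq; [field; lra|].
        apply Rdiv_le_0_compat; [apply radial_integral_ge_0, Hr|exact W].
    + apply U. exists f, g. split; [|split; [exact Hn|split; [exact Hg|reflexivity]]].
      split; [apply analytic_holomorphic, Hf|]. eapply Rbar_le_lt_trans; [exact Hn|exact I].
Qed.

End Norm.

(** * The lower bound *)

Section Reflection.
Variable al : R.
Hypothesis Hal : 0 < al < 1.

(** The substitution t = e^x / (1 + e^x) turns t^(al-1) (1 - t)^(-al) dt into h (x) dx on the real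
    line. The nearest pole above the axis is PI i, hence the restriction Im z < PI below. *)
Let h (z : C) : C := (cexp (RtoC al * z) / (1 + cexp z))%C.

Let one_plus_cexp_neq_0 (z : C) : 0 <= Im z < PI -> (1 + cexp z)%C <> 0%C.
Proof.
  intros Hz E. unfold cexp, RtoC, Cplus in E. cbn [fst snd] in E. injection E as E1 E2.
  assert (Ex := exp_pos (Re z)).
  destruct (Req_dec (Im z) 0) as [Y|Y].
  - rewrite Y, cos_0 in E1. lra.
  - assert (S := sin_gt_0 (Im z) ltac:(lra) ltac:(lra)).
    assert (0 < exp (Re z) * sin (Im z)) by (apply Rmult_lt_0_compat; assumption). lra.
Qed.

Let h_deriv (z : C) : 0 <= Im z < PI -> exists l, Cderiv h z l.
Proof.
  intros Hz. eexists. apply (Cderiv_div (fun z => cexp (RtoC al * z)) (fun z => 1 + cexp z)%C).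
  - apply one_plus_cexp_neq_0, Hz.
  - apply (Cderiv_comp cexp (fun z => RtoC al * z)%C); [apply Cderiv_cexp|apply Cderiv_linear].
  - apply Cderiv_plus; [apply Cderiv_const|apply Cderiv_cexp].
Qed.

Definition logistic_integrand (x : R) : R := exp (al * x) / (1 + exp x).

Lemma logistic_continuous (x : R) : continuous logistic_integrand x.
Proof.
  apply (ex_derive_continuous (V := R_NormedModule)). unfold logistic_integrand.
  auto_derive. generalize (exp_pos x). lra.
Qed.

(** Minus the imaginary part of exp (- i al th) h (x + i th). As th tends to PI the second factor
    concentrates at x = 0 with total mass tending to PI. *)
Let poisson (th x : R) : R := exp (al * x) * (sin th * exp x / ((exp x + cos th) ^ 2 + sin th ^ 2)).

Let poisson_den_pos (th x : R) : 0 < th < PI -> 0 < (exp x + cos th) ^ 2 + sin th ^ 2.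
Proof.
  intros Hth. assert (S := sin_gt_0 th ltac:(lra) ltac:(lra)).
  assert (0 <= (exp x + cos th) ^ 2) by apply pow2_ge_0. assert (0 < sin th ^ 2) by (apply pow_lt; lra). lra.
Qed.

Let poisson_continuous (th x : R) : 0 < th < PI -> continuous (poisson th) x.
Proof.
  intros Hth. assert (D := poisson_den_pos th x Hth).
  apply (ex_derive_continuous (V := R_NormedModule)). unfold poisson. auto_derive.
  change ((exp x + cos th) ^ 2 + sin th ^ 2 <> 0). lra.
Qed.

Let edge_bound (X y : R) : 0 <= y < PI -> X <> 0 -> Cmod (h (X, y)) <= exp (al * X) / Rabs (1 - exp X).
Proof.
  intros Hy HX. unfold h. rewrite Cmod_div by (apply one_plus_cexp_neq_0; exact Hy).
  rewrite Cmod_cexp. rewrite re_scal_l. cbn [Re fst].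
  apply Rmult_le_compat_l; [left; apply exp_pos|].
  assert (Hne : 1 - exp X <> 0).
  { intros E. apply HX. apply exp_inv. rewrite exp_0. lra. }
  apply Rinv_le_contravar; [apply Rabs_pos_lt, Hne|].
  assert (A1 := Cmod_triangle_minus 1 (- cexp (X, y))). assert (A2 := Cmod_triangle_minus (- cexp (X, y)) 1).
  rewrite Cmod_opp, Cmod_1, Cmod_cexp in A1, A2. cbn [Re fst] in A1, A2.
  rewrite Cmod_minus_sym in A2. replace (1 - - cexp (X, y))%C with (1 + cexp (X, y))%C in A1, A2 by ring.
  apply Rabs_le; lra.
Qed.

(* Cauchy's theorem on the rectangle [-X, X] x [0, th]; the imaginary part is taken after the rotation by exp (- i al th). *)
Let strip_identity (X th : R) : 0 < X -> 0 < th < PI ->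
  RInt (poisson th) (- X) X - PI * (exp (al * X) / (exp X - 1) + exp (al * - X) / (1 - exp (- X)))
   <= RInt logistic_integrand (- X) X * sin (al * th).
Proof.
  intros HX Hth.
  assert (Hd : forall z, in_rect (- X) X 0 th z -> exists l, Cderiv h z l).
  { intros z [_ Hz]. apply h_deriv. lra. }
  assert (Hc : forall z, in_rect (- X) X 0 th z -> Ccont_at h z).
  { intros z Hz. destruct (Hd z Hz) as [l Hl]. exact (Cderiv_Ccont _ _ _ Hl). }
  assert (G := goursat h (- X) X 0 th ltac:(lra) ltac:(lra) Hd). unfold rect_int in G.
  set (I0 := CInt (fun x => h (x, 0)) (- X) X) in G. set (It := CInt (fun x => h (x, th)) (- X) X) in G.
  set (JR := CInt (fun y => h (X, y)) 0 th) in G. set (JL := CInt (fun y => h (- X, y)) 0 th) in G.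
  assert (EI0 : I0 = RtoC (RInt logistic_integrand (- X) X)).
  { apply is_CInt_unique. apply (is_CInt_ext (fun x => RtoC (logistic_integrand x))).
    - intros x _. unfold h, logistic_integrand.
      replace (RtoC al * (x, 0))%C with ((al * x, 0) : C) by (unfold RtoC, Cmult; cbn [fst snd]; f_equal; ring).
      rewrite !cexp_pair, cis_0, !Cmult_1_r. rewrite RtoC_div by (generalize (exp_pos x); lra).
      rewrite RtoC_plus. reflexivity.
    - split; cbn [Re Im RtoC fst snd].
      + apply (RInt_correct (V := R_CompleteNormedModule)), (ex_RInt_continuous (V := R_CompleteNormedModule)).
        intros x _. apply logistic_continuous.
      + evar_last; [apply (is_RInt_const (V := R_NormedModule) (- X) X 0)|]. unfold scal; simpl; unfold mult; simpl. ring. }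
  set (u := cis (- (al * th))).
  assert (Eu : Im (u * It)%C = - RInt (poisson th) (- X) X).
  { assert (I : is_CInt (fun x => u * h (x, th))%C (- X) X (u * It)).
    { apply is_CInt_scal, CInt_correct_le; [lra|]. intros t Ht.
      apply (Ccont_curve_rect_h h (- X) X 0 th); [exact Hc|lra|exact Ht]. }
    destruct I as [_ I]. apply (is_RInt_unique (V := R_CompleteNormedModule)) in I. rewrite <- I.
    rewrite <- (RInt_opp (V := R_CompleteNormedModule)).
    - apply RInt_ext. intros x _. cbv beta.
      change (Im (u * h (x, th))%C = - poisson th x).
      assert (D := poisson_den_pos th x Hth).
      assert (E : (u * h (x, th))%C = (RtoC (exp (al * x)) / (1 + RtoC (exp x) * cis th))%C).
      { unfold h. replace (RtoC al * (x, th))%C with ((al * x, al * th) : C) by (unfold RtoC, Cmult; cbn [fst snd]; f_equal; ring).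
        rewrite !cexp_pair. unfold u. rewrite cis_opp.
        assert (N := one_plus_cexp_neq_0 (x, th) ltac:(cbn [Im snd]; lra)). rewrite cexp_pair in N.
        field. split; [exact N|apply cis_neq_0]. }
      rewrite E. unfold Cdiv. rewrite im_scal_l. unfold poisson.
          replace (Im (/ (1 + RtoC (exp x) * cis th))%C) with (- (exp x * sin th) / ((exp x + cos th) ^ 2 + sin th ^ 2)).
      + field. lra.
      + unfold Cinv, cis, RtoC, Cplus, Cmult, Im; cbn [fst snd].
        replace ((1 + (exp x * cos th - 0 * sin th)) ^ 2 + (0 + (exp x * sin th + 0 * cos th)) ^ 2)
          with ((exp x + cos th) ^ 2 + sin th ^ 2).
        * f_equal. ring.
        * assert (S := sin2_cos2 th). unfold Rsqr in S.
          replace ((1 + (exp x * cos th - 0 * sin th)) ^ 2 + (0 + (exp x * sin th + 0 * cos th)) ^ 2)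
            with (1 + 2 * exp x * cos th + exp x ^ 2 * (sin th * sin th + cos th * cos th)) by ring.
          replace ((exp x + cos th) ^ 2 + sin th ^ 2) with (exp x ^ 2 + 2 * exp x * cos th + (sin th * sin th + cos th * cos th)) by ring.
          rewrite S. ring.
    - apply (ex_RInt_continuous (V := R_CompleteNormedModule)). intros x _. apply poisson_continuous, Hth. }
  assert (Hedge : forall Y, Y <> 0 -> - X <= Y <= X -> Cmod (CInt (fun y => h (Y, y)) 0 th) <= PI * (exp (al * Y) / Rabs (1 - exp Y))).
  { intros Y HY HYX. set (b := exp (al * Y) / Rabs (1 - exp Y)).
    assert (Hb : 0 <= b) by (eapply Rle_trans; [apply Cmod_ge_0|apply (edge_bound Y 0); [lra|exact HY]]).
    apply Rle_trans with (b * (th - 0)).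
    - apply (Cmod_CInt_le_const (fun y => h (Y, y))); [lra| |].
      + apply CInt_correct_le; [lra|]. intros t Ht.
        apply (Ccont_curve_rect_v h (- X) X 0 th); [exact Hc|exact HYX|exact Ht].
      + intros t Ht. apply edge_bound; [lra|exact HY].
    - rewrite Rmult_comm, Rminus_0_r. apply Rmult_le_compat_r; lra. }
  assert (eX : 1 < exp X) by (rewrite <- exp_0; apply exp_increasing, HX).
  assert (enX : exp (- X) < 1) by (rewrite <- exp_0; apply exp_increasing; lra).
  assert (BR := Hedge X ltac:(lra) ltac:(lra)). assert (BL := Hedge (- X) ltac:(lra) ltac:(lra)).
  fold JR in BR. fold JL in BL. rewrite Rabs_left in BR by lra. rewrite Rabs_pos_eq in BL by lra.
  replace (- (1 - exp X)) with (exp X - 1) in BR by ring.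
  assert (E : (u * It - u * I0)%C = (u * Ci * (JR - JL))%C).
  { replace (u * Ci * (JR - JL))%C with (u * ((I0 + Ci * JR - It - Ci * JL) + It - I0))%C by ring. rewrite G. ring. }
  assert (Bd : Rabs (Im (u * It - u * I0)%C) <= Cmod JR + Cmod JL).
  { eapply Rle_trans; [apply im_le_Cmod|]. rewrite E, !Cmod_mult, Cmod_Ci. unfold u. rewrite Cmod_cis.
    eapply Rle_trans; [|apply Cmod_minus_le]. lra. }
  rewrite im_minus, Eu, EI0 in Bd.
  rewrite im_scal_r in Bd. unfold u, cis in Bd. cbn [Im snd] in Bd. rewrite sin_neg in Bd.
  assert (B2 := Rle_abs (- (- RInt (poisson th) (- X) X - - sin (al * th) * RInt logistic_integrand (- X) X))).
  rewrite Rabs_Ropp in B2. lra.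
Qed.

(** Positivity allows restriction to [- de, de], where e^(al x) >= e^(- al de). The remaining kernel
    has the antiderivative atan ((e^x + cos th) / sin th). *)
Let poisson_lower (X th de : R) : 0 < de <= X -> 0 < th < PI ->
  exp (- (al * de)) * (atan ((exp de + cos th) / sin th) - atan ((exp (- de) + cos th) / sin th)) <= RInt (poisson th) (- X) X.
Proof.
  intros Hde Hth. assert (S := sin_gt_0 th ltac:(lra) ltac:(lra)).
  assert (Hex : forall a b, ex_RInt (poisson th) a b).
  { intros a b. apply (ex_RInt_continuous (V := R_CompleteNormedModule)). intros x _. apply poisson_continuous, Hth. }
  assert (Hpos : forall x, 0 <= poisson th x).
  { intros x. unfold poisson. apply Rmult_le_pos; [left; apply exp_pos|].
    apply Rdiv_le_0_compat; [|apply poisson_den_pos, Hth]. apply Rmult_le_pos; [lra|left; apply exp_pos]. }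
  assert (C1 := RInt_Chasles (poisson th) (- X) (- de) X (Hex _ _) (Hex _ _)).
  assert (C2 := RInt_Chasles (poisson th) (- de) de X (Hex _ _) (Hex _ _)).
  unfold plus in C1, C2; simpl in C1, C2.
  assert (P1 : 0 <= RInt (poisson th) (- X) (- de)) by (apply RInt_ge_0; [lra|apply Hex|intros; apply Hpos]).
  assert (P2 : 0 <= RInt (poisson th) de X) by (apply RInt_ge_0; [lra|apply Hex|intros; apply Hpos]).
  apply Rle_trans with (RInt (poisson th) (- de) de); [|lra].
  set (k := fun x => sin th * exp x / ((exp x + cos th) ^ 2 + sin th ^ 2)).
  assert (Ik : is_RInt k (- de) de (atan ((exp de + cos th) / sin th) - atan ((exp (- de) + cos th) / sin th))).
  { apply (is_RInt_derive (V := R_CompleteNormedModule) (fun x => atan ((exp x + cos th) / sin th))).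
    - intros x _. assert (D := poisson_den_pos th x Hth). unfold k. auto_derive; [exact I|].
      field. split; lra.
    - intros x _. assert (D := poisson_den_pos th x Hth). apply (ex_derive_continuous (V := R_NormedModule)). unfold k. auto_derive.
      change ((exp x + cos th) ^ 2 + sin th ^ 2 <> 0). lra. }
  apply (is_RInt_le (fun x => exp (- (al * de)) * k x) (poisson th) (- de) de); [lra| | |].
  - apply (is_RInt_scal (V := R_NormedModule) k), Ik.
  - apply (RInt_correct (V := R_CompleteNormedModule)), Hex.
  - intros x Hx. unfold poisson. fold (k x). apply Rmult_le_compat_r.
    + unfold k. apply Rdiv_le_0_compat; [|apply poisson_den_pos, Hth]. apply Rmult_le_pos; [lra|left; apply exp_pos].
    + apply exp_le_compat. rewrite Ropp_mult_distr_r. apply Rmult_le_compat_l; lra.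
Qed.

Let atan_large (y : R) (eps : R) : 0 < eps < PI / 2 -> tan (PI / 2 - eps) <= y -> PI / 2 - eps <= atan y.
Proof.
  intros He Hy. rewrite <- (atan_tan (PI / 2 - eps)) by lra.
  destruct Hy as [Hy|Hy]; [left; apply atan_increasing, Hy|right; rewrite Hy; reflexivity].
Qed.

(** Let th = PI - y with y tending to 0. Then e^de - cos y stays positive and e^(- de) - cos y
    negative while sin y vanishes, so the two arctangents tend to PI / 2 and - PI / 2. *)
Let poisson_limit (X de : R) : 0 < de <= X ->
  exp (- (al * de)) * PI - PI * (exp (al * X) / (exp X - 1) + exp (al * - X) / (1 - exp (- X)))
   <= RInt logistic_integrand (- X) X * sin (al * PI).
Proof.
  intros Hde. assert (HP := PI_RGT_0).
  set (Fx := RInt logistic_integrand (- X) X). set (E := PI * _).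
  assert (HF : 0 <= Fx).
  { apply RInt_ge_0; [lra| |].
    - apply (ex_RInt_continuous (V := R_CompleteNormedModule)). intros x _. apply logistic_continuous.
    - intros x _. unfold logistic_integrand. apply Rdiv_le_0_compat; [left; apply exp_pos|generalize (exp_pos x); lra]. }
  apply le_epsilon. intros eps Heps.
  (* The two arctangents lose at most 2 e in total, and replacing sin (al (PI - y)) by sin (al PI)
     loses Fx e. *)
  set (e := Rmin (PI / 4) (eps / (2 + Fx + 1))).
  assert (He : 0 < e) by (apply Rmin_pos; [lra|apply Rdiv_lt_0_compat; lra]).
  assert (He1 : e <= PI / 4) by apply Rmin_l.
  assert (He2 : (2 + Fx + 1) * e <= eps).
  { apply Rle_trans with ((2 + Fx + 1) * (eps / (2 + Fx + 1))); [|right; field; lra].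
    apply Rmult_le_compat_l; [lra|apply Rmin_r]. }
  assert (e1 : 1 < exp de) by (rewrite <- exp_0; apply exp_increasing; lra).
  assert (e2 : exp (- de) < 1) by (rewrite <- exp_0; apply exp_increasing; lra).
  assert (e3 := exp_pos (- de)).
  destruct (continuous_eps_inv cos 0 (continuous_cos 0) ((1 - exp (- de)) / 2)) as [d1 [Hd1 H1]]; [lra|].
  destruct (continuous_eps_inv (fun y => sin (al * (PI - y))) 0) with (eps := e) as [d2 [Hd2 H2]]; [|exact He|].
  { apply (ex_derive_continuous (V := R_NormedModule)). auto_derive. exact I. }
  (* A lower bound for both e^de - cos y and cos y - e^(- de), once cos y is close enough to 1. *)
  set (m := Rmin (exp de - 1) ((1 - exp (- de)) / 2)).
  assert (Hm : 0 < m) by (apply Rmin_pos; lra).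
  assert (Hm1 : m <= exp de - 1) by apply Rmin_l. assert (Hm2 : m <= (1 - exp (- de)) / 2) by apply Rmin_r.
  set (tn := tan (PI / 2 - e)).
  assert (Htn : 0 < tn) by (apply tan_gt_0; lra).
  (* From sin y <= y <= m / tn both quotients exceed tn = tan (PI / 2 - e), so each arctangent is
     within e of its limit. *)
  set (y := Rmin (Rmin (PI / 2) (m / tn)) (Rmin (d1 / 2) (d2 / 2))).
  assert (Hy : 0 < y) by (repeat apply Rmin_pos; try lra; apply Rdiv_lt_0_compat; lra).
  assert (Y1 : y <= PI / 2) by (eapply Rle_trans; [apply Rmin_l|apply Rmin_l]).
  assert (Y2 : y <= m / tn) by (eapply Rle_trans; [apply Rmin_l|apply Rmin_r]).
  assert (Y3 : y <= d1 / 2) by (eapply Rle_trans; [apply Rmin_r|apply Rmin_l]).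
  assert (Y4 : y <= d2 / 2) by (eapply Rle_trans; [apply Rmin_r|apply Rmin_r]).
  specialize (H1 y ltac:(rewrite Rminus_0_r, Rabs_pos_eq; lra)). rewrite cos_0 in H1.
  specialize (H2 y ltac:(rewrite Rminus_0_r, Rabs_pos_eq; lra)). cbv beta in H2. rewrite Rminus_0_r in H2.
  apply Rabs_def2 in H1. apply Rabs_def2 in H2.
  assert (Hth : 0 < PI - y < PI) by lra.
  assert (S1 := strip_identity X (PI - y) ltac:(lra) Hth). fold Fx E in S1.
  assert (S2 := poisson_lower X (PI - y) de Hde Hth).
  rewrite Rtrigo_facts.cos_pi_minus, Rtrigo_facts.sin_pi_minus in S2.
  assert (Sy : 0 < sin y <= y).
  { split; [apply sin_gt_0; lra|]. left. apply sin_lt_x, Hy. }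
  assert (Hmy : forall w, m <= w -> tn <= w / sin y).
  { intros w Hw. apply (Rle_div_r tn w (sin y)); [lra|]. apply Rle_trans with m; [|exact Hw].
    apply Rle_trans with (tn * y); [apply Rmult_le_compat_l; lra|].
    apply Rle_trans with (tn * (m / tn)); [apply Rmult_le_compat_l; lra|right; field; lra]. }
  assert (A1 := atan_large ((exp de + - cos y) / sin y) e ltac:(lra) (Hmy (exp de + - cos y) ltac:(generalize (COS_bound y); lra))).
  assert (A2 := atan_large (- ((exp (- de) + - cos y) / sin y)) e ltac:(lra)).
  rewrite atan_opp in A2.
  specialize (A2 ltac:(replace (- ((exp (- de) + - cos y) / sin y)) with ((cos y - exp (- de)) / sin y) by (field; lra); apply Hmy; lra)).
  assert (Hex1 : exp (- (al * de)) <= 1).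
  { rewrite <- exp_0. apply exp_le_compat. assert (0 <= al * de) by (apply Rmult_le_pos; lra). lra. }
  assert (Hex0 := exp_pos (- (al * de))).
  assert (L1 : exp (- (al * de)) * (PI - 2 * e) <= RInt (poisson (PI - y)) (- X) X).
  { eapply Rle_trans; [|exact S2]. apply Rmult_le_compat_l; lra. }
  assert (L2 : exp (- (al * de)) * (2 * e) <= 1 * (2 * e)) by (apply Rmult_le_compat_r; lra).
  assert (L3 : Fx * sin (al * (PI - y)) <= Fx * (sin (al * PI) + e)) by (apply Rmult_le_compat_l; lra).
  nra.
Qed.

(** The edge terms decay like e^((al - 1) X) and e^(- al X), that is, at least like e^(- m X) with m
    the smaller of al and 1 - al. *)
Lemma logistic_integral_lower (eps : R) : 0 < eps -> exists X, 0 < X /\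
  (PI - eps) / sin (al * PI) <= RInt logistic_integrand (- X) X.
Proof.
  intros Heps. assert (HP := PI_RGT_0).
  assert (Hs : 0 < sin (al * PI)).
  { apply sin_gt_0; [apply Rmult_lt_0_compat; lra|]. rewrite <- (Rmult_1_l PI) at 2. apply Rmult_lt_compat_r; lra. }
  set (m := Rmin al (1 - al)). assert (Hm : 0 < m) by (apply Rmin_pos; lra).
  assert (Hm1 : m <= al) by apply Rmin_l. assert (Hm2 : m <= 1 - al) by apply Rmin_r.
  (* Through e^s >= 1 + s this brings the edge terms, at most 4 PI e^(- m X), below eps / 2; X >= 1
     ensures e^X >= 2. *)
  set (X := Rmax 1 (8 * PI / (m * eps))).
  assert (HX1 : 1 <= X) by apply Rmax_l. assert (HX2 : 8 * PI / (m * eps) <= X) by apply Rmax_r.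
  assert (Hme : 0 < m * eps) by (apply Rmult_lt_0_compat; lra).
  assert (Hsm : 8 * PI * exp (- (m * X)) <= eps).
  { rewrite exp_Ropp. apply Rle_div_l; [apply exp_pos|].
    assert (E := exp_ineq1_le (m * X)).
    apply Rle_trans with (eps * (m * X)); [|apply Rmult_le_compat_l; lra].
    apply Rle_trans with (m * eps * (8 * PI / (m * eps))); [right; field; lra|].
    replace (eps * (m * X)) with (m * eps * X) by ring. apply Rmult_le_compat_l; lra. }
  assert (e2 : 2 <= exp X).
  { generalize (exp_ineq1_le X). lra. }
  assert (e2' : exp (- X) <= 1 / 2).
  { rewrite exp_Ropp. replace (1 / 2) with (/ 2) by lra. apply Rinv_le_contravar; lra. }
  assert (T1 : exp (al * X) / (exp X - 1) <= 2 * exp (- (m * X))).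
  { apply Rle_div_l; [lra|]. apply Rle_trans with (2 * exp (- (m * X)) * (exp X / 2)).
    - replace (2 * exp (- (m * X)) * (exp X / 2)) with (exp (- (m * X)) * exp X) by field.
      rewrite <- exp_plus. apply exp_le_compat.
      assert ((al + m) * X <= 1 * X) by (apply Rmult_le_compat_r; lra). lra.
    - apply Rmult_le_compat_l; [generalize (exp_pos (- (m * X))); lra|lra]. }
  assert (T2 : exp (al * - X) / (1 - exp (- X)) <= 2 * exp (- (m * X))).
  { apply Rle_div_l; [lra|]. apply Rle_trans with (2 * exp (- (m * X)) * (1 / 2)).
    - replace (2 * exp (- (m * X)) * (1 / 2)) with (exp (- (m * X))) by field.
      apply exp_le_compat. assert (m * X <= al * X) by (apply Rmult_le_compat_r; lra). lra.
    - apply Rmult_le_compat_l; [generalize (exp_pos (- (m * X))); lra|lra]. }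
  (* The other half of eps: replacing e^(- al de) by 1 costs at most PI de. *)
  set (de := Rmin 1 (eps / (2 * PI))).
  assert (Hde : 0 < de) by (apply Rmin_pos; [lra|apply Rdiv_lt_0_compat; lra]).
  assert (Hde1 : de <= 1) by apply Rmin_l.
  assert (Hde2 : PI * de <= eps / 2).
  { apply Rle_trans with (PI * (eps / (2 * PI))); [apply Rmult_le_compat_l; [lra|apply Rmin_r]|right; field; lra]. }
  assert (L := poisson_limit X de ltac:(lra)).
  assert (Hexp : 1 - de <= exp (- (al * de))).
  { eapply Rle_trans; [|apply exp_ineq1_le]. assert (al * de <= 1 * de) by (apply Rmult_le_compat_r; lra). lra. }
  exists X. split; [lra|]. apply Rle_div_l; [exact Hs|].
  eapply Rle_trans; [|exact L].
  assert (PI * (1 - de) <= PI * exp (- (al * de))) by (apply Rmult_le_compat_l; lra).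
  assert (PI * (exp (al * X) / (exp X - 1) + exp (al * - X) / (1 - exp (- X))) <= PI * (4 * exp (- (m * X)))) by (apply Rmult_le_compat_l; lra).
  lra.
Qed.

(** * From the beta integral to the radial integrals *)

Definition beta_integrand (t : R) : R := Rpower t (al - 1) * Rpower (1 - t) (- al).

Let sigma (x : R) : R := exp x / (1 + exp x).

Let sigma_range (x : R) : 0 < sigma x < 1.
Proof.
  assert (E := exp_pos x). unfold sigma. split; [apply Rdiv_lt_0_compat; lra|apply Rlt_div_l; lra].
Qed.

(** Substitutes t = sigma x with sigma' = sigma (1 - sigma). A truncation in x becomes a compact
    interval inside (0, 1), on which the radial integrands can be bounded below uniformly. *)
Lemma beta_logistic (X : R) : 0 < X -> exists a b, 0 < a < b /\ b < 1 /\
  is_RInt beta_integrand a b (RInt logistic_integrand (- X) X).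
Proof.
  intros HX. exists (sigma (- X)), (sigma X).
  destruct (sigma_range X) as [S1 S2]. destruct (sigma_range (- X)) as [S3 S4].
  assert (Hlt : sigma (- X) < sigma X).
  { unfold sigma. assert (E1 := exp_pos X). assert (E2 := exp_pos (- X)).
    assert (E3 : exp (- X) < exp X) by (apply exp_increasing; lra).
    apply Rlt_div_l; [lra|]. apply Rmult_lt_reg_r with (1 + exp X); [lra|].
    replace (exp X / (1 + exp X) * (1 + exp (- X)) * (1 + exp X)) with (exp X * (1 + exp (- X))) by (field; lra). nra. }
  split; [split; assumption|]. split; [exact S2|].
  assert (Hc : forall t, 0 < t < 1 -> continuous beta_integrand t).
  { intros t Ht. apply (ex_derive_continuous (V := R_NormedModule)). unfold beta_integrand, Rpower. auto_derive. lra. }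
  assert (Hds : forall x, is_derive sigma x (sigma x * (1 - sigma x))).
  { intros x. assert (E := exp_pos x). unfold sigma. auto_derive; [lra|]. field. lra. }
  assert (Hsub : is_RInt (fun x => scal (sigma x * (1 - sigma x)) (beta_integrand (sigma x))) (- X) X (RInt beta_integrand (sigma (- X)) (sigma X))).
  { apply (is_RInt_comp (V := R_CompleteNormedModule) beta_integrand sigma (fun x => sigma x * (1 - sigma x))).
    - intros x _. apply Hc, sigma_range.
    - intros x _. split; [apply Hds|]. apply (ex_derive_continuous (V := R_NormedModule)).
      unfold sigma. auto_derive. generalize (exp_pos x). lra. }
  replace (RInt logistic_integrand (- X) X) with (RInt beta_integrand (sigma (- X)) (sigma X)).
  - apply (RInt_correct (V := R_CompleteNormedModule)), (ex_RInt_continuous (V := R_CompleteNormedModule)).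
    intros t. rewrite Rmin_left, Rmax_right by lra. intros Ht. apply Hc. lra.
  - symmetry. rewrite <- (is_RInt_unique _ _ _ _ Hsub). apply RInt_ext. intros x _.
    change (logistic_integrand x = sigma x * (1 - sigma x) * beta_integrand (sigma x)).
    destruct (sigma_range x) as [Q1 Q2]. assert (E := exp_pos x).
    unfold beta_integrand, logistic_integrand.
    replace (sigma x * (1 - sigma x) * (Rpower (sigma x) (al - 1) * Rpower (1 - sigma x) (- al)))
      with ((Rpower (sigma x) (al - 1) * sigma x) * (Rpower (1 - sigma x) (- al) * (1 - sigma x))) by ring.
    replace (sigma x) with (Rpower (sigma x) 1) at 2 by (apply Rpower_1; lra).
    replace (1 - sigma x) with (Rpower (1 - sigma x) 1) at 2 by (apply Rpower_1; lra).
    rewrite <- !Rpower_plus. replace (al - 1 + 1) with al by ring.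
    assert (L1 : ln (sigma x) = x - ln (1 + exp x)).
    { unfold sigma. rewrite ln_div, ln_exp by lra. reflexivity. }
    assert (L2 : ln (1 - sigma x) = - ln (1 + exp x)).
    { replace (1 - sigma x) with (/ (1 + exp x)) by (unfold sigma; field; lra). apply ln_Rinv. lra. }
    unfold Rpower. rewrite L1, L2, <- exp_plus.
    replace (al * (x - ln (1 + exp x)) + (- al + 1) * - ln (1 + exp x)) with (al * x + - ln (1 + exp x)) by ring.
    rewrite exp_plus, exp_Ropp, exp_ln by lra. reflexivity.
Qed.

(** The three losses have separate sources: (1 - r) / 2 from replacing 1 + r by 2, (1 - r) / a from
    replacing the denominator d by t, and the last one from the quotient of logarithms. Only the
    last is slow, of order 1 / ln (1 / (1 - r)). *)
Lemma norm_integrand_lower (a b r t : R) : 0 < a < b -> b < 1 -> 0 <= r < 1 -> a <= t <= b -> 1 - r <= a ->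
  ln (2 / ((1 - b) * a)) <= log_factor al r ->
  (1 - (1 - r) / 2 - (1 - r) / a - ln (2 / ((1 - b) * a)) / log_factor al r) * beta_integrand t <= norm_integrand al r t.
Proof.
  intros Hab Hb Hr Ht Hra HL.
  set (Cc := ln (2 / ((1 - b) * a))) in *.
  set (d := (t - 1) * r + 1). set (ph := t / (1 - (1 - t) * r)).
  destruct (den_bounds r Hr t ltac:(lra)) as (D1 & D2 & D3). fold d in D1, D2, D3.
  assert (D4 := den_upper r Hr t ltac:(lra)). cbv beta in D4. fold d in D4.
  assert (Ph := phi_range r Hr t ltac:(lra)). cbv beta in Ph. fold ph in Ph.
  assert (L1 := log_factor_ge_1 al Hal r Hr). assert (L2 := log_factor_ge_1 al Hal ph Ph).
  assert (Hba : 0 < (1 - b) * a) by (apply Rmult_lt_0_compat; lra).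
  assert (HC : 0 <= Cc).
  { unfold Cc. rewrite <- ln_1. apply ln_le; [lra|]. apply Rle_div_r; nra. }
  assert (LC : log_factor al ph <= log_factor al r + Cc).
  { rewrite !log_factor_eq by assumption.
    destruct (one_minus_sqr_pos r Hr) as [R1 R2]. destruct (one_minus_sqr_pos ph Ph) as [Q1 Q2].
    (* By the factorisation of 1 - ph^2 it is enough that d <= 1 and (1 - t) (d + t) >= (1 - b)
       a. *)
    assert (H : ln (1 - r ^ 2) <= ln ((1 - ph ^ 2) * (2 / ((1 - b) * a)))).
    { apply ln_le; [exact R1|]. unfold ph. rewrite (one_minus_phi_sqr r Hr t) by lra. fold d.
      replace ((1 - t) * (1 - r) * (d + t) / d ^ 2 * (2 / ((1 - b) * a)))
        with (((1 - r) * 2) * (((1 - t) * (d + t)) * / (d ^ 2 * ((1 - b) * a)))) by (field; lra).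
      replace (1 - r ^ 2) with ((1 - r) * (1 + r) * 1) by ring.
      assert (X : 1 <= (1 - t) * (d + t) * / (d ^ 2 * ((1 - b) * a))).
      { apply Rle_div_r; [apply Rmult_lt_0_compat; [apply pow_lt, D1|exact Hba]|].
        assert (d ^ 2 <= 1) by (simpl; nra).
        assert ((1 - b) * a <= (1 - t) * (d + t)) by (apply Rmult_le_compat; lra).
        assert (d ^ 2 * ((1 - b) * a) <= 1 * ((1 - b) * a)) by (apply Rmult_le_compat_r; lra). lra. }
      apply Rmult_le_compat; [apply Rmult_le_pos; lra|lra|apply Rmult_le_compat_l; lra|exact X]. }
    rewrite ln_mult in H by (try assumption; apply Rdiv_lt_0_compat; lra). fold Cc in H. lra. }
  assert (Eq : norm_integrand al r t = Rpower (1 + r) al * (Rpower d (2 * al - 1) * Rpower (d + t) (- al)) * Rpower (1 - t) (- al)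
     * (log_factor al r / log_factor al ph)).
  { unfold norm_integrand. fold d. fold ph. rewrite !Rpower_Ropp.
    assert (P1 := Rpower_pos (1 - t) al). assert (P3 := Rpower_pos (d + t) al).
    field. repeat split; lra. }
  rewrite Eq. unfold beta_integrand.
  set (x := (1 - r) / 2). set (y := (1 - r) / a). set (w := Cc / log_factor al r).
  assert (Hx : 0 <= x <= 1) by (unfold x; lra).
  assert (Hy : 0 <= y <= 1) by (unfold y; split; [apply Rdiv_le_0_compat; lra|apply Rle_div_l; lra]).
  assert (Hw : 0 <= w <= 1) by (unfold w; split; [apply Rdiv_le_0_compat; lra|apply Rle_div_l; lra]).
  assert (B1 : (1 - x) * Rpower d (al - 1) <= Rpower (1 + r) al * (Rpower d (2 * al - 1) * Rpower (d + t) (- al))).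
  (* From d + t <= 2 d the constant ((1 + r) / 2)^al splits off; its base 1 - x is at most 1, so its
     power al < 1 is at least 1 - x. *)
  { assert (H2d : Rpower (2 * d) (- al) <= Rpower (d + t) (- al)) by (apply Rpower_base_le_neg; lra).
    rewrite <- Rpower_mult_distr in H2d by lra.
    apply Rle_trans with (Rpower (1 + r) al * (Rpower d (2 * al - 1) * (Rpower 2 (- al) * Rpower d (- al)))).
    - replace (Rpower (1 + r) al * (Rpower d (2 * al - 1) * (Rpower 2 (- al) * Rpower d (- al))))
        with ((Rpower (1 + r) al * Rpower 2 (- al)) * (Rpower d (2 * al - 1) * Rpower d (- al))) by ring.
      rewrite <- Rpower_plus. replace (2 * al - 1 + - al) with (al - 1) by ring.
      apply Rmult_le_compat_r; [left; apply Rpower_pos|].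
      rewrite <- Rpower_inv_base, Rpower_mult_distr by lra.
      replace ((1 + r) * / 2) with (1 - x) by (unfold x; field).
      assert (Hx' : 0 < 1 - x <= 1) by (unfold x; lra).
      rewrite <- (Rpower_1 (1 - x)) at 1 by lra.
      unfold Rpower. apply exp_le_compat. assert (Ln := ln_le_0 (1 - x) Hx').
      assert (0 <= (1 - al) * - ln (1 - x)) by (apply Rmult_le_pos; lra). lra.
    - apply Rmult_le_compat_l; [left; apply Rpower_pos|]. apply Rmult_le_compat_l; [left; apply Rpower_pos|exact H2d]. }
  assert (B2 : (1 - y) * Rpower t (al - 1) <= Rpower d (al - 1)).
  (* As d <= t + (1 - r) and 1 - r = a y <= t y. Then (1 + y)^(al - 1) >= 1 / (1 + y) >= 1 - y. *)
  { assert (Hdt : d <= t * (1 + y)).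
    { assert (a * y <= t * y) by (apply Rmult_le_compat_r; lra).
      assert (a * y = 1 - r) by (unfold y; field; lra).
      rewrite Rmult_plus_distr_l, Rmult_1_r. lra. }
    apply Rle_trans with (Rpower (t * (1 + y)) (al - 1)); [|apply Rpower_base_le_neg; lra].
    rewrite <- Rpower_mult_distr by lra. rewrite Rmult_comm. apply Rmult_le_compat_l; [left; apply Rpower_pos|].
    apply Rle_trans with (Rpower (1 + y) (Ropp 1)).
    - rewrite Rpower_Ropp, Rpower_1 by lra. apply Rmult_le_reg_r with (1 + y); [lra|]. rewrite Rinv_l by lra. nra.
    - apply Rle_Rpower; lra. }
  assert (B3 : 1 - w <= log_factor al r / log_factor al ph).
  { apply Rle_div_r; [lra|].
    apply Rle_trans with ((1 - w) * (log_factor al r + Cc)); [apply Rmult_le_compat_l; lra|].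
    assert (Ew : w * log_factor al r = Cc) by (unfold w; field; lra).
    assert (0 <= w * Cc) by (apply Rmult_le_pos; lra). lra. }
  assert (P0 := Rpower_pos d (al - 1)). assert (P1 := Rpower_pos t (al - 1)). assert (P2 := Rpower_pos (1 - t) (- al)).
  assert (B4 : (1 - x) * (1 - y) * Rpower t (al - 1) <= Rpower (1 + r) al * (Rpower d (2 * al - 1) * Rpower (d + t) (- al))).
  { eapply Rle_trans; [|exact B1]. rewrite Rmult_assoc. apply Rmult_le_compat_l; lra. }
  assert (Hxy : 0 <= (1 - x) * (1 - y)) by (apply Rmult_le_pos; lra).
  apply Rle_trans with ((1 - x) * (1 - y) * Rpower t (al - 1) * Rpower (1 - t) (- al) * (1 - w)).
  - replace ((1 - x) * (1 - y) * Rpower t (al - 1) * Rpower (1 - t) (- al) * (1 - w))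
      with ((1 - x) * (1 - y) * (1 - w) * (Rpower t (al - 1) * Rpower (1 - t) (- al))) by ring.
    apply Rmult_le_compat_r; [apply Rmult_le_pos; lra|].
    assert (0 <= x * y * (1 - w)) by (apply Rmult_le_pos; [apply Rmult_le_pos; lra|lra]).
    assert (0 <= x * w) by (apply Rmult_le_pos; lra). assert (0 <= y * w) by (apply Rmult_le_pos; lra). lra.
  - apply Rmult_le_compat; [|lra| |exact B3].
    + apply Rmult_le_pos; [apply Rmult_le_pos; lra|lra].
    + apply Rmult_le_compat_r; [lra|exact B4].
Qed.

(** The part of the radial integral over [a, b] alone suffices, by positivity, once r is close
    enough to 1 for all three losses together to stay below eps. *)
Lemma radial_integral_lower (a b Iab eps : R) : 0 < a < b -> b < 1 -> is_RInt beta_integrand a b Iab -> 0 < eps ->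
  exists r, 0 <= r < 1 /\ (1 - eps) * Iab <= radial_integral al r.
Proof.
  intros Hab Hb HI Heps.
  set (Cc := ln (2 / ((1 - b) * a))).
  set (e := Rmin eps 1). assert (He : 0 < e <= 1) by (unfold e; split; [apply Rmin_pos; lra|apply Rmin_r]).
  assert (Hee : e <= eps) by apply Rmin_l.
  assert (HC : 0 <= Cc).
  { unfold Cc. rewrite <- ln_1. apply ln_le; [lra|]. apply Rle_div_r; nra. }
  (* The first bound keeps the two algebraic losses within e / 2 in total. The second gives 1 - r^2
     <= 2 s <= exp (- 2 Cc / e), hence a logarithm of at least 2 Cc / e and a logarithmic loss of at
     most e / 2. *)
  set (s := Rmin (a * e / 4) (exp (- (2 * Cc / e)) / 2)).
  assert (Hs0 : 0 < s).
  { apply Rmin_pos; [|generalize (exp_pos (- (2 * Cc / e))); lra]. assert (0 < a * e) by (apply Rmult_lt_0_compat; lra). lra. }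
  assert (Hs1 : s <= a * e / 4) by apply Rmin_l. assert (Hs2 : s <= exp (- (2 * Cc / e)) / 2) by apply Rmin_r.
  assert (Hae : a * e <= a * 1) by (apply Rmult_le_compat_l; lra).
  set (r := 1 - s). assert (Hr : 0 <= r < 1) by (unfold r; lra).
  assert (HL : 2 * Cc / e <= log_factor al r).
  { rewrite log_factor_eq by assumption. destruct (one_minus_sqr_pos r Hr) as [R1 R2].
    assert (ln (1 - r ^ 2) <= ln (exp (- (2 * Cc / e)))).
    { apply ln_le; [exact R1|]. apply Rle_trans with (2 * s); [unfold r; simpl; nra|lra]. }
    rewrite ln_exp in H. assert (P := ln_2_pos). assert (0 < / al) by (apply Rinv_0_lt_compat; lra). lra. }
  assert (L1 := log_factor_ge_1 al Hal r Hr).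
  assert (HL2 : Cc <= e / 2 * log_factor al r).
  { apply Rle_trans with (e / 2 * (2 * Cc / e)); [right; field; lra|apply Rmult_le_compat_l; lra]. }
  assert (HL3 : Cc <= log_factor al r).
  { apply Rle_trans with (e / 2 * log_factor al r); [exact HL2|].
    assert (e / 2 * log_factor al r <= 1 * log_factor al r) by (apply Rmult_le_compat_r; lra). lra. }
  exists r. split; [exact Hr|].
  destruct (radial_integral_spec al Hal r Hr) as (_ & Hint & _).
  set (k := norm_integrand al r) in *.
  assert (Hex : forall u v, 0 <= u -> u <= v -> v < 1 -> ex_RInt k u v).
  { intros u v Hu Huv Hv. apply (ex_RInt_continuous (V := R_CompleteNormedModule)).
    intros x. rewrite Rmin_left, Rmax_right by lra. intros Hx. apply norm_integrand_continuous; [exact Hal|exact Hr|lra]. }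
  assert (C1 := RInt_Chasles k 0 a b (Hex 0 a ltac:(lra) ltac:(lra) ltac:(lra)) (Hex a b ltac:(lra) ltac:(lra) ltac:(lra))).
  change (RInt k 0 a + RInt k a b = RInt k 0 b) in C1.
  assert (P1 : 0 <= RInt k 0 a).
  { apply RInt_ge_0; [lra|apply Hex; lra|]. intros x Hx. left. apply norm_integrand_pos; [exact Hal|exact Hr|lra]. }
  assert (Hb0 : forall t, a < t < b -> 0 <= beta_integrand t) by (intros; unfold beta_integrand; apply Rmult_le_pos; left; apply Rpower_pos).
  assert (L : (1 - e) * Iab <= RInt k a b).
  { apply (is_RInt_le (fun t => (1 - e) * beta_integrand t) k a b); [lra| | |].
    - apply (is_RInt_scal (V := R_NormedModule) beta_integrand), HI.
    - apply (RInt_correct (V := R_CompleteNormedModule)), Hex; lra.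
    - intros t Ht. eapply Rle_trans; [|apply (norm_integrand_lower a b r t Hab Hb Hr); [lra|unfold r; lra|exact HL3]].
      apply Rmult_le_compat_r; [apply Hb0, Ht|]. fold Cc.
      assert ((1 - r) / a <= e / 4).
      { apply Rle_div_l; [lra|]. unfold r. lra. }
      assert (Cc / log_factor al r <= e / 2) by (apply Rle_div_l; lra).
      assert (a * e <= 1 * e) by (apply Rmult_le_compat_r; lra).
      assert (1 - r = s) by (unfold r; ring). lra. }
  assert (HI0 : 0 <= Iab) by (apply (is_RInt_ge_0 beta_integrand a b); [lra|exact HI|exact Hb0]).
  specialize (Hint b ltac:(lra)).
  assert ((1 - eps) * Iab <= (1 - e) * Iab) by (apply Rmult_le_compat_r; lra). lra.
Qed.

Lemma radial_sup_lower : Rbar_le (PI / sin (al * PI)) (radial_sup al).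
Proof.
  assert (HP := PI_RGT_0).
  assert (Hs : 0 < sin (al * PI)).
  { apply sin_gt_0; [apply Rmult_lt_0_compat; lra|]. rewrite <- (Rmult_1_l PI) at 2. apply Rmult_lt_compat_r; lra. }
  assert (X0 := radial_sup_ge al 0 ltac:(lra)).
  destruct (radial_sup al) as [S| |] eqn:ES; [|exact I|contradiction].
  assert (Hup : forall r, 0 <= r < 1 -> radial_integral al r <= S).
  { intros r Hr. assert (X := radial_sup_ge al r Hr). rewrite ES in X. exact X. }
  simpl. apply le_epsilon. intros eps Heps.
  destruct (logistic_integral_lower (eps / 2 * sin (al * PI))) as [X [HX HXl]]; [apply Rmult_lt_0_compat; lra|].
  replace ((PI - eps / 2 * sin (al * PI)) / sin (al * PI)) with (PI / sin (al * PI) - eps / 2) in HXl by (field; lra).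
  destruct (beta_logistic X HX) as (a & b & Hab & Hb & HI).
  set (J := RInt logistic_integrand (- X) X) in *.
  set (e := eps / 2 / (Rabs J + 1)).
  (* The tolerance e is relative to J, so that e J <= eps / 2; the other eps / 2 was spent on
     approximating PI / sin (al PI) by J. *)
  assert (HJ := Rabs_pos J).
  destruct (radial_integral_lower a b J e Hab Hb HI) as (r & Hr & Hlow); [apply Rdiv_lt_0_compat; lra|].
  specialize (Hup r Hr).
  assert (e * J <= eps / 2).
  { apply Rle_trans with (e * (Rabs J + 1)); [|right; unfold e; field; lra].
    apply Rmult_le_compat_l; [left; apply Rdiv_lt_0_compat; lra|generalize (Rle_abs J); lra]. }
  lra.
Qed.

End Reflection.

Theorem theorem4p1 (alpha : R) (halpha : 0 < alpha < 1) :
  bounded_operator (korenblum_log alpha) (korenblum_log alpha)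
    (korenblum_log_norm alpha) (korenblum_log_norm alpha) hilbert /\
  (forall r : R, 0 <= r < 1 ->
     ex_RInt_gen (norm_integrand alpha r) (at_point 0) (at_left 1)) /\
  hilbert_korenblum_log_norm alpha =
    Lub_Rbar (fun y : R => exists r : R, 0 <= r < 1 /\
      y = RInt_gen (norm_integrand alpha r) (at_point 0) (at_left 1)) /\
  Rbar_le (Finite (PI / sin (alpha * PI))) (hilbert_korenblum_log_norm alpha).
Proof.
  split; [apply hilbert_bounded, halpha|]. split; [|split].
  - intros r Hr. exists (radial_integral alpha r). apply (radial_integral_spec alpha halpha r Hr).
  - apply hilbert_norm_eq, halpha.
  - rewrite (hilbert_norm_eq alpha halpha). apply radial_sup_lower, halpha.
Qed.
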